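(* Let $\Gamma$ and $\Delta$ be countable discrete groups that are amenably measure equivalent. (1) If one of them has the Haagerup property, then the other one has the same property. (2) The following equalities hold: $\Lambda_{\mathrm{WA}}(\Gamma)=\Lambda_{\mathrm{WA}}(\Delta)$ and $\Lambda_{\mathrm{WH}}(\Gamma)=\Lambda_{\mathrm{WH}}(\Delta)$.
   Context: Amenable pair. If a group $G$ acts in a measure class preserving way on a standard measure space $(X,\mu)$, then $(G,X)$ is an amenable pair if $L^\infty(X,\mu)$ has a $G$-invariant state. Amenable measure equivalence. Countable discrete groups $\Gamma$ and $\Delta$ are amenably measure equivalent if there exist commuting, measure-preserving, free actions of $\Gamma$ (on the left) and $\Delta$ (on the right) on some infinite-measure ($\sigma$-finite) standard space $(\Sigma,\sigma)$ such that the pairs $(\Gamma,\Sigma/\Delta)$ and $(\Delta,\Gamma\backslash\Sigma)$ are both amenable pairs. Here the quotients $\Sigma/\Delta$ and $\Gamma\backslash\Sigma$ admit Borel cross-sections to $\Sigma$, with ranges $X$ and $Y$ respectively, so that $\Sigma=\bigsqcup_{\delta\in\Delta}X\delta=\bigsqcup_{\gamma\in\Gamma}\gamma Y$, and the quotients are regarded as standard measure spaces via the identifications with $(X,\sigma|_X)$ and $(Y,\sigma|_Y)$ (these measures are not required to be finite). Function algebras (for a countable discrete group $G$; continuity is then automatic and compact sets are finite sets). $C_0(G)$ is the space of complex functions on $G$ tending to $0$ at infinity. The Fourier algebra $A(G)$ is the set of coefficient functions $g\mapsto\langle\lambda(g)\xi|\eta\rangle$, $\xi,\eta\in\ell^2(G)$,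 of the left regular representation $\lambda$. $B_2(G)$ is the set of Herz-Schur multipliers, i.e. functions $u:G\to\mathbb C$ for which there exist a separable Hilbert space $\mathcal H$ and bounded functions $\xi,\eta:G\to\mathcal H$ with $u(h^{-1}g)=\langle\xi(g)|\eta(h)\rangle$ for all $g,h\in G$, with norm $\Vert u\Vert_{B_2}=\inf\Vert\xi\Vert_\infty\Vert\eta\Vert_\infty$ over all such representations. Properties. $G$ has the Haagerup property if there is a sequence $(u_n)_{n\ge1}$ of normalized ($u_n(1)=1$) positive definite functions in $C_0(G)$ with $u_n\to1$ uniformly on compact (i.e. finite) subsets of $G$. $\Lambda_{\mathrm{WA}}(G)$ is the infimum of all $C\ge1$ for which there is a sequence $(u_n)$ in $A(G)$ with $\Vert u_n\Vert_{B_2}\le C$ for all $n$ and $u_n\to1$ uniformly on compact sets ($=\infty$ if there is no such $C$). $\Lambda_{\mathrm{WH}}(G)$ is the infimum of all $C\ge1$ for which there is a sequence $(u_n)$ in $B_2(G)\cap C_0(G)$ with $\Vert u_n\Vert_{B_2}\le C$ for all $n$ and $u_n\to1$ uniformly on compact sets ($=\infty$ if there is no such $C$). *)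

(* Defs.v *)
From HB Require Import structures.
From mathcomp Require Import all_boot all_order all_algebra sesquilinear finmap.
From mathcomp Require Import complex.
From mathcomp Require Import all_classical all_reals all_analysis.

Set Implicit Arguments.
Unset Strict Implicit.
Unset Printing Implicit Defensive.

Import Order.TTheory GRing.Theory Num.Theory.
Import numFieldNormedType.Exports.

Local Open Scope classical_set_scope.
Local Open Scope ring_scope.
Local Open Scope complex_scope.

Section Actions.
Variables (G : groupType) (d : measure_display) (T : measurableType d).

(* Left actions of G on a subset X of T; the values of [a g] outside X are
   irrelevant. *)
Definition left_action_on (X : set T) (a : G -> T -> T) : Prop :=
  [/\ forall g x, X x -> X (a g x),
      forall x, X x -> a 1%g x = x &
      forall g h x, X x -> a (g * h)%g x = a g (a h x)].

Definition right_action (r : T -> G -> T) : Prop :=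
  (forall x, r x 1%g = x) /\ (forall g h x, r x (g * h)%g = r (r x g) h).

Definition left_of_right (r : T -> G -> T) : G -> T -> T :=
  fun g x => r x (g^-1)%g.

Definition free_action (a : G -> T -> T) : Prop :=
  forall g x, a g x = x -> g = 1%g.

(* T is the disjoint union, over g in G, of the translates of the Borel set X;
   equivalently, X is the range of a Borel cross-section of T -> T / G. *)
Definition fundamental_domain (a : G -> T -> T) (X : set T) : Prop :=
  [/\ measurable X,
      \bigcup_(g in [set: G]) (a g @` X) = [set: T] &
      trivIset [set: G] (fun g => a g @` X)].

(* The representative in X of the G-orbit of z (unique when X is a
   fundamental domain). *)
Definition orbit_rep (a : G -> T -> T) (X : set T) (z : T) : T :=
  xget z [set x | X x /\ exists g, a g z = x].

End Actions.

(* If b acts on T, commuting with a, and X is a fundamental domain for a, this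
   is the action induced by b on the orbit space of a, carried over to X. *)
Definition quotient_action (G H : groupType) (d : measure_display)
    (T : measurableType d) (a : G -> T -> T) (X : set T) (b : H -> T -> T) :
    H -> T -> T :=
  fun h x => orbit_rep a X (b h x).

Section Measure.
Variables (R : realType) (d : measure_display) (T : measurableType d).

Definition standard_borel : Prop :=
  exists (P : completePseudoMetricType R) (f : T -> P),
    [/\ hausdorff_space P,
        exists2 D : set P, countable D & dense D,
        bijective f &
        forall A : set P, <<s @open P >> A <-> measurable (f @^-1` A)].

Variable mu : {measure set T -> \bar R}.

Definition measure_preserving (f : T -> T) : Prop :=
  measurable_fun [set: T] f /\
  forall A, measurable A -> mu (f @^-1` A) = mu A.

(* Below, X is a measurable subset of T standing for the measure space
   (X, mu restricted to X). *)
Definition nonsingular_action_on (G : groupType) (X : set T)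
    (a : G -> T -> T) : Prop :=
  [/\ left_action_on X a,
      forall g, measurable_fun X (a g) &
      forall g A, measurable A -> A `<=` X ->
        (mu (X `&` a g @^-1` A) = 0%E <-> mu A = 0%E)].

(* Representatives of the elements of the complex space L^oo(X, mu). *)
Definition Linfty (X : set T) (f : T -> R[i]) : Prop :=
  [/\ measurable_fun X (fun x => complex.Re (f x)),
      measurable_fun X (fun x => complex.Im (f x)) &
      exists M : R, {ae mu, forall x, X x -> `|f x| <= M%:C}].

(* A state of L^oo(X, mu), seen as a functional on representatives; its values
   outside Linfty are irrelevant. *)
Record Linfty_state (X : set T) (m : (T -> R[i]) -> R[i]) : Prop := {
  state_ae : forall f g, Linfty X f -> Linfty X g ->
    {ae mu, forall x, X x -> f x = g x} -> m f = m g ;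
  state_linear : forall (c : R[i]) f g, Linfty X f -> Linfty X g ->
    m (fun x => c * f x + g x) = c * m f + m g ;
  state_ge0 : forall f, Linfty X f ->
    {ae mu, forall x, X x -> 0 <= f x} -> 0 <= m f ;
  state_unit : m (fun=> 1) = 1 }.

Definition amenable_pair (G : groupType) (X : set T) (a : G -> T -> T) : Prop :=
  nonsingular_action_on X a /\
  exists2 m, Linfty_state X m &
    forall g f, Linfty X f -> m (f \o a g) = m f.

End Measure.

Record amenable_coupling (R : realType) (Gam Del : groupType)
    (d : measure_display) (T : measurableType d)
    (sigma : {measure set T -> \bar R})
    (l : Gam -> T -> T) (r : T -> Del -> T) (X Y : set T) : Prop := {
  coupling_standard : standard_borel R T ;
  coupling_sigma_finite : sigma_finite [set: T] sigma ;
  coupling_infinite : sigma [set: T] = +oo%E ;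
  coupling_left : left_action_on [set: T] l ;
  coupling_right : right_action r ;
  coupling_commute : forall g x h, l g (r x h) = r (l g x) h ;
  coupling_left_mp : forall g, measure_preserving sigma (l g) ;
  coupling_right_mp : forall h, measure_preserving sigma (r^~ h) ;
  coupling_left_free : free_action l ;
  coupling_right_free : free_action (left_of_right r) ;
  coupling_right_domain : fundamental_domain (left_of_right r) X ;
  coupling_left_domain : fundamental_domain l Y ;
  coupling_left_amenable :
    amenable_pair sigma X (quotient_action (left_of_right r) X l) ;
  coupling_right_amenable :
    amenable_pair sigma Y (quotient_action l Y (left_of_right r)) }.

Definition amenably_measure_equivalent (R : realType) (Gam Del : groupType) :
    Prop :=
  exists (d : measure_display) (T : measurableType d)
    (sigma : {measure set T -> \bar R})
    (l : Gam -> T -> T) (r : T -> Del -> T) (X Y : set T),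
    amenable_coupling sigma l r X Y.

Section Hilbert.
Variables (R : realType) (V : lmodType R[i]).
(* ip is linear in its first argument and conjugate linear in its second. *)
Variable ip : {dot V for (@Num.conj R[i])}.

Definition hnorm (x : V) : R := Num.sqrt (complex.Re (ip x x)).

Definition hilbert_complete : Prop :=
  forall u : nat -> V,
    (forall e : R, 0 < e -> exists N, forall m n, (N <= m)%N -> (N <= n)%N ->
      hnorm (u m - u n) < e) ->
    exists l : V, (fun n => hnorm (u n - l)) @ \oo --> (0 : R).

Definition hilbert_separable : Prop :=
  exists2 D : set V, countable D &
    forall (x : V) (e : R), 0 < e -> exists2 y, D y & hnorm (x - y) < e.

Definition hbounded (G : Type) (xi : G -> V) : Prop :=
  exists M : R, forall g, hnorm (xi g) <= M.

(* Only meaningful for bounded xi. *)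
Definition sup_hnorm (G : Type) (xi : G -> V) : R :=
  sup (range (fun g => hnorm (xi g))).

End Hilbert.

Section FunctionAlgebras.
Variables (R : realType) (G : groupType).
Implicit Types (u xi eta f : G -> R[i]).

Definition C0 u : Prop :=
  forall e : R, 0 < e -> finite_set [set g | e%:C <= `|u g|].

Definition positive_definite u : Prop :=
  forall (n : nat) (g : 'I_n -> G) (c : 'I_n -> R[i]),
    0 <= \sum_(i < n) \sum_(j < n)
           c i * Num.conj (c j) * u ((g j)^-1 * g i)%g.

(* Unordered summation. *)
Definition has_sum f (s : R[i]) : Prop :=
  forall e : R, 0 < e -> exists K0 : {fset G}, forall K : {fset G},
    (K0 `<=` K)%fset -> `|\sum_(h <- K) f h - s| < e%:C.

Definition l2 xi : Prop :=
  (\esum_(g in [set: G]) (complex.Re (`|xi g| ^+ 2))%:E < +oo)%E.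

Definition left_regular (g : G) xi : G -> R[i] := fun h => xi (g^-1 * h)%g.

Definition fourier_algebra u : Prop :=
  exists xi eta, [/\ l2 xi, l2 eta &
    forall g, has_sum (fun h => left_regular g xi h * Num.conj (eta h)) (u g)].

Definition herz_schur_rep u (V : lmodType R[i])
    (ip : {dot V for (@Num.conj R[i])}) (xi eta : G -> V) : Prop :=
  [/\ hilbert_complete ip, hilbert_separable ip,
      hbounded ip xi, hbounded ip eta &
      forall g h : G, u (h^-1 * g)%g = ip (xi g) (eta h)].

Definition B2 u : Prop :=
  exists (V : lmodType R[i]) (ip : {dot V for (@Num.conj R[i])})
    (xi eta : G -> V), herz_schur_rep u ip xi eta.

(* Equal to +oo when u is not in B2. *)
Definition B2_norm u : \bar R :=
  ereal_inf [set x | exists (V : lmodType R[i])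
    (ip : {dot V for (@Num.conj R[i])}) (xi eta : G -> V),
    herz_schur_rep u ip xi eta /\
    x = (sup_hnorm ip xi * sup_hnorm ip eta)%:E].

Definition cvg_to_one (u : nat -> G -> R[i]) : Prop :=
  forall K : set G, finite_set K -> forall e : R, 0 < e ->
    \forall n \near \oo, forall g, K g -> `|u n g - 1| < e%:C.

Definition haagerup : Prop :=
  exists u : nat -> G -> R[i],
    [/\ forall n, u n 1%g = 1,
        forall n, positive_definite (u n),
        forall n, C0 (u n) &
        cvg_to_one u].

Definition Lambda_WA : \bar R :=
  ereal_inf [set C%:E | C in [set C : R | 1 <= C /\
    exists u : nat -> G -> R[i],
      [/\ forall n, fourier_algebra (u n),
          forall n, (B2_norm (u n) <= C%:E)%E &
          cvg_to_one u]]].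

Definition Lambda_WH : \bar R :=
  ereal_inf [set C%:E | C in [set C : R | 1 <= C /\
    exists u : nat -> G -> R[i],
      [/\ forall n, B2 (u n) /\ C0 (u n),
          forall n, (B2_norm (u n) <= C%:E)%E &
          cvg_to_one u]]].

End FunctionAlgebras.

(* Main.v *)
Require Import Defs.
From HB Require Import structures.
From mathcomp Require Import all_boot all_order all_algebra sesquilinear finmap.
From mathcomp Require Import complex ring lra.
From mathcomp Require Import all_classical all_reals all_analysis measurable_realfun.

(** Write the right action of [Del] as a left one, so that commuting left
    actions [a] of [Gam] and [b] of [Del] preserve the measure of a space [T],
    and let X be a fundamental domain of [b].  Functions on X are the same as
    [b]-invariant functions on [T], and on these [Gam] acts through [a].  Let
    [c z] be the element of [Del] that moves [z] into X; then
    [c (b h z) = c z * h^-1].  A function [u] on [Del] and a nonnegative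
    [b]-invariant [f] of norm 1 in L^2(X) induce the function
      [transfer f u g] = integral over X of
                         u (c z * (c (g^-1 z))^-1) * f (g^-1 z) * f z
    on [Gam], and everything rests on three properties of it.

    Positivity.  The kernel [transfer f u (h^-1 * g)] is an integral of
    kernels K (x g, x h) * v g * v h with K the kernel of [u], x with values
    in [Del] and v real, and such kernels are positive when K is.  Hence a
    positive definite [u] has a positive definite transfer.  Describing
    Herz-Schur multipliers as corner blocks of positive kernels on two copies
    of the group reduces their norm to the diagonal of such kernels, so the
    transfer does not increase it ([positive_definite_transfer],
    [herz_schur_transfer]).  A Cholesky factorization, which exhibits every
    positive kernel on a countable set as a Gram matrix in l^2, translates
    between the kernels and the Hilbert space representations
    ([psd_realize], [B2_norm_herz_schur], [herz_schur_B2_norm]).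

    Approximation.  When [u] tends to 1 pointwise and boundedly,
    [transfer f u g] tends to the integral of f (g^-1 z) * f z, which is close
    to 1 when [f] is almost invariant under [g].  Almost invariant vectors
    come from the invariant state by an argument of Kesten type
    ([almost_invariant_vectors]).  Without them the averaging operator P of a
    finite symmetric set S contracts L^2(X) strictly, so for some q < 1 the
    series F = sum of q^-n P^n f0 with f0 > 0 converges almost everywhere, and
    P F <= q F.  The functions c_s = ln (F o s) - ln F are bounded and the mean
    of c_(s^-1) is the opposite of that of c_s, so their sum over S has mean 0.
    But ln x <= x - 1 and P F <= q F bound this sum above by a negative
    constant ([no_contracted_function]).

    Decay.  A fundamental domain Y of [a] serves to multiply [f] by a cut-off
    function, which changes it little in norm, so that finitely supported [u]
    have finitely supported transfers
    ([transfer_cut_finite_support]).  By approximation the transfer of a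
    function tending to 0 at infinity tends to 0 at infinity
    ([transfer_C0]).  For the Fourier algebra finitely supported functions are
    enough: they belong to it and approximate each of its elements in the
    Herz-Schur norm ([fourier_of_finite_support], [fourier_finite_approx]).

    So the existence of an invariant state on X carries the approximation
    properties of [Del] over to [Gam], without loss in the constants.  The
    state on Y gives the converse, with the two actions exchanged. *)

Set Implicit Arguments.
Unset Strict Implicit.
Unset Printing Implicit Defensive.

Import Order.TTheory GRing.Theory Num.Theory.
Import numFieldNormedType.Exports.

Local Open Scope classical_set_scope.
Local Open Scope ring_scope.
Local Open Scope complex_scope.

(** * Positive kernels and their Cholesky factorization *)

Section PsdKernels.
Variable R : realType.
Local Notation C := R[i].
Local Notation cj := (@Num.conj C).

Lemma cjE (z : C) : cj z = (complex.Re z) -i* (complex.Im z).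
Proof. by case: z. Qed.

Lemma mulcjE (z : C) : z * cj z = (complex.Re z ^+ 2 + complex.Im z ^+ 2)%:C.
Proof.
by case: z => a b; rewrite cjE; apply/eqP; rewrite eq_complex /=; apply/andP;
  split; apply/eqP; ring.
Qed.

(** The families are lists, possibly with repeated points, so that pulling a
    kernel back along any map only relabels them. *)
Definition psd (S : Type) (K : S -> S -> C) : Prop :=
  forall L : seq (C * S),
    0 <= \sum_(p <- L) \sum_(q <- L) p.1 * cj q.1 * K p.2 q.2.

Section Basic.
Variables (S : Type) (K : S -> S -> C).
Hypothesis Kpsd : psd K.

Lemma psd_diag_ge0 s : 0 <= K s s.
Proof.
have := Kpsd [:: (1, s)]; rewrite !big_cons !big_nil /= !addr0.
by rewrite rmorph1 !mul1r.
Qed.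

Lemma psd_pair a s b t :
  0 <= a * cj a * K s s + a * cj b * K s t + b * cj a * K t s + b * cj b * K t t.
Proof.
have := Kpsd [:: (a, s); (b, t)]; rewrite !big_cons !big_nil /= !addr0.
by rewrite !addrA.
Qed.

(** The form takes real values at the coefficients (1, 1) and ('i, 1), which
    yields the imaginary and the real part of the identity. *)
Lemma psd_herm s t : K t s = cj (K s t).
Proof.
have Hs := ger0_Im (psd_diag_ge0 s); have Ht := ger0_Im (psd_diag_ge0 t).
have := ger0_Im (psd_pair 1 s 1 t); have := ger0_Im (psd_pair 'i s 1 t).
move: Hs Ht; rewrite !cjE.
case: (K s s) (K t t) (K s t) (K t s) => [a b] [c d] [x y] [z w] /= -> -> H1 H2.
apply/eqP; rewrite eq_complex /=; apply/andP; split; apply/eqP; lra.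
Qed.

(** The Cauchy-Schwarz inequality, for equal bounds on the diagonal. *)
Lemma psd_bound (c : R) s t :
  K s s <= c%:C -> K t t <= c%:C -> `|K s t| <= c%:C.
Proof.
move=> Hs Ht; have [->|nz] := eqVneq (K s t) 0.
  by rewrite normr0 (le_trans (psd_diag_ge0 s)).
have n0 : `|K s t| != 0 by rewrite normr_eq0.
(* With this phase both cross terms equal the opposite of the norm of K s t. *)
have := psd_pair 1 s (- (K s t / `|K s t|)) t.
rewrite rmorphN rmorphM /= rmorph1 fmorphV /= (psd_herm s t) !mul1r !mulr1.
rewrite !(mulNr, mulrN) opprK.
have -> : cj `|K s t| = `|K s t| by apply: conj_Creal; apply: normr_real.
have E : K s t * cj (K s t) = `|K s t| ^+ 2 by rewrite normCK.
have -> : cj (K s t) / `|K s t| * K s t = `|K s t|.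
  by rewrite mulrAC [cj _ * _]mulrC E expr2 mulfK.
have -> : K s t / `|K s t| * cj (K s t) = `|K s t|.
  by rewrite mulrAC E expr2 mulfK.
have -> : K s t / `|K s t| * (cj (K s t) / `|K s t|) = 1.
  by rewrite mulrACA E -invfM -expr2 mulfV // expf_neq0.
rewrite mul1r => H.
have H2 : `|K s t| *+ 2 <= c%:C *+ 2.
  rewrite mulr2n -subr_ge0.
  have -> : c%:C *+ 2 - (`|K s t| + `|K s t|) =
    (c%:C - K s s) + (c%:C - K t t) + (K s s - `|K s t| - `|K s t| + K t t).
    by rewrite mulr2n; ring.
  by apply: addr_ge0 => //; apply: addr_ge0; rewrite subr_ge0.
by move: H2; rewrite lerMn2r.
Qed.

(** If [K t t = 0], the form is affine in the coefficient of [t], hence takes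
    negative values unless its linear part vanishes. *)
Lemma psd_diag0 s t : K t t = 0 -> K s t = 0.
Proof.
move=> t0; pose m := K s t * cj (K s t); pose k := K s s.
have k0 : 0 <= k := psd_diag_ge0 s.
have m0 : 0 <= m by rewrite /m mul_conjC_ge0.
have k1 : 0 < k + 1 by rewrite ltr_wpDl.
(* At the coefficients x and - K s t the form is x^2 k - 2 x m, which is
   negative for x = m / (k + 1) unless m = 0. *)
pose x := m / (k + 1).
have x0 : 0 <= x by rewrite divr_ge0 // ltW.
have := psd_pair x s (- K s t) t.
rewrite t0 mulr0 addr0 (psd_herm s t).
have -> : cj x = x by apply: conj_Creal; rewrite ger0_real.
have -> : x * x * K s s + x * cj (- K s t) * K s t + - K s t * x * cj (K s t) =
   - (x * (m + m / (k + 1))).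
  rewrite rmorphN /= -/k.
  have -> : x * x * k = x * m - x * (m / (k + 1)).
    by rewrite /x; field; rewrite gt_eqF.
  by rewrite /m; ring.
rewrite oppr_ge0 => H.
have : m == 0.
  apply/negPn/negP => nm.
  have mp : 0 < m by rewrite lt_def nm m0.
  have xp : 0 < x by rewrite divr_gt0.
  have : 0 < x * (m + m / (k + 1)) by rewrite mulr_gt0 // addr_gt0.
  by rewrite (le_gtF H).
by rewrite mul_conjC_eq0 => /eqP.
Qed.

(** The Schur complement.  If [K s0 s0 = 0], the correction is 0 because the
    inverse of 0 is 0; by [psd_diag0] row [s0] then vanishes already. *)
Definition schur s0 s t := K s t - K s s0 * K s0 t / K s0 s0.

(** The form of the Schur complement is the minimum of the form of [K] over
    the coefficient of [s0]. *)
Lemma psd_schur s0 : psd (schur s0).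
Proof.
move=> L.
pose A := \sum_(p <- L) p.1 * K p.2 s0.
have Ac : \sum_(q <- L) cj q.1 * K s0 q.2 = cj A.
  rewrite /A rmorph_sum /=; apply: eq_bigr => q _.
  by rewrite rmorphM /= -psd_herm.
pose k := K s0 s0.
have ck : cj k = k by rewrite /k -psd_herm.
(* This coefficient of s0 minimizes the form. *)
have := Kpsd ((- (A / k), s0) :: L).
rewrite big_cons big_cons /=.
under [X in _ + X + _]eq_bigr => q _ do rewrite -mulrA.
rewrite -mulr_sumr Ac.
under [X in _ + X]eq_bigr => p _ do rewrite big_cons /=.
rewrite big_split /=.
under [X in _ + (X + _)]eq_bigr => p _ do rewrite mulrAC.
rewrite -mulr_suml -/A -/k.
congr (0 <= _).
rewrite /schur; under [RHS]eq_bigr => p _ do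
  (under eq_bigr => q _ do
    (rewrite mulrBr; have -> : p.1 * cj q.1 * (K p.2 s0 * K s0 q.2 / K s0 s0) =
       (p.1 * K p.2 s0 / k) * (cj q.1 * K s0 q.2) by rewrite /k; ring);
   rewrite big_split /= sumrN -mulr_sumr Ac).
rewrite big_split /= sumrN -!mulr_suml -/A addrA [RHS]addrC; congr (_ + _).
rewrite !rmorphN !rmorphM /= fmorphV /= ck.
have [->|k0] := eqVneq k 0; first by rewrite invr0 !mulr0 oppr0 !mul0r !mulr0 !addr0 oppr0.
by field.
Qed.

End Basic.

Section Cholesky.
Variable K : nat -> nat -> C.
Hypothesis Kpsd : psd K.

Fixpoint schur_iter n := if n is m.+1 then schur (schur_iter m) m else K.

Lemma psd_schur_iter n : psd (schur_iter n).
Proof. by elim: n => [//|n IH]; apply: psd_schur. Qed.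

(** A step of the elimination clears its own row and leaves the cleared rows
    at zero. *)
Lemma schur_iter_eq0 n i j : (i < n)%N -> schur_iter n i j = 0.
Proof.
elim: n i j => [//|n IH] i j; rewrite ltnS leq_eqVlt => /orP[/eqP->|lin] /=; last first.
  by rewrite /schur (IH i j lin) (IH i n lin) !mul0r subr0.
rewrite /schur; have [z|nz] := eqVneq (schur_iter n n n) 0.
  have e : schur_iter n n j = 0.
    by rewrite (psd_herm (psd_schur_iter n) j n)
      (psd_diag0 (psd_schur_iter n) _ z) rmorph0.
  by rewrite e mulr0 mul0r subr0.
by rewrite mulrAC mulfV // mul1r subrr.
Qed.

(** The Cholesky factor; a zero pivot makes the whole column zero. *)
Definition chol i k : C := schur_iter k i k / sqrtC (schur_iter k k k).

Lemma chol_eq0 i k : (i < k)%N -> chol i k = 0.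
Proof. by move=> lik; rewrite /chol schur_iter_eq0 // mul0r. Qed.

(** Step k of the elimination removes the rank-one kernel of column k of
    [chol], and nothing is left of row i after i + 1 steps. *)
Lemma cholE n i j : (i < n)%N -> K i j = \sum_(k < n) chol i k * cj (chol j k).
Proof.
suff H : K i j = \sum_(k < n) chol i k * cj (chol j k) + schur_iter n i j.
  by move=> lin; rewrite H schur_iter_eq0 ?addr0.
elim: n => [|n ->]; first by rewrite big_ord0 add0r.
rewrite big_ord_recr /= -addrA; congr (_ + _).
have d0 := psd_diag_ge0 (psd_schur_iter n) n.
have e : chol i n * cj (chol j n) =
    schur_iter n i n * schur_iter n n j / schur_iter n n n.
  rewrite /chol rmorphM /= -(psd_herm (psd_schur_iter n)) fmorphV /=.
  have -> : cj (sqrtC (schur_iter n n n)) = sqrtC (schur_iter n n n).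
    by apply: conj_Creal; rewrite ger0_real // sqrtC_ge0.
  by rewrite mulrACA -invfM -expr2 sqrtCK.
by rewrite e /schur addrC subrK.
Qed.

End Cholesky.
End PsdKernels.

(** * The Hilbert space of square-summable sequences *)

Section EllTwo.
Variable R : realType.
Local Notation C := R[i].
Local Notation cj := (@Num.conj C).

Definition sqn (z : C) : R := complex.Re z ^+ 2 + complex.Im z ^+ 2.

Lemma sqn_ge0 z : 0 <= sqn z.
Proof. by rewrite addr_ge0 ?sqr_ge0. Qed.

Lemma sqn0 : sqn 0 = 0. Proof. by rewrite /sqn /= expr0n addr0. Qed.

Lemma sqn_eq0 z : sqn z = 0 -> z = 0.
Proof.
case: z => a b /eqP; rewrite /sqn /= paddr_eq0 ?sqr_ge0 // !sqrf_eq0.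
by case/andP => /eqP -> /eqP ->.
Qed.

Lemma sqnD z w : sqn (z + w) <= 2 * (sqn z + sqn w).
Proof.
case: z w => a b [c d]; rewrite /sqn /=.
have := sqr_ge0 (a - c); have := sqr_ge0 (b - d); nra.
Qed.

Lemma sqnM z w : sqn (z * w) = sqn z * sqn w.
Proof. by case: z w => a b [c d]; rewrite /sqn /=; ring. Qed.

Lemma sqnN z : sqn (- z) = sqn z.
Proof. by case: z => a b; rewrite /sqn /= !sqrrN. Qed.

Lemma Re_mulcj (z w : C) : `|complex.Re (z * cj w)| <= sqn z + sqn w.
Proof.
case: z w => a b [c d]; rewrite cjE /sqn /= ler_norml.
have := sqr_ge0 (a - c); have := sqr_ge0 (b - d).
have := sqr_ge0 (a + c); have := sqr_ge0 (b + d).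
move=> *; apply/andP; split; nra.
Qed.

Lemma Im_mulcj (z w : C) : `|complex.Im (z * cj w)| <= sqn z + sqn w.
Proof.
case: z w => a b [c d]; rewrite cjE /sqn /= ler_norml.
have := sqr_ge0 (a - d); have := sqr_ge0 (b - c).
have := sqr_ge0 (a + d); have := sqr_ge0 (b + c).
move=> *; apply/andP; split; nra.
Qed.

Lemma Re_sum I (r : seq I) (P : pred I) (F : I -> C) :
  complex.Re (\sum_(i <- r | P i) F i) = \sum_(i <- r | P i) complex.Re (F i).
Proof. by apply: (big_morph (@complex.Re R)) => // -[? ?] []. Qed.

Lemma Im_sum I (r : seq I) (P : pred I) (F : I -> C) :
  complex.Im (\sum_(i <- r | P i) F i) = \sum_(i <- r | P i) complex.Im (F i).
Proof. by apply: (big_morph (@complex.Im R)) => // -[? ?] []. Qed.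

Implicit Types f g x y : nat -> C.

(** Real and imaginary parts are summed separately, which makes the theory of
    real series available. *)
Definition csummable f : Prop :=
  cvgn (series (fun n => complex.Re (f n))) /\
  cvgn (series (fun n => complex.Im (f n))).

Definition csum f : C :=
  (limn (series (fun n => complex.Re (f n)))) +i*
  (limn (series (fun n => complex.Im (f n)))).

Lemma csum_linear a f g : csummable f -> csummable g ->
  csummable (fun n => a * f n + g n) /\
  csum (fun n => a * f n + g n) = a * csum f + csum g.
Proof.
case=> fr fi [gr gi]; case: a => a b.
have E1 : (fun n => complex.Re ((a +i* b) * f n + g n)) =
    a *: (fun n => complex.Re (f n)) - b *: (fun n => complex.Im (f n))
      + (fun n => complex.Re (g n)).
  by apply/funext => n; rewrite /= !fctE; case: (f n) (g n) => p q [r s].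
have E2 : (fun n => complex.Im ((a +i* b) * f n + g n)) =
    a *: (fun n => complex.Im (f n)) + b *: (fun n => complex.Re (f n))
      + (fun n => complex.Im (g n)).
  by apply/funext => n; rewrite /= !fctE; case: (f n) (g n) => p q [r s].
rewrite /csummable /csum E1 E2.
have afr := is_cvg_seriesZ (k := a) fr; have bfi := is_cvg_seriesZ (k := b) fi.
have afi := is_cvg_seriesZ (k := a) fi; have bfr := is_cvg_seriesZ (k := b) fr.
have c1 := is_cvg_seriesB afr bfi; have c2 := is_cvg_seriesD afi bfr.
split; first by split; apply: is_cvg_seriesD.
rewrite (lim_seriesD c1 gr) (lim_seriesD c2 gi) (lim_seriesB afr bfi).
rewrite (lim_seriesD afi bfr) !lim_seriesZ //.
Qed.

Lemma csum_conj f : csummable f ->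
  csummable (fun n => cj (f n)) /\ csum (fun n => cj (f n)) = cj (csum f).
Proof.
case=> fr fi.
have E1 : (fun n => complex.Re (cj (f n))) = (fun n => complex.Re (f n)).
  by apply/funext => n; rewrite cjE.
have E2 : (fun n => complex.Im (cj (f n))) = - (fun n => complex.Im (f n)).
  by apply/funext => n; rewrite cjE.
rewrite /csummable /csum E1 E2 is_cvg_seriesN lim_seriesN //.
Qed.

Lemma cvg_series_fin (u : nat -> R) N : (forall n, (N <= n)%N -> u n = 0) ->
  series u @ \oo --> \sum_(k < N) u k.
Proof.
move=> u0; apply: cvg_near_cst; exists N => // n /= Nn.
rewrite /series /= -(big_mkord xpredT u) (big_cat_nat _ Nn) //=.
rewrite big_mkord [X in _ + X]big1_seq ?addr0 // => i /=.
by rewrite mem_index_iota => /andP[/u0].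
Qed.

Lemma csum_fin f N : (forall n, (N <= n)%N -> f n = 0) ->
  csummable f /\ csum f = \sum_(k < N) f k.
Proof.
move=> f0.
have cr := @cvg_series_fin (fun n => complex.Re (f n)) N.
have ci := @cvg_series_fin (fun n => complex.Im (f n)) N.
have {}cr := cr (fun n h => congr1 (@complex.Re R) (f0 n h)).
have {}ci := ci (fun n h => congr1 (@complex.Im R) (f0 n h)).
split; first by split; [apply: cvgP cr | apply: cvgP ci].
rewrite /csum (cvg_lim _ cr) // (cvg_lim _ ci) //.
apply/eqP; rewrite eq_complex /=; apply/andP; split; apply/eqP.
  by rewrite /= Re_sum.
by rewrite /= Im_sum.
Qed.

Definition sqsum_le x (M : R) : Prop := forall n, \sum_(k < n) sqn (x k) <= M.

Definition sqsummable x : Prop := exists M, sqsum_le x M.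

Lemma sqsummableP x : sqsummable x <-> cvgn (series (fun n => sqn (x n))).
Proof.
split=> [[M xM]|cx].
  apply: nondecreasing_is_cvgn; first exact: nondecreasing_series (fun n _ _ => sqn_ge0 _).
  by exists M => _ [n _ <-]; rewrite /series /= big_mkord.
exists (limn (series (fun n => sqn (x n)))) => n.
rewrite -(big_mkord xpredT (fun k => sqn (x k))).
apply: (@nondecreasing_cvgn_le _ (series (fun n => sqn (x n)))) => //.
exact: nondecreasing_series (fun n _ _ => sqn_ge0 _).
Qed.

Lemma csummable_dom f (h : nat -> R) : (forall n, 0 <= h n) -> cvgn (series h) ->
  (forall n, `|complex.Re (f n)| <= h n) -> (forall n, `|complex.Im (f n)| <= h n) ->
  csummable f.
Proof.
move=> h0 ch fr fi; split; apply: normed_cvg.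
  exact: (series_le_cvg (fun n => normr_ge0 _) h0 fr ch).
exact: (series_le_cvg (fun n => normr_ge0 _) h0 fi ch).
Qed.

Lemma csummable_mul x y : sqsummable x -> sqsummable y ->
  csummable (fun n => x n * cj (y n)).
Proof.
move=> /sqsummableP cx /sqsummableP cy.
apply: (@csummable_dom _ ((fun n => sqn (x n)) + (fun n => sqn (y n)))).
- by move=> n; rewrite /= addr_ge0 // sqn_ge0.
- exact: is_cvg_seriesD.
- by move=> n; apply: Re_mulcj.
- by move=> n; apply: Im_mulcj.
Qed.

(** The scalars are regular modules here, so that sequences form a module over
    the complex numbers. *)
Definition l2pred : {pred (nat -> C^o)} := fun x => `[< sqsummable x >].

Lemma l2_submod : submod_closed l2pred.
Proof.
split.
  rewrite unfold_in; apply/asboolP; exists 0 => n.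
  by rewrite big1 // => i _; rewrite sqn0.
move=> a x y; rewrite !unfold_in => /asboolP [M xM] /asboolP [N yN].
apply/asboolP; exists (2 * (sqn a * M + N)) => n.
apply: (@le_trans _ _ (\sum_(k < n) 2 * (sqn a * sqn (x k) + sqn (y k)))).
  by apply: ler_sum => i _; rewrite -sqnM; apply: sqnD.
rewrite -mulr_sumr; apply: ler_wpM2l => //.
rewrite big_split -mulr_sumr /=; apply: lerD; last exact: yN.
by apply: ler_wpM2l; [apply: sqn_ge0 | apply: xM].
Qed.

HB.instance Definition _ := GRing.isSubmodClosed.Build C (nat -> C^o) l2pred l2_submod.

Record ell2 := Ell2 { ell2_val :> nat -> C^o ; ell2P : ell2_val \in l2pred }.
HB.instance Definition _ := [isSub for ell2_val].
HB.instance Definition _ := [Choice of ell2 by <:].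
HB.instance Definition _ := [SubChoice_isSubLmodule of ell2 by <:].

Lemma ell2_sqsum (x : ell2) : sqsummable x.
Proof. by have := ell2P x; rewrite unfold_in => /asboolP. Qed.

Definition mk_ell2 x (hx : sqsummable x) : ell2 := @Ell2 x (asboolT hx).

Definition ell2_ip (x y : ell2) : C := csum (fun n => x n * cj (y n)).

Lemma ell2_ip_bilinear : bilinear_for
  (GRing.Scale.Law.clone _ _ ( *%R : C -> C -> C) _)
  (GRing.Scale.Law.clone _ _ (cj \; *%R : C -> C -> C) _) ell2_ip.
Proof.
split=> [y a x x'|x a y y'] /=; rewrite /ell2_ip.
  rewrite -(csum_linear a (csummable_mul (ell2_sqsum x) (ell2_sqsum y))
    (csummable_mul (ell2_sqsum x') (ell2_sqsum y))).2.
  by congr csum; apply/funext => n; rewrite /= mulrDl -mulrA.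
rewrite -(csum_linear (cj a) (csummable_mul (ell2_sqsum x) (ell2_sqsum y))
    (csummable_mul (ell2_sqsum x) (ell2_sqsum y'))).2.
congr csum; apply/funext => n.
have -> : (a *: y + y') n = a * y n + y' n by [].
by rewrite rmorphD rmorphM /= mulrDr mulrCA.
Qed.

HB.instance Definition _ := @bilinear_isBilinear.Build C ell2 ell2 C
  _ _ ell2_ip ell2_ip_bilinear.

Lemma ell2_ip_herm (x y : ell2) : ell2_ip x y = (-1) ^+ false * cj (ell2_ip y x).
Proof.
rewrite expr0 mul1r /ell2_ip.
rewrite -(csum_conj (csummable_mul (ell2_sqsum y) (ell2_sqsum x))).2.
by congr csum; apply/funext => n; rewrite rmorphM /= conjCK mulrC.
Qed.

HB.instance Definition _ := @isHermitianSesquilinear.Build C ell2 false cj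
  ell2_ip ell2_ip_herm.

Lemma ell2_ipxx (x : ell2) : ell2_ip x x = (limn (series (fun n => sqn (x n))))%:C.
Proof.
rewrite /ell2_ip /csum.
have -> : (fun n => complex.Re (x n * cj (x n))) = (fun n => sqn (x n)).
  by apply/funext => n; rewrite mulcjE.
have -> : (fun n => complex.Im (x n * cj (x n))) = (fun n => 0).
  by apply/funext => n; rewrite mulcjE.
have -> : series (fun=> 0 : R) = (fun=> 0).
  by apply/funext => n; rewrite /series /= big1.
by rewrite lim_cst.
Qed.

Lemma sqsum_lim (x : ell2) : sqsum_le x (limn (series (fun n => sqn (x n)))).
Proof.
move=> n; rewrite -(big_mkord xpredT (fun k => sqn (x k))).
apply: (@nondecreasing_cvgn_le _ (series (fun n => sqn (x n)))).
  exact: nondecreasing_series (fun n _ _ => sqn_ge0 _).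
by apply/sqsummableP; apply: ell2_sqsum.
Qed.

Lemma ell2_ip_gt0 (x : ell2) : x != 0 -> 0 < ell2_ip x x.
Proof.
move=> x0; rewrite ell2_ipxx ltcR.
have [n xn] : exists n, x n != 0.
  apply: contrapT => H; move/eqP: x0; apply.
  apply: val_inj; apply/funext => n /=; apply: contrapT => /eqP xn.
  by apply: H; exists n.
have := sqsum_lim x n.+1; rewrite big_ord_recr /=; apply: lt_le_trans.
rewrite ltr_pwDr //; last by apply: sumr_ge0 => i _; apply: sqn_ge0.
rewrite lt_def sqn_ge0 andbT; apply/eqP => /sqn_eq0 /eqP.
by rewrite (negbTE xn).
Qed.

HB.instance Definition _ := @isDotProduct.Build C ell2 ell2_ip ell2_ip_gt0.

Definition ell2_dot : {dot ell2 for cj} := ell2_ip.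

End EllTwo.

Section EllTwoHilbert.
Variable R : realType.
Local Notation C := R[i].
Local Notation cj := (@Num.conj C).
Local Notation dot := (ell2_dot R).
Local Notation ell2 := (ell2 R).
Implicit Types x y : ell2.

Lemma hnorm_ge0 x : 0 <= hnorm dot x. Proof. exact: sqrtr_ge0. Qed.

Lemma hnorm_ell2E x : hnorm dot x = Num.sqrt (limn (series (fun n => sqn (x n)))).
Proof.
rewrite /hnorm; congr (Num.sqrt _).
by have /(congr1 (@complex.Re R)) := ell2_ipxx x.
Qed.

Lemma ell2_hnorm_le x (e : R) : 0 <= e ->
  sqsum_le x (e ^+ 2) -> hnorm dot x <= e.
Proof.
move=> e0 xe; rewrite hnorm_ell2E -[leRHS](ger0_norm e0) -sqrtr_sqr.
apply: ler_wsqrtr.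
apply: limr_le; first by apply/sqsummableP; apply: ell2_sqsum.
by apply: nearW => n; rewrite /series /= big_mkord.
Qed.

Lemma ell2_hnorm_ge x : sqsum_le x (hnorm dot x ^+ 2).
Proof.
rewrite hnorm_ell2E sqr_sqrtr; first exact: sqsum_lim.
have := sqsum_lim x 0; by rewrite big_ord0.
Qed.

Lemma sqn_le_hnorm x k : sqn (x k) <= hnorm dot x ^+ 2.
Proof.
apply: le_trans (ell2_hnorm_ge x k.+1); rewrite big_ord_recr /= lerDr.
by apply: sumr_ge0 => i _; apply: sqn_ge0.
Qed.

Lemma Re_le_hnorm x k : `|complex.Re (x k)| <= hnorm dot x.
Proof.
rewrite -(ger0_norm (hnorm_ge0 x)) -ler_sqr ?nnegrE ?normr_ge0 // !real_normK ?num_real //.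
by apply: le_trans (sqn_le_hnorm x k); rewrite lerDl sqr_ge0.
Qed.

Lemma Im_le_hnorm x k : `|complex.Im (x k)| <= hnorm dot x.
Proof.
rewrite -(ger0_norm (hnorm_ge0 x)) -ler_sqr ?nnegrE ?normr_ge0 // !real_normK ?num_real //.
by apply: le_trans (sqn_le_hnorm x k); rewrite lerDr sqr_ge0.
Qed.

Lemma real_cauchy (a : nat -> R) :
  (forall e, 0 < e -> exists N, forall m n, (N <= m)%N -> (N <= n)%N ->
     `|a m - a n| < e) -> cvgn a.
Proof.
move=> H; apply/cauchy_cvgP/cauchy_exP => e e0.
have [N HN] := H e e0; exists (a N); exists N => // n /= Nn.
by rewrite -ball_normE /=; apply: HN.
Qed.

Lemma cvg_sqr_dist (a : nat -> R) (c : R) : cvgn a ->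
  (fun n => (c - a n) ^+ 2) @ \oo --> (c - limn a) ^+ 2.
Proof.
move=> ca; have H : (fun n => c - a n) @ \oo --> c - limn a.
  by apply: cvgB => //; apply: cvg_cst.
have -> : (fun n => (c - a n) ^+ 2) = (fun n => c - a n) \* (fun n => c - a n).
  by apply/funext => n; rewrite expr2.
by rewrite expr2; exact: (cvgM H H).
Qed.

Lemma cvg_sqn_dist (z : nat -> C) (w : C) :
  cvgn (fun n => complex.Re (z n)) -> cvgn (fun n => complex.Im (z n)) ->
  (fun n => sqn (w - z n)) @ \oo --> sqn (w -
    ((limn (fun n => complex.Re (z n))) +i* (limn (fun n => complex.Im (z n))))).
Proof.
move=> cr ci.
have -> : (fun n => sqn (w - z n)) =
  (fun n => (complex.Re w - complex.Re (z n)) ^+ 2) \+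
  (fun n => (complex.Im w - complex.Im (z n)) ^+ 2).
  by apply/funext => n; rewrite /= /sqn; case: w (z n) => ? ? [].
case: w => a b; apply: cvgD; [exact: cvg_sqr_dist cr | exact: cvg_sqr_dist ci].
Qed.

(** The limit is taken coordinate by coordinate; it is a limit in norm because
    the Cauchy estimate bounds all partial sums, and these only involve
    finitely many coordinates. *)
Lemma ell2_complete : hilbert_complete dot.
Proof.
move=> u cu.
have cr k : cvgn (fun n => complex.Re (u n k)).
  apply: real_cauchy => e e0; have [N HN] := cu e e0; exists N => m n Nm Nn.
  apply: le_lt_trans (HN m n Nm Nn).
  apply: le_trans (Re_le_hnorm (u m - u n) k).
  have -> : (u m - u n) k = u m k - u n k by [].
  by case: (u m k) (u n k) => ? ? [].
have ci k : cvgn (fun n => complex.Im (u n k)).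
  apply: real_cauchy => e e0; have [N HN] := cu e e0; exists N => m n Nm Nn.
  apply: le_lt_trans (HN m n Nm Nn).
  apply: le_trans (Im_le_hnorm (u m - u n) k).
  have -> : (u m - u n) k = u m k - u n k by [].
  by case: (u m k) (u n k) => ? ? [].
pose l k : C := (limn (fun n => complex.Re (u n k))) +i*
                (limn (fun n => complex.Im (u n k))).
have Hl e : 0 < e -> exists N, forall m, (N <= m)%N ->
    sqsum_le (fun k => u m k - l k) (e ^+ 2).
  move=> e0; have [N HN] := cu e e0; exists N => m Nm K.
  have cK : (fun n => \sum_(k < K) sqn (u m k - u n k)) @ \oo -->
      \sum_(k < K) sqn (u m k - l k).
    apply: cvg_big; first exact: add_continuous.
    by move=> k _; apply: cvg_sqn_dist.
  rewrite -(cvg_lim _ cK) //; apply: limr_le; first by apply: cvgP cK.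
  exists N => // n /= Nn.
  apply: le_trans (ell2_hnorm_ge (u m - u n) K) _.
  by rewrite ler_sqr ?nnegrE ?hnorm_ge0 ?(ltW e0) // ltW // HN.
have l2l : sqsummable l.
  have [N HN] := Hl 1 ltr01; have {HN}HN := HN N (leqnn _).
  have [M HM] := ell2_sqsum (u N).
  exists (2 * (M + 1 ^+ 2)) => K.
  apply: (@le_trans _ _ (\sum_(k < K) 2 * (sqn (u N k) + sqn (u N k - l k)))).
    apply: ler_sum => k _; rewrite -(sqnN (u N k - l k)).
    apply: le_trans (sqnD _ _); rewrite opprB addrC subrK //.
  rewrite -mulr_sumr; apply: ler_wpM2l => //.
  by rewrite big_split /=; apply: lerD; [apply: HM | apply: HN].
exists (mk_ell2 l2l); apply/cvgrPdist_le => e e0.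
have [N HN] := Hl e e0; exists N => // n /= Nn.
rewrite sub0r normrN ger0_norm ?hnorm_ge0 //.
by apply: ell2_hnorm_le (ltW e0) _; apply: HN.
Qed.

Definition rat_seq (q : seq (rat * rat)) : nat -> C :=
  fun n => (ratr (nth (0, 0) q n).1) +i* (ratr (nth (0, 0) q n).2).

Lemma sqsummable_fin (x : nat -> C) N : (forall n, (N <= n)%N -> x n = 0) ->
  sqsummable x.
Proof.
move=> x0; apply/sqsummableP; apply: cvgP; apply: (@cvg_series_fin _ _ N).
by move=> n /x0 ->; rewrite sqn0.
Qed.

Lemma rat_seq_sqsum q : sqsummable (rat_seq q).
Proof.
apply: (@sqsummable_fin _ (size q)) => n qn.
by rewrite /rat_seq nth_default //= raddf0.
Qed.

(** Finite sequences with rational real and imaginary parts are dense. *)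
Lemma ell2_separable : hilbert_separable dot.
Proof.
exists (range (fun q => mk_ell2 (rat_seq_sqsum q))).
  by apply: card_le_trans (card_image_le _ _) _; apply: countableP.
move=> x e e0.
pose l := limn (series (fun n => sqn (x n))).
have cx : cvgn (series (fun n => sqn (x n))) by apply/sqsummableP; apply: ell2_sqsum.
pose h := (e / 2) ^+ 2; have h0 : 0 < h by rewrite exprn_gt0 // divr_gt0.
have [N _ HN] : \forall n \near \oo, `|l - series (fun n => sqn (x n)) n| < h / 2.
  by apply: cvgr_dist_lt; [exact: cx | rewrite divr_gt0].
have {}HN : l - \sum_(k < N) sqn (x k) < h / 2.
  have := HN N (leqnn N); rewrite /series /= big_mkord -/l => H.
  by apply: le_lt_trans (ler_norm _) H.
(* Each of the first N coordinates gets at most the fraction 1 / (N + 1) of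
   half the error, d for its real and d for its imaginary part; the bound
   d <= 1 gives d^2 <= d. *)
pose d := Num.min 1 (h / (4 * N.+1%:R)).
have N0 : (0 : R) < N.+1%:R by rewrite ltr0n.
have d0 : 0 < d by rewrite lt_min ltr01 divr_gt0 // mulr_gt0.
have approx (r : R) : exists q : rat, (r - ratr q) ^+ 2 <= d.
  have rd : r < r + d by rewrite ltrDl.
  have [q] := rat_in_itvoo rd.
  rewrite in_itv /= => /andP[rq qr]; exists q.
  have d1 : d <= 1 by rewrite ge_min lexx.
  have : 0 < ratr q - r < d by rewrite subr_gt0 rq ltrBlDl qr.
  by case/andP => ? ?; nra.
have [qr Hqr] := choice (fun n => approx (complex.Re (x n))).
have [qi Hqi] := choice (fun n => approx (complex.Im (x n))).
pose q := mkseq (fun n => (qr n, qi n)) N.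
exists (mk_ell2 (rat_seq_sqsum q)); first by exists q.
have e2 : e / 2 < e by rewrite ltr_pdivrMr // ltr_pMr // ltr1n.
apply: le_lt_trans e2; apply: ell2_hnorm_le; first by rewrite divr_ge0 // ltW.
rewrite -/h.
set z := (x - _).
have zE n : z n = x n - rat_seq q n by [].
have z1 n : (n < N)%N -> sqn (z n) <= h / (2 * N.+1%:R).
  move=> nN; rewrite zE /rat_seq nth_mkseq //.
  apply: (@le_trans _ _ (d + d)).
    have -> : sqn (x n - (ratr (qr n) +i* ratr (qi n))) =
      (complex.Re (x n) - ratr (qr n)) ^+ 2 + (complex.Im (x n) - ratr (qi n)) ^+ 2.
      by case: (x n).
    exact: lerD.
  have : d <= h / (4 * N.+1%:R) by rewrite ge_min lexx orbT.
  move=> H; apply: le_trans (lerD H H) _; rewrite le_eqVlt; apply/orP; left.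
  by apply/eqP; field; rewrite gt_eqF.
have z2 n : (N <= n)%N -> z n = x n.
  move=> Nn; rewrite zE /rat_seq nth_default ?size_mkseq //= raddf0.
  by rewrite subr0.
suff H m : \sum_(k < N + m) sqn (z k) <= h.
  move=> n; apply: le_trans (H n).
  rewrite -!(big_mkord xpredT (fun k => sqn (z k))).
  rewrite [leRHS](big_cat_nat _ (leq_addl N n)) //= lerDl.
  by apply: sumr_ge0 => i _; apply: sqn_ge0.
rewrite big_split_ord /=.
have -> : h = h / 2 + h / 2 by field.
apply: lerD.
  apply: (@le_trans _ _ (\sum_(i < N) h / (2 * N.+1%:R))).
    by apply: ler_sum => i _; apply: z1.
  rewrite sumr_const card_ord -[X in X <= _]mulr_natr.
  have -> : h / (2 * N.+1%:R) * N%:R = h / 2 * (N%:R / N.+1%:R).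
    by field; rewrite gt_eqF.
  apply: ler_piMr; first by rewrite divr_ge0 // ltW.
  by rewrite ler_pdivrMr // mul1r ler_nat.
apply/ltW; apply: le_lt_trans HN.
rewrite lerBrDl; apply: le_trans (sqsum_lim x (N + m)).
rewrite big_split_ord /= lerD2l; apply: ler_sum => i _.
by have /= -> := z2 (N + i)%N (leq_addr _ _).
Qed.

End EllTwoHilbert.

(** * Herz-Schur multipliers as blocks of positive kernels *)

Section PsdCalculus.
Variable R : realType.
Local Notation C := R[i].
Local Notation cj := (@Num.conj C).

Lemma psd_comp (S S' : Type) (K : S -> S -> C) (f : S' -> S) (w : S' -> C) :
  psd K -> psd (fun s t => w s * cj (w t) * K (f s) (f t)).
Proof.
move=> Kp L; have := Kp [seq (p.1 * w p.2, f p.2) | p <- L].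
rewrite big_map; under eq_bigr => p _ do rewrite big_map /=.
congr (0 <= _); apply: eq_bigr => p _; apply: eq_bigr => q _.
by rewrite rmorphM /=; ring.
Qed.

Lemma psd_add (S : Type) (K K' : S -> S -> C) :
  psd K -> psd K' -> psd (fun s t => K s t + K' s t).
Proof.
move=> Kp Kp' L; have := addr_ge0 (Kp L) (Kp' L).
rewrite -big_split; congr (0 <= _); apply: eq_bigr => p _ /=.
by rewrite -big_split; apply: eq_bigr => q _ /=; rewrite mulrDr.
Qed.

Lemma psd_gram (S : Type) (V : lmodType C) (ip : {dot V for cj}) (v : S -> V) :
  psd (fun s t => ip (v s) (v t)).
Proof.
move=> L; have := dnorm_ge0 ip (\sum_(p <- L) p.1 *: v p.2).
congr (0 <= _); rewrite linear_sumlz; apply: eq_bigr => p _.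
rewrite linear_sumr /=; apply: eq_bigr => q _.
by rewrite linearZl_LR linearZr_LR /= mulrA.
Qed.

Lemma countable_inj (T : Type) : countable [set: T] ->
  exists idx : T -> nat, injective idx.
Proof.
by case/countable_injP => f fi; exists f => x y; apply: fi; rewrite inE.
Qed.

(** Along an enumeration of [S], the rows of the Cholesky factor are finitely
    supported, hence vectors of l^2, and [K] is their Gram matrix. *)
Lemma psd_realize (S : Type) (s0 : S) (K : S -> S -> C) :
  countable [set: S] -> psd K ->
  exists v : S -> ell2 R, forall s t, K s t = ell2_dot R (v s) (v t).
Proof.
move=> /countable_inj [idx idxI] Kp.
have [e eK] : exists e : nat -> S, cancel idx e.
  have H n : exists s, forall s', idx s' = n -> s' = s.
    have [[s <-]|no] := pselect (exists s, idx s = n).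
      by exists s => s' /idxI.
    by exists s0 => s' h; case: no; exists s'.
  have [e He] := choice H; exists e => s; exact/esym/He.
pose K' m n := K (e m) (e n).
have Kp' : psd K'.
  move=> L; have := Kp [seq (p.1, e p.2) | p <- L].
  by rewrite big_map; under eq_bigr => p _ do rewrite big_map /=.
have sq i : sqsummable (chol K' i).
  by apply: (@sqsummable_fin _ _ i.+1) => n; apply: chol_eq0.
exists (fun s => mk_ell2 (sq (idx s))) => s t.
have -> : K s t = K' (idx s) (idx t) by rewrite /K' !eK.
rewrite (cholE Kp' (idx t) (leqnn (idx s).+1)).
apply/esym; apply: (csum_fin _).2 => n ns.
by rewrite /= chol_eq0 ?mul0r.
Qed.

Variable G : groupType.
Implicit Types u v : G -> C.

(** The Gram matrix of the vectors xi g and eta g of a Herz-Schur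
    representation of [u] is a positive kernel on two copies of [G] with
    off-diagonal block [u (h^-1 * g)].  The numbers [a] and [b] bound the
    squares of the two sup norms, so that [a = b = c] means that the Herz-Schur
    norm is at most [c].  Unlike vectors, such kernels can be integrated. *)
Definition herz_schur_le (a b : R) u : Prop :=
  exists K : G * bool -> G * bool -> C,
    [/\ psd K, forall g h, K (g, false) (h, true) = u (h^-1 * g)%g,
        forall g, K (g, false) (g, false) <= a%:C &
        forall g, K (g, true) (g, true) <= b%:C].

Lemma herz_schur_leW a b a' b' u : a <= a' -> b <= b' ->
  herz_schur_le a b u -> herz_schur_le a' b' u.
Proof.
move=> aa bb [K [Kp Ku Ka Kb]]; exists K; split => // g.
  by apply: le_trans (Ka g) _; rewrite lecR.
by apply: le_trans (Kb g) _; rewrite lecR.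
Qed.

Lemma herz_schur_leD a b a' b' u v :
  herz_schur_le a b u -> herz_schur_le a' b' v ->
  herz_schur_le (a + a') (b + b') (fun g => u g + v g).
Proof.
move=> [K [Kp Ku Ka Kb]] [K' [Kp' Ku' Ka' Kb']].
exists (fun s t => K s t + K' s t); split.
- exact: psd_add.
- by move=> g h; rewrite Ku Ku'.
- by move=> g; rewrite rmorphD lerD.
- by move=> g; rewrite rmorphD lerD.
Qed.

(** Multiplying the first family of vectors by r and the second by 1 / r does
    not change their inner products; this balances the two bounds. *)
Lemma herz_schur_le_scale t a b u : 0 < t ->
  herz_schur_le a b u -> herz_schur_le (t * a) (b / t) u.
Proof.
move=> t0 [K [Kp Ku Ka Kb]].
pose r := Num.sqrt t.
have r0 : 0 < r by rewrite sqrtr_gt0.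
have rr : r * r = t by rewrite -expr2 sqr_sqrtr ?ltW.
pose w (s : G * bool) : C := (if s.2 then r^-1 else r)%:C.
exists (fun s t => w s * cj (w t) * K s t).
have cw x : cj x%:C = x%:C by rewrite cjE /= oppr0.
split.
- exact: (@psd_comp _ _ K id w).
- by move=> g h; rewrite /w /= cw -rmorphM mulfV ?gt_eqF // mul1r Ku.
- move=> g; rewrite /w /= cw -rmorphM rr rmorphM ler_wpM2l //.
  by rewrite ler0c ltW.
- move=> g; rewrite /w /= cw -rmorphM -invfM rr rmorphM mulrC ler_wpM2r //.
  by rewrite ler0c invr_ge0 ltW.
Qed.

Lemma herz_schur_leN a b u : herz_schur_le a b u ->
  herz_schur_le a b (fun g => - u g).
Proof.
move=> [K [Kp Ku Ka Kb]].
pose w (s : G * bool) : C := if s.2 then -1 else 1.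
exists (fun s t => w s * cj (w t) * K s t); split.
- exact: (@psd_comp _ _ K id w).
- by move=> g h; rewrite /w /= rmorphN rmorph1 mul1r mulN1r Ku.
- by move=> g; rewrite /w /= rmorph1 !mul1r.
- by move=> g; rewrite /w /= rmorphN rmorph1 mulrNN !mul1r.
Qed.

Lemma hnorm_sqr (V : lmodType C) (ip : {dot V for cj}) (x : V) :
  ip x x = (hnorm ip x ^+ 2)%:C.
Proof.
have := dnorm_ge0 ip x; rewrite /hnorm; case: (ip x x) => p q.
rewrite lecE /= => /andP[/eqP -> p0].
by rewrite sqr_sqrtr.
Qed.

Lemma hnorm_le_sup (V : lmodType C) (ip : {dot V for cj}) (xi : G -> V) g :
  hbounded ip xi -> hnorm ip (xi g) <= sup_hnorm ip xi.
Proof.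
move=> [M xM]; apply: ub_le_sup; last by exists g.
by exists M => _ [h _ <-].
Qed.

(** A scaling brings both diagonal bounds of the Gram matrix below [c].  The
    strict inequality leaves room for the case in which the second family is
    zero and no exact balance exists. *)
Lemma herz_schur_of_rep u c (V : lmodType C) (ip : {dot V for cj}) (xi eta : G -> V) :
  herz_schur_rep u ip xi eta -> sup_hnorm ip xi * sup_hnorm ip eta < c ->
  herz_schur_le c c u.
Proof.
move=> [_ _ bx be ue] ab.
set a := sup_hnorm ip xi in ab; set b := sup_hnorm ip eta in ab.
have a0 : 0 <= a by apply: le_trans (hnorm_le_sup 1%g bx); apply: sqrtr_ge0.
have b0 : 0 <= b by apply: le_trans (hnorm_le_sup 1%g be); apply: sqrtr_ge0.
have c0 : 0 < c by apply: le_lt_trans ab; apply: mulr_ge0.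
have H : herz_schur_le (a ^+ 2) (b ^+ 2) u.
  exists (fun s t => ip (if s.2 then eta s.1 else xi s.1)
                       (if t.2 then eta t.1 else xi t.1)).
  split.
  - exact: (psd_gram ip (fun s : G * bool => if s.2 then eta s.1 else xi s.1)).
  - by move=> g h; rewrite /= ue.
  - move=> g; rewrite /= hnorm_sqr lecR ler_sqr ?nnegrE ?sqrtr_ge0 //.
    exact: hnorm_le_sup.
  - move=> g; rewrite /= hnorm_sqr lecR ler_sqr ?nnegrE ?sqrtr_ge0 //.
    exact: hnorm_le_sup.
have [bz|bn] := eqVneq b 0.
  have t0 : 0 < c / (a ^+ 2 + 1) by rewrite divr_gt0 // ltr_wpDl // sqr_ge0.
  apply: herz_schur_leW (herz_schur_le_scale t0 H).
    rewrite mulrAC ler_pdivrMr; last by rewrite ltr_wpDl // sqr_ge0.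
    by rewrite ler_pM2l // lerDl.
  by rewrite bz expr0n mul0r ltW.
have bp : 0 < b ^+ 2 by rewrite exprn_gt0 // lt_def bn.
have t0 : 0 < b ^+ 2 / c by rewrite divr_gt0.
apply: herz_schur_leW (herz_schur_le_scale t0 H).
  rewrite mulrAC ler_pdivrMr // -exprMn mulrC -expr2.
  by rewrite mulrC ler_sqr ?nnegrE ?mulr_ge0 ?(ltW c0) // ltW // mulrC.
by rewrite invfM invrK mulrA mulfV ?mul1r // gt_eqF.
Qed.

Lemma B2_norm_herz_schur u c : (B2_norm u < c%:E)%E -> herz_schur_le c c u.
Proof.
move=> /ereal_inf_lt [_ [V [ip [xi [eta [rep ->]]]]]].
by rewrite lte_fin; apply: herz_schur_of_rep rep.
Qed.

(** The Gram vectors of the kernel form a representation on l^2, a separable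
    Hilbert space, with both sup norms at most the square root of [c]. *)
Lemma herz_schur_rep_of u c : countable [set: G] -> herz_schur_le c c u ->
  exists xi eta : G -> ell2 R, herz_schur_rep u (ell2_dot R) xi eta /\
    sup_hnorm (ell2_dot R) xi * sup_hnorm (ell2_dot R) eta <= c.
Proof.
move=> cG [K [Kp Ku Ka Kb]].
have cGb : countable [set: G * bool] by rewrite -setXTT; apply: countableX.
have [v Kv] := psd_realize (1%g, true) cGb Kp.
have c0 : 0 <= c.
  by rewrite -ler0c; apply: le_trans (Ka 1%g); apply: psd_diag_ge0.
have bnd i g : hnorm (ell2_dot R) (v (g, i)) <= Num.sqrt c.
  apply: ler_wsqrtr; rewrite -Kv.
  have : K (g, i) (g, i) <= c%:C by case: i.
  by rewrite lecE => /andP[].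
have bsup i : sup_hnorm (ell2_dot R) (fun g => v (g, i)) <= Num.sqrt c.
  apply: ge_sup; first by exists (hnorm (ell2_dot R) (v (1%g, i))); exists 1%g.
  by move=> _ [g _ <-]; apply: bnd.
exists (fun g => v (g, false)), (fun g => v (g, true)); split.
  split; [exact: ell2_complete|exact: ell2_separable| | |].
  - by exists (Num.sqrt c) => g; apply: bnd.
  - by exists (Num.sqrt c) => g; apply: bnd.
  - by move=> g h; rewrite -Ku Kv.
have pos i : 0 <= sup_hnorm (ell2_dot R) (fun g => v (g, i)).
  apply: le_trans (@hnorm_le_sup _ (ell2_dot R) (fun g => v (g, i)) 1%g _).
    exact: sqrtr_ge0.
  by exists (Num.sqrt c) => g; apply: bnd.
by apply: le_trans (ler_pM (pos _) (pos _) (bsup _) (bsup _)) _; rewrite -expr2 sqr_sqrtr.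
Qed.

Lemma herz_schur_B2 u c : countable [set: G] -> herz_schur_le c c u -> B2 u.
Proof.
move=> cG /(herz_schur_rep_of cG) [xi [eta [rep _]]].
by exists (ell2 R : lmodType C), (ell2_dot R), xi, eta.
Qed.

Lemma herz_schur_B2_norm u c : countable [set: G] -> herz_schur_le c c u ->
  (B2_norm u <= c%:E)%E.
Proof.
move=> cG /(herz_schur_rep_of cG) [xi [eta [rep le]]].
apply: ge_ereal_inf; exists (sup_hnorm (ell2_dot R) xi * sup_hnorm (ell2_dot R) eta)%:E.
  by exists (ell2 R : lmodType C), (ell2_dot R), xi, eta.
by rewrite lee_fin.
Qed.

Lemma herz_schur_bound u c g : herz_schur_le c c u -> `|u g| <= c%:C.
Proof.
move=> [K [Kp Ku Ka Kb]]; have := Ku g 1%g; rewrite invg1 mul1g => <-.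
exact: psd_bound.
Qed.

Lemma positive_definite_psd u :
  positive_definite u <-> psd (fun g h => u (h^-1 * g)%g).
Proof.
split=> [pu L|pu n g c].
  have := pu (size L) (fun i => (tnth (in_tuple L) i).2)
    (fun i => (tnth (in_tuple L) i).1).
  rewrite [in X in _ -> X]big_tnth; congr (0 <= _).
  by apply: eq_bigr => i _; rewrite [RHS]big_tnth.
have := pu [seq (c i, g i) | i <- enum 'I_n].
rewrite big_map big_enum /=; congr (0 <= _); apply: eq_bigr => i _.
by rewrite big_map big_enum.
Qed.

End PsdCalculus.

(** * Finitely supported functions in the Fourier algebra *)

Section Fourier.
Variable R : realType.
Local Notation C := R[i].
Local Notation cj := (@Num.conj C).

Lemma ltcRnorm (z : C) (e : R) : `|z| < e%:C ->
  `|complex.Re z| < e /\ `|complex.Im z| < e.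
Proof.
move=> ze; have re := le_lt_trans (normc_ge_Re z) ze.
split; first by move: re; rewrite ltcR.
have := normc_ge_Re ('i * z); rewrite normrM normCi mul1r => /le_lt_trans /(_ ze).
by rewrite ltcR; case: (z) => a b; rewrite /= mul0r mul1r sub0r normrN.
Qed.

Lemma csum_lim (f : nat -> C) (s : C) :
  (forall e : R, 0 < e -> exists N, forall n, (N <= n)%N ->
    `|\sum_(k < n) f k - s| < e%:C) -> csum f = s.
Proof.
move=> H; rewrite /csum.
have Hr : series (fun n => complex.Re (f n)) @ \oo --> complex.Re s.
  apply/cvgrPdist_lt => e e0; have [N HN] := H e e0; exists N => // n /= Nn.
  have [+ _] := ltcRnorm (HN n Nn).
  rewrite distrC /series /= big_mkord -Re_sum.
  by case: (\sum_(i < n) f i) (s) => ? ? [].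
have Hi : series (fun n => complex.Im (f n)) @ \oo --> complex.Im s.
  apply/cvgrPdist_lt => e e0; have [N HN] := H e e0; exists N => // n /= Nn.
  have [_ +] := ltcRnorm (HN n Nn).
  rewrite distrC /series /= big_mkord -Im_sum.
  by case: (\sum_(i < n) f i) (s) => ? ? [].
by rewrite (cvg_lim _ Hr) // (cvg_lim _ Hi) //; case: s {H Hr Hi}.
Qed.

Variable G : groupType.
Implicit Types (u v xi eta f : G -> C).

Definition sqsum_fset_le xi (M : R) : Prop :=
  forall K : {fset G}, \sum_(h <- K) sqn (xi h) <= M.

Lemma sqn_normC (z : C) : complex.Re (`|z| ^+ 2) = sqn z.
Proof. by rewrite normCK mulcjE. Qed.

Lemma l2E xi : l2 xi = (\esum_(g in [set: G]) (sqn (xi g))%:E < +oo)%E :> Prop.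
Proof.
rewrite /l2; congr (_ (_ < _)%E); congr esum; apply/funext => g.
by rewrite sqn_normC.
Qed.

Lemma l2_bound xi : l2 xi -> exists M, sqsum_fset_le xi M.
Proof.
rewrite l2E => x2; exists (fine (\esum_(g in [set: G]) (sqn (xi g))%:E)) => K.
have x0 : (0 <= \esum_(g in [set: G]) (sqn (xi g))%:E)%E.
  by apply: esum_ge0 => g _; rewrite lee_fin sqn_ge0.
rewrite -lee_fin fineK; last by rewrite ge0_fin_numE.
apply: esum_ge; exists [set` K]; first by split => //; exact: finite_fset.
by rewrite fsbig_finite ?finite_fset //= set_fsetK sumEFin.
Qed.

Lemma l2_of_bound xi M : sqsum_fset_le xi M -> l2 xi.
Proof.
rewrite l2E => xM; apply: (@le_lt_trans _ _ M%:E); last by rewrite ltry.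
apply: ge_ereal_sup => _ [A [fA _] <-].
by rewrite fsbig_finite //= sumEFin lee_fin.
Qed.

(** A finite set whose partial sum is within [e] of the supremum leaves at most
    [e] for its complement. *)
Lemma sqsum_fset_tail xi M (e : R) : sqsum_fset_le xi M -> 0 < e ->
  exists F : {fset G}, sqsum_fset_le (fun h => if h \in F then 0 else xi h) e.
Proof.
move=> xM e0.
pose S := range (fun K : {fset G} => \sum_(h <- K) sqn (xi h)).
have hS : has_sup S.
  split; first by exists (\sum_(h <- fset0) sqn (xi h)); exists fset0.
  by exists M => _ [K _ <-]; apply: xM.
have [_ [F _ <-] HF] := sup_adherent e0 hS.
exists F => K.
have := ub_le_sup hS.2 (ex_intro2 _ _ (F `|` (K `\` F))%fset I erefl).
have PE : perm_eq (F `|` (K `\` F))%fset ((F : seq G) ++ (K `\` F)%fset).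
  apply: uniq_perm; first exact: fset_uniq.
    rewrite cat_uniq !fset_uniq /= andbT; apply/hasPn => x.
    by rewrite in_fsetD => /andP[].
  by move=> x; rewrite mem_cat in_fsetU.
rewrite (perm_big _ PE) big_cat /= => H.
have -> : \sum_(h <- K) sqn (if h \in F then 0 else xi h) =
    \sum_(h <- (K `\` F)%fset) sqn (xi h).
  transitivity (\sum_(h <- (K `\` F)%fset) sqn (if h \in F then 0 else xi h)).
    apply/esym; apply: big_fset_incl; first exact: fsubsetDl.
    by move=> x xK; rewrite in_fsetD xK andbT negbK => ->; rewrite sqn0.
  by apply: eq_big_seq => x; rewrite in_fsetD => /andP[/negbTE ->].
by move: HF H; rewrite -/S; lra.
Qed.

Lemma has_sum_fin f (F : {fset G}) : (forall h, h \notin F -> f h = 0) ->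
  has_sum f (\sum_(h <- F) f h).
Proof.
move=> f0 e e0; exists F => K FK.
rewrite -(big_fset_incl _ FK) ?subrr ?normr0 ?ltcR //.
by move=> x _; apply: f0.
Qed.

Lemma has_sumB f f' s s' : has_sum f s -> has_sum f' s' ->
  has_sum (fun h => f h - f' h) (s - s').
Proof.
move=> fs fs' e e0.
have e2 : 0 < e / 2 by rewrite divr_gt0.
have [K0 H0] := fs _ e2; have [K1 H1] := fs' _ e2.
exists (K0 `|` K1)%fset => K KK.
rewrite big_split /= sumrN opprB addrACA -opprB opprB.
have -> : \sum_(h <- K) f h + s' + (- \sum_(h <- K) f' h - s) =
  (\sum_(h <- K) f h - s) - (\sum_(h <- K) f' h - s') by ring.
apply: le_lt_trans (ler_normB _ _) _.
have -> : e%:C = (e / 2)%:C + (e / 2)%:C by rewrite -rmorphD /= -splitr.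
apply: ltrD.
  by apply: H0; apply: fsubset_trans KK; apply: fsubsetUl.
by apply: H1; apply: fsubset_trans KK; apply: fsubsetUr.
Qed.

Lemma has_sum_translate f s (h : G) :
  has_sum f s -> has_sum (fun k => f (h^-1 * k)%g) s.
Proof.
move=> fs e e0; have [K0 H0] := fs e e0.
exists [fset (h * k)%g | k in K0]%fset => K KK.
have := H0 [fset (h^-1 * k)%g | k in K]%fset.
rewrite big_imfset /=; last by move=> x y _ _; apply: mulgI.
apply; apply/fsubsetP => x xK0; apply/imfsetP; exists (h * x)%g; rewrite ?mulKg //=.
by apply: (fsubsetP KK); apply/imfsetP; exists x.
Qed.

Lemma countable_decode : countable [set: G] ->
  exists (idx : G -> nat) (dec : nat -> option G),
    (forall g, dec (idx g) = Some g) /\ (forall n g, dec n = Some g -> idx g = n).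
Proof.
move=> /countable_inj [idx idxI]; exists idx.
have H n : exists o : option G, (forall g, idx g = n -> o = Some g) /\
    (forall g, o = Some g -> idx g = n).
  have [[g gn]|no] := pselect (exists g, idx g = n).
    exists (Some g); split; last by move=> _ [<-].
    by move=> g' g'n; congr Some; apply: idxI; rewrite gn g'n.
  by exists None; split => // g gn; case: no; exists g.
have [dec Hd] := choice H; exists dec; split=> [g|n g].
  exact: (Hd _).1.
exact: (Hd _).2.
Qed.

(** The coefficient of [xi] and [eta] at [h^-1 * g] is the inner product of the
    translates of [xi] by [g] and of [eta] by [h], so that these translates
    form a Herz-Schur representation.  Enumerating [G] turns them into
    sequences. *)
Lemma herz_schur_coef u xi eta A B : countable [set: G] ->
  sqsum_fset_le xi A -> sqsum_fset_le eta B ->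
  (forall g, has_sum (fun h => left_regular g xi h * cj (eta h)) (u g)) ->
  herz_schur_le A B u.
Proof.
move=> cG xA eB ue.
have [idx [dec [decK idxK]]] := countable_decode cG.
(* The finite set formed by the first N terms of the enumeration. *)
pose fs N : {fset G} := [fset k | k in pmap dec (iota 0 N)]%fset.
have fsE N k : (k \in fs N) = (idx k < N)%N.
  rewrite /fs in_fset /= mem_pmap; apply/mapP/idP => [[n]|kN].
    by rewrite mem_iota add0n => /andP[_ nN] /esym /idxK ->.
  by exists (idx k); rewrite ?mem_iota ?decK.
have sumE (V : zmodType) (F : G -> V) N :
    \sum_(n < N) oapp F 0 (dec n) = \sum_(k <- fs N) F k.
  elim: N => [|N IH].
    rewrite big_ord0 big_seq big1 // => k; by rewrite fsE.
  rewrite big_ord_recr /= IH; case E : (dec N) => [g|] /=.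
    have gN := idxK _ _ E.
    rewrite (big_fsetD1 (A := fs N.+1) g) /=; last by rewrite fsE gN.
    have -> : (fs N.+1 `\ g)%fset = fs N; last by rewrite addrC.
    apply/fsetP => k; rewrite in_fsetD1 !fsE ltnS leq_eqVlt.
    have [-> /=|kg] := eqVneq k g; first by rewrite gN ltnn.
    case: eqVneq => //= kN.
    by move: (decK k); rewrite kN E => -[/eqP]; rewrite eq_sym (negbTE kg).
  have -> : fs N.+1 = fs N; last by rewrite addr0.
  apply/fsetP => k; rewrite !fsE ltnS leq_eqVlt.
  by case: eqVneq => //= kN; move: (decK k); rewrite kN E.
pose X xi (g : G) n := oapp (fun k => xi (g^-1 * k)%g) 0 (dec n) : C.
have Xsq z M g : sqsum_fset_le z M -> sqsum_le (X z g) M.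
  move=> zM N.
  have -> : \sum_(k < N) sqn (X z g k) =
      \sum_(k < N) oapp (fun k => sqn (z (g^-1 * k)%g)) 0 (dec k).
    by apply: eq_bigr => k _; rewrite /X; case: (dec k) => //=; rewrite sqn0.
  rewrite sumE; have := zM [fset (g^-1 * k)%g | k in fs N]%fset.
  by rewrite big_imfset //=; move=> x y _ _; apply: mulgI.
have X2 z M g : sqsum_fset_le z M -> sqsummable (X z g).
  by move=> zM; exists M; apply: Xsq.
pose v (s : G * bool) : ell2 R :=
  if s.2 then mk_ell2 (X2 _ _ s.1 eB) else mk_ell2 (X2 _ _ s.1 xA).
have diag z M g (zM : sqsum_fset_le z M) :
    ell2_dot R (mk_ell2 (X2 _ _ g zM)) (mk_ell2 (X2 _ _ g zM)) <= M%:C.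
  have -> : ell2_dot R (mk_ell2 (X2 _ _ g zM)) (mk_ell2 (X2 _ _ g zM)) =
    (limn (series (fun n => sqn (X z g n))))%:C by exact: ell2_ipxx.
  rewrite lecR; apply: limr_le; first by apply/sqsummableP; apply: X2 zM.
  by apply: nearW => n; rewrite /series /= big_mkord; apply: Xsq.
exists (fun s t => ell2_dot R (v s) (v t)); split.
- exact: psd_gram.
- move=> g h; apply: csum_lim => e e0.
  have [K0 HK] := has_sum_translate h (ue (h^-1 * g)%g) e0.
  exists (\max_(k <- K0) (idx k).+1)%N => n Kn.
  have -> : \sum_(k < n) v (g, false) k * cj (v (h, true) k) =
    \sum_(k < n) oapp (fun k => xi (g^-1 * k)%g * cj (eta (h^-1 * k)%g)) 0 (dec k).
    by apply: eq_bigr => k _; rewrite /= /X; case: (dec k) => //=; rewrite mul0r.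
  rewrite sumE.
  have := HK (fs n); rewrite /left_regular.
  have E k : ((h^-1 * g)^-1 * (h^-1 * k))%g = (g^-1 * k)%g.
    by rewrite invgM invgK -mulgA mulVKg.
  under eq_bigr => k _ do rewrite E.
  apply; apply/fsubsetP => k kK0; rewrite fsE.
  apply: leq_trans Kn; rewrite (big_fsetD1 k kK0) /=; exact: leq_maxl.
- by move=> g; apply: diag.
- by move=> g; apply: diag.
Qed.

(** Truncating first [xi] and then [eta] to a finite set changes the
    coefficient by coefficients of a small and a bounded vector, and leaves a
    finitely supported function. *)
Lemma fourier_finite_approx u (e : R) : countable [set: G] ->
  fourier_algebra u -> 0 < e ->
  exists v, finite_set [set g | v g != 0] /\ herz_schur_le e e (fun g => u g - v g).
Proof.
move=> cG [xi [eta [/l2_bound [A xA] /l2_bound [B eB] ue]]] e0.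
have A0 : 0 <= A by apply: le_trans (xA fset0); rewrite big_seq_fset0 ?big1.
have B0 : 0 <= B by apply: le_trans (eB fset0); rewrite big_seq_fset0 ?big1.
(* Scaling by t1 the bounds (e / 2 / t1, B) of u - p, and by t2 the bounds
   (A, t2 * (e / 2)) of p - v, makes all of them at most e / 2. *)
pose t1 := 2 * (B + 1) / e; pose t2 := e / (2 * (A + 1)).
have B1 : 0 < B + 1 by rewrite ltr_wpDl.
have A1 : 0 < A + 1 by rewrite ltr_wpDl.
have t10 : 0 < t1 by rewrite divr_gt0 // mulr_gt0.
have t20 : 0 < t2 by rewrite divr_gt0 // mulr_gt0.
have d10 : 0 < e / 2 / t1 by rewrite !divr_gt0 // ?mulr_gt0.
have d20 : 0 < t2 * (e / 2) by rewrite mulr_gt0 // divr_gt0.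
have [F1 HF1] := sqsum_fset_tail xA d10.
have [F2 HF2] := sqsum_fset_tail eB d20.
pose xi1 h := if h \in F1 then xi h else 0.
pose p g := \sum_(f <- F1) xi f * cj (eta (g * f)%g).
pose v g := \sum_(h <- F2) left_regular g xi1 h * cj (eta h).
have x1A : sqsum_fset_le xi1 A.
  move=> K; apply: le_trans (xA K); apply: ler_sum => h _.
  by rewrite /xi1; case: ifP => // _; rewrite sqn0 sqn_ge0.
have hp g : has_sum (fun h => left_regular g xi1 h * cj (eta h)) (p g).
  have -> : p g = \sum_(h <- [fset (g * f)%g | f in F1]%fset)
      left_regular g xi1 h * cj (eta h).
    rewrite big_imfset /=; last by move=> x y _ _; apply: mulgI.
    by apply: eq_big_seq => f fF; rewrite /left_regular mulKg /xi1 fF.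
  apply: has_sum_fin => h hF; rewrite /left_regular /xi1 ifF ?mul0r //.
  apply: contraNF hF => hF; apply/imfsetP; exists (g^-1 * h)%g => //.
  by rewrite mulVKg.
exists v; split.
  apply: (@sub_finite_set _ _ [set (h * f^-1)%g | h in [set` F2] & f in [set` F1]]).
    move=> g /= vg; apply: contrapT => nv; move/eqP: vg; apply.
    rewrite /v big_seq big1 // => h hF; rewrite /left_regular /xi1 ifF ?mul0r //.
    apply: contra_notF nv => hF1; exists h => //; exists (g^-1 * h)%g => //.
    by rewrite invgM invgK mulVKg.
  by apply: finite_image2; apply: finite_fset.
have H1 : herz_schur_le (e / 2 / t1) B (fun g => u g - p g).
  apply: (herz_schur_coef cG HF1 eB) => g.
  have := has_sumB (ue g) (hp g); congr has_sum; apply/funext => h.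
  rewrite -mulrBl /left_regular /xi1; congr (_ * _).
  by case: ifP => _; rewrite ?subrr ?subr0.
have H2 : herz_schur_le A (t2 * (e / 2)) (fun g => p g - v g).
  apply: (herz_schur_coef cG x1A HF2) => g.
  have vE : has_sum (fun h => left_regular g xi1 h *
      cj (if h \in F2 then eta h else 0)) (v g).
    have -> : v g = \sum_(h <- F2) left_regular g xi1 h *
        cj (if h \in F2 then eta h else 0).
      by apply: eq_big_seq => h ->.
    by apply: has_sum_fin => h /negbTE ->; rewrite rmorph0 mulr0.
  have := has_sumB (hp g) vE; congr has_sum; apply/funext => h.
  by case: ifP => _; rewrite ?rmorph0 ?mulr0 ?subrr ?subr0.
have := herz_schur_leD (herz_schur_le_scale t10 H1) (herz_schur_le_scale t20 H2).
have -> : (fun g => u g - p g + (p g - v g)) = (fun g => u g - v g).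
  by apply/funext => g; rewrite addrA subrK.
apply: herz_schur_leW.
  rewrite [leRHS]splitr; apply: lerD.
    by rewrite mulrC divfK // gt_eqF.
  rewrite /t2 mulrAC ler_pdivrMr ?mulr_gt0 //.
  rewrite -subr_ge0.
  have -> : e / 2 * (2 * (A + 1)) - e * A = e by field.
  exact: ltW.
rewrite [leRHS]splitr; apply: lerD.
  rewrite /t1 invf_div mulrA ler_pdivrMr ?mulr_gt0 // -subr_ge0.
  have -> : e / 2 * (2 * (B + 1)) - B * e = e by field.
  exact: ltW.
by rewrite mulrAC mulfV ?mul1r // gt_eqF.
Qed.

(** A function is the coefficient of the indicator of the identity and its own
    conjugate. *)
Lemma fourier_of_finite_support v :
  finite_set [set g | v g != 0] -> fourier_algebra v.
Proof.
move=> fv; pose d (h : G) : C := if h == 1%g then 1 else 0.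
pose F := fset_set [set g | v g != 0].
have vF h : h \notin F -> v h = 0.
  by rewrite in_fset_set // notin_setE /= => /negP /negPn /eqP.
exists d, (fun h => cj (v h)); split.
- apply: (@l2_of_bound _ 1) => K.
  apply: (@le_trans _ _ (\sum_(h <- K `&` [fset 1%g]) 1)%fset).
    rewrite le_eqVlt; apply/orP; left; apply/eqP.
    transitivity (\sum_(h <- (K `&` [fset 1%g])%fset) sqn (d h)).
      apply/esym; apply: big_fset_incl; first exact: fsubsetIl.
      move=> x xK; rewrite in_fsetI xK in_fset1 /= /d => /negbTE ->.
      exact: sqn0.
    apply: eq_big_seq => x; rewrite in_fsetI in_fset1 /d => /andP[_ ->].
    by rewrite /sqn /= expr0n expr1n addr0.
  apply: (@le_trans _ _ (\sum_(h <- [fset (1%g : G)]%fset) 1)).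
    rewrite !big_const_seq !count_predT !iter_addr_0 ler_nat.
    by apply: fsubset_leq_card; apply: fsubsetIr.
  by rewrite big_seq_fset1.
- apply: (@l2_of_bound _ (\sum_(h <- F) sqn (v h))) => K.
  have sc h : sqn (cj (v h)) = sqn (v h).
    by rewrite cjE /sqn /= sqrrN.
  under eq_bigr => h _ do rewrite sc.
  rewrite -(@big_fset_incl _ _ _ _ (K `&` F)%fset); last 2 first.
  + exact: fsubsetIl.
  + by move=> x xK; rewrite in_fsetI xK /= => /vF ->; rewrite sqn0.
  rewrite [leRHS](big_fsetID _ (mem K)) /=.
  have -> : [fset x in F | x \in K]%fset = (K `&` F)%fset.
    by apply/fsetP => x; rewrite in_fsetI !inE andbC.
  by rewrite lerDl; apply: sumr_ge0 => h _; apply: sqn_ge0.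
- move=> g.
  have -> : v g = \sum_(h <- [fset g]%fset) left_regular g d h * cj (cj (v h)).
    by rewrite big_seq_fset1 /left_regular /d mulVg eqxx mul1r conjCK.
  apply: has_sum_fin => h; rewrite in_fset1 => /negbTE hg.
  rewrite /left_regular /d ifF ?mul0r //; apply: contraFF hg => /eqP E.
  by rewrite -(mulVKg g h) E mulg1.
Qed.

End Fourier.

(** * Fundamental domains and their cocycles *)

Section CountableFactor.
Context (d : measure_display) (T : measurableType d).

Lemma measurable_countable_factor (S : Type) (k : T -> S) d' (U : measurableType d')
    (h : S -> U) :
  countable [set: S] -> (forall s, measurable [set z | k z = s]) ->
  measurable_fun [set: T] (h \o k).
Proof.
move=> cS mk _ A mA; rewrite setTI.
have -> : (h \o k) @^-1` A =
    \bigcup_s (if pselect (A (h s)) then [set z | k z = s] else set0).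
  apply/seteqP; split=> [z /= Az|z [s _]].
    by exists (k z) => //; case: pselect.
  by case: pselect => // As /= ->.
apply: countable_bigcupT_measurable => // s.
by case: pselect => hs; [exact: mk | exact: measurable0].
Qed.

End CountableFactor.

Section FundamentalDomain.
Context (G : groupType) (d : measure_display) (T : measurableType d).
Variables (b : G -> T -> T) (X : set T).
Hypothesis b_left : left_action_on [set: T] b.
Hypothesis b_meas : forall g, measurable_fun [set: T] (b g).
Hypothesis cG : countable [set: G].
Hypothesis fdX : fundamental_domain b X.

Lemma act1 z : b 1%g z = z. Proof. by case: b_left => _ H _; apply: H. Qed.
Lemma actM g h z : b (g * h)%g z = b g (b h z).
Proof. by case: b_left => _ _; apply. Qed.
Lemma actK g z : b (g^-1)%g (b g z) = z.
Proof. by rewrite -actM mulVg act1. Qed.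

Lemma measurable_fd : measurable X. Proof. by case: fdX. Qed.

(** The cocycle of the fundamental domain.  The default value never occurs,
    because the translates of X cover T. *)
Definition cocyc (z : T) : G := xget 1%g [set g | X (b g z)].

Lemma cocycP z : X (b (cocyc z) z).
Proof.
rewrite /cocyc; case: xgetP => [g -> //|no].
case: fdX => _ cov _.
have : [set: T] z by [].
rewrite -cov => -[g _ [x Xx bx]].
by case: (no (g^-1)%g); rewrite /= -bx actK.
Qed.

Lemma fd_unique g h z : X (b g z) -> X (b h z) -> g = h.
Proof.
move=> Xg Xh; case: fdX => _ _ tr.
have := tr (g^-1)%g (h^-1)%g I I.
move=> /(_ _)/invg_inj; apply; exists z; split.
  by exists (b g z) => //; rewrite actK.
by exists (b h z) => //; rewrite actK.
Qed.

Lemma cocyc_eq g z : X (b g z) -> cocyc z = g.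
Proof. by apply: fd_unique; apply: cocycP. Qed.

Lemma cocyc_act g z : cocyc (b g z) = (cocyc z * g^-1)%g.
Proof. by apply: cocyc_eq; rewrite actM actK; apply: cocycP. Qed.

Lemma cocyc_fd z : X z -> cocyc z = 1%g.
Proof. by move=> Xz; apply: cocyc_eq; rewrite act1. Qed.

Lemma cocycE g : [set z | cocyc z = g] = b g @^-1` X.
Proof.
by apply/seteqP; split=> z /=; [move=> <-; apply: cocycP | apply: cocyc_eq].
Qed.

Lemma measurable_act_preimage g A : measurable A -> measurable (b g @^-1` A).
Proof. by move=> mA; rewrite -[_ @^-1` _]setTI; apply: b_meas. Qed.

Lemma measurable_cocyc g : measurable [set z | cocyc z = g].
Proof. by rewrite cocycE; apply: measurable_act_preimage; apply: measurable_fd. Qed.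

Definition fd_rep (z : T) : T := b (cocyc z) z.

Lemma fd_rep_act g z : fd_rep (b g z) = fd_rep z.
Proof. by rewrite /fd_rep cocyc_act actM actK. Qed.

Lemma fd_rep_id z : X z -> fd_rep z = z.
Proof. by move=> Xz; rewrite /fd_rep cocyc_fd ?act1. Qed.

Lemma orbit_repE z : orbit_rep b X z = fd_rep z.
Proof.
rewrite /orbit_rep; case: xgetP => [x -> [Xx [g gx]]|no].
  by rewrite /fd_rep (@cocyc_eq g) ?gx.
by case: (no (fd_rep z)); split; [apply: cocycP | exists (cocyc z)].
Qed.

Lemma measurable_fd_rep : measurable_fun [set: T] fd_rep.
Proof.
move=> _ A mA; rewrite setTI.
have -> : fd_rep @^-1` A = \bigcup_g ([set z | cocyc z = g] `&` b g @^-1` A).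
  apply/seteqP; split=> [z Az|z [g _ [<-]] //].
  by exists (cocyc z).
apply: countable_bigcupT_measurable => // g.
by apply: measurableI; [apply: measurable_cocyc | apply: measurable_act_preimage].
Qed.

End FundamentalDomain.

Section InvariantIntegral.
Context (R : realType) (Gam Del : groupType) (d : measure_display)
  (T : measurableType d) (mu : {measure set T -> \bar R}).
Variables (a : Gam -> T -> T) (b : Del -> T -> T) (X : set T).
Hypothesis cDel : countable [set: Del].

Record commuting_actions : Prop := {
  ca_left : left_action_on [set: T] a ;
  ca_right : left_action_on [set: T] b ;
  ca_comm : forall g h z, a g (b h z) = b h (a g z) ;
  ca_left_mp : forall g, measure_preserving mu (a g) ;
  ca_right_mp : forall h, measure_preserving mu (b h) ;
  ca_fd : fundamental_domain b X }.

Hypothesis ca : commuting_actions.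
Let a_left := ca_left ca.
Let b_left := ca_right ca.
Let ab_comm := ca_comm ca.
Let a_mp := ca_left_mp ca.
Let b_mp := ca_right_mp ca.
Let fdX := ca_fd ca.
Let a_meas g : measurable_fun [set: T] (a g) := (a_mp g).1.
Let b_meas g : measurable_fun [set: T] (b g) := (b_mp g).1.

Definition orbit_inv (V : Type) (f : T -> V) : Prop := forall h z, f (b h z) = f z.

Lemma ge0_integral_mp (t : T -> T) (E : set T) (F : T -> \bar R) :
  measure_preserving mu t -> measurable E -> measurable_fun [set: T] F ->
  (forall z, (0 <= F z)%E) ->
  (\int[mu]_(z in t @^-1` E) F (t z) = \int[mu]_(z in E) F z)%E.
Proof.
move=> [mt pt] mE mF F0.
rewrite -(@ge0_integral_pushforward _ _ _ _ _ _ mt mu E F) //; last first.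
  exact: measurable_funS mF.
by apply: (@eq_measure_integral _ _ _ _ mu) => A mA _; exact: pt.
Qed.

(** Although [a g] does not preserve X, the integral of a [b]-invariant function
    over a fundamental domain does not depend on the domain.  Cut X into the
    countably many pieces on which the element h of [Del] that moves [a g z]
    back into X is constant: on such a piece [b h \o a g] preserves the measure,
    and the images of the pieces form a partition of X again. *)
Lemma integral_invariant (F : T -> \bar R) g :
  measurable_fun [set: T] F -> (forall z, (0 <= F z)%E) -> orbit_inv F ->
  (\int[mu]_(z in X) F (a g z) = \int[mu]_(z in X) F z)%E.
Proof.
move=> mF F0 Fi; have [idx idxI] := countable_inj cDel.
have mX := measurable_fd fdX.
have mc := measurable_cocyc b_left b_meas fdX.
pose c := cocyc b X.
have mnat (s : T -> Del) n : (forall h, measurable [set z | s z = h]) ->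
    measurable [set z | idx (s z) = n].
  move=> ms; have [[h <-]|no] := pselect (exists h, idx h = n).
    suff -> : [set z | idx (s z) = idx h] = [set z | s z = h] by [].
    by apply/seteqP; split=> z /=; [move/idxI | move->].
  suff -> : [set z | idx (s z) = n] = set0 by apply: measurable0.
  by apply/seteqP; split=> z //= zn; apply: no; exists (s z).
have split_int (s : T -> Del) (H : T -> \bar R) : (forall h, measurable [set z | s z = h]) ->
    measurable_fun [set: T] H -> (forall z, (0 <= H z)%E) ->
    (\int[mu]_(z in X) H z =
     \sum_(0 <= n <oo) \int[mu]_(z in X `&` [set z | idx (s z) = n]) H z)%E.
  move=> ms mH H0.
  have XE : X = \bigcup_n (X `&` [set z | idx (s z) = n]).
    rewrite -setI_bigcupr -[LHS]setIT; congr (_ `&` _).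
    by apply/seteqP; split=> z //= _; exists (idx (s z)).
  rewrite [in LHS]XE ge0_integral_bigcup //.
  - by move=> n; apply: measurableI => //; apply: mnat.
  - exact: measurable_funS mH.
  - by move=> m n _ _ [z [[_ /= <-] [_ /= <-]]].
have mFa : measurable_fun [set: T] (fun z => F (a g z)).
  exact: (measurableT_comp mF (a_meas g)).
have pre_a (A : set T) : measurable A -> measurable (a g^-1%g @^-1` A).
  by move=> mA; rewrite -[_ @^-1` _]setTI; apply: a_meas.
(* s1 is constant on the pieces, s2 on their images: if t z = b h (a g z) with
   z and t z in X, then s1 z = h and s2 (t z) = h. *)
pose s1 z := c (a g z); pose s2 z := ((c (a (g^-1)%g z))^-1)%g.
have ms1 h : measurable [set z | s1 z = h].
  by have := a_meas g measurableT (mc h); rewrite setTI.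
have ms2 h : measurable [set z | s2 z = h].
  have -> : [set z | s2 z = h] = a (g^-1)%g @^-1` [set z | c z = (h^-1)%g].
    by apply/seteqP; split=> z /=; rewrite /s2; [move=> <- | move=> ->]; rewrite invgK.
  by have := a_meas (g^-1)%g measurableT (mc (h^-1)%g); rewrite setTI.
rewrite (split_int s1) // (split_int s2) //.
apply: eq_eseriesr => n _.
have [[h <-]|no] := pselect (exists h, idx h = n); last first.
  have e0 (s : T -> Del) : X `&` [set z | idx (s z) = n] = set0.
    by apply/seteqP; split=> z //= [_ zn]; apply: no; exists (s z).
  by rewrite !e0 !integral_set0.
pose t z := b h (a g z).
have tmp : measure_preserving mu t.
  split; first exact: (measurableT_comp (b_meas h) (a_meas g)).
  move=> A mA.
  have -> : t @^-1` A = a g @^-1` (b h @^-1` A) by [].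
  rewrite (a_mp g).2 ?(b_mp h).2 //.
  by rewrite -[_ @^-1` _]setTI; apply: b_meas.
pose E := X `&` [set z | idx (s2 z) = idx h].
have mE : measurable E by apply: measurableI => //; apply: mnat.
rewrite -(ge0_integral_mp tmp mE mF F0) /E.
have -> : t @^-1` (X `&` [set z | idx (s2 z) = idx h]) =
    X `&` [set z | idx (s1 z) = idx h].
  apply/seteqP; split=> z /= [Xz /idxI Hz]; split.
  - move: Hz; rewrite /s2 /t /c ab_comm (actK a_left) (cocyc_act b_left fdX).
    rewrite invgM invgK => /(canRL (mulKg _)); rewrite mulVg.
    move=> /(congr1 (fun x => x^-1)%g); rewrite invgK invg1 => cz.
    by have := cocycP b_left fdX z; rewrite cz (act1 b_left).
  - by congr idx; apply: (cocyc_eq b_left fdX).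
  - rewrite /t -Hz; exact: (cocycP b_left fdX).
  - congr idx; rewrite /s2 /t /c ab_comm (actK a_left) (cocyc_act b_left fdX).
    by rewrite (cocyc_fd b_left fdX) // mul1g invgK.
by apply: eq_integral => z _; rewrite /t Fi.
Qed.

Lemma integral_invariant_real (F : T -> R) g : measurable_fun [set: T] F ->
  orbit_inv F ->
  (\int[mu]_(z in X) (F (a g z))%:E = \int[mu]_(z in X) (F z)%:E)%E.
Proof.
move=> mF Fi.
have mFE : measurable_fun [set: T] (fun z => (F z)%:E) by apply/measurable_EFinP.
rewrite [LHS]integralE [RHS]integralE; congr (_ - _)%E.
  transitivity (\int[mu]_(z in X) ((fun z => (F z)%:E)^\+ (a g z)))%E.
    by apply: eq_integral => z _; rewrite !funeposE.
  apply: integral_invariant.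
  - exact: measurable_funepos.
  - by move=> z; apply: funepos_ge0.
  - by move=> h z; rewrite !funeposE /= Fi.
transitivity (\int[mu]_(z in X) ((fun z => (F z)%:E)^\- (a g z)))%E.
  by apply: eq_integral => z _; rewrite !funenegE.
apply: integral_invariant.
- exact: measurable_funeneg.
- by move=> z; apply: funeneg_ge0.
- by move=> h z; rewrite !funenegE /= Fi.
Qed.

End InvariantIntegral.

(** * Invariant means on bounded functions *)

Section Mean.
Context (R : realType) (Gam Del : groupType) (d : measure_display)
  (T : measurableType d) (mu : {measure set T -> \bar R}).
Variables (a : Gam -> T -> T) (b : Del -> T -> T) (X : set T).
Hypothesis cDel : countable [set: Del].
Hypothesis ca : commuting_actions mu a b X.
Local Notation C := R[i].

Definition ess_bounded (f : T -> R) : Prop :=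
  measurable_fun X f /\ exists M : R, {ae mu, forall x, X x -> `|f x| <= M}.

(** The real part of an invariant state.  Functions live on T instead of X, and
    invariance is only asked of [b]-invariant functions, on which the action
    [a] of [Gam] is its action on the orbit space. *)
Record invariant_mean (m : (T -> R) -> R) : Prop := {
  mean_add : forall f g, ess_bounded f -> ess_bounded g ->
    m (fun x => f x + g x) = m f + m g ;
  mean_le : forall f g, ess_bounded f -> ess_bounded g ->
    {ae mu, forall x, X x -> f x <= g x} -> m f <= m g ;
  mean_cst : forall k, m (fun=> k) = k ;
  mean_inv : forall g f, ess_bounded f -> orbit_inv b f ->
    m (fun x => f (a g x)) = m f }.

Lemma Linfty_real (f : T -> R) : ess_bounded f -> Linfty mu X (fun x => (f x)%:C).
Proof.
move=> [mf [M fM]]; split; [exact: mf | exact: (measurable_cst (0 : R)) |].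
exists M; apply: filterS fM => x fx /fx.
have -> : `|(f x)%:C| = (`|f x|)%:C; last by rewrite lecR.
by rewrite normc_def /= expr0n addr0 sqrtr_sqr.
Qed.

Lemma ess_bounded_cst k : ess_bounded (fun=> k).
Proof. by split; [exact: measurable_cst | exists `|k|; apply: aeW]. Qed.

(** The quotient action moves the point [a g x] inside its [b]-orbit, which
    [b]-invariant functions do not notice. *)
Lemma amenable_pair_mean : amenable_pair mu X (quotient_action b X a) ->
  exists m, invariant_mean m.
Proof.
move=> [_ [m ms mi]].
have mC := Linfty_real.
have L0 : Linfty mu X (fun=> 0 : C) := mC _ (ess_bounded_cst 0).
have m0 : m (fun=> 0) = 0.
  have := state_linear ms 1 L0 L0.
  have -> : (fun x : T => 1 * 0 + 0 : C) = (fun=> 0).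
    by apply/funext => x; rewrite mulr0 addr0.
  by rewrite mul1r => /eqP; rewrite -subr_eq0 opprD addrA subrr add0r oppr_eq0 => /eqP.
have add f g : ess_bounded f -> ess_bounded g ->
    m (fun x => (f x + g x)%:C) = m (fun x => (f x)%:C) + m (fun x => (g x)%:C).
  move=> bf bg; have := state_linear ms 1 (mC _ bf) (mC _ bg).
  rewrite mul1r => <-; congr m; apply/funext => x.
  by rewrite mul1r rmorphD.
exists (fun f => complex.Re (m (fun x => (f x)%:C))); split.
- move=> f g bf bg; rewrite add //.
  by case: (m (fun x => (f x)%:C)) (m (fun x => (g x)%:C)) => ? ? [].
- move=> f g bf bg fg.
  have Lh : Linfty mu X (fun x => -1 * (f x)%:C + (g x)%:C).
    have -> : (fun x => -1 * (f x)%:C + (g x)%:C : C) = (fun x => (g x - f x)%:C).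
      by apply/funext => x; rewrite mulN1r addrC rmorphB.
    apply: mC; split; first by apply: measurable_funB; [exact: bg.1 | exact: bf.1].
    have [M fM] := bf.2; have [N gN] := bg.2.
    exists (N + M); apply: filterS2 fM gN => x fx gx Xx.
    by apply: le_trans (ler_normB _ _) _; apply: lerD; [exact: gx | exact: fx].
  have := state_ge0 ms Lh.
  have H : {ae mu, forall x, X x -> 0 <= -1 * (f x)%:C + (g x)%:C}.
    by apply: filterS fg => x fx /fx; rewrite mulN1r addrC subr_ge0 lecR.
  move=> /(_ H); rewrite (state_linear ms _ (mC _ bf) (mC _ bg)) mulN1r.
  rewrite addrC subr_ge0 lecE => /andP[_].
  by [].
- move=> k; have E := state_linear ms k%:C (mC _ (ess_bounded_cst 1)) L0.
  move: E; rewrite m0 (state_unit ms) mulr1 addr0 => E.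
  by rewrite E.
- move=> g f bf fi; rewrite -(mi g _ (mC _ bf)); congr (complex.Re (m _)).
  apply/funext => x; rewrite /= /quotient_action.
  by rewrite (orbit_repE (ca_right ca) (ca_fd ca)) /fd_rep fi.
Qed.

End Mean.

(** * Elementary inequalities *)

Section Averaging.
Variable R : realType.

(** The Cauchy-Schwarz inequality for [w] and a constant vector. *)
Lemma sqr_sum_le (w : seq R) :
  (\sum_(x <- w) x) ^+ 2 <= (size w)%:R * \sum_(x <- w) x ^+ 2.
Proof.
elim: w => [|x w IH]; first by rewrite !big_nil expr0n mulr0.
rewrite !big_cons /=; set S := \sum_(j <- w) j in IH *.
set Q := \sum_(j <- w) j ^+ 2 in IH *.
have [w0|wn] := posnP (size w).
  move: w0 IH => /size0nil w0; rewrite /S /Q w0 !big_nil /= => _.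
  by rewrite !addr0 mul1r.
have n0 : (0 : R) < (size w)%:R by rewrite ltr0n.
have Q1 : (0 : R) <= Q by apply: sumr_ge0 => i _; apply: sqr_ge0.
rewrite -natr1; move: n0 IH; set n : R := (size w)%:R => n0 IH.
have : 0 <= n * (n * x ^+ 2 + Q - 2 * x * S).
  have -> : n * (n * x ^+ 2 + Q - 2 * x * S) =
    (n * x - S) ^+ 2 + (n * Q - S ^+ 2) by ring.
  by rewrite addr_ge0 ?sqr_ge0 // subr_ge0.
rewrite pmulr_rge0 // => H; rewrite -subr_ge0.
have -> : (n + 1) * (x ^+ 2 + Q) - (x + S) ^+ 2 =
  (n * x ^+ 2 + Q - 2 * x * S) + (n * Q - S ^+ 2) by ring.
by rewrite addr_ge0 // subr_ge0.
Qed.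

(** The gap between the square of a sum and the sum of squares controls the
    distances to any one of the terms; it is [sqr_sum_le] for the
    differences. *)
Lemma variance_le (x0 : R) (v : seq R) :
  (x0 + \sum_(x <- v) x) ^+ 2 + \sum_(x <- v) (x - x0) ^+ 2 <=
  (size v).+1%:R * (x0 ^+ 2 + \sum_(x <- v) x ^+ 2).
Proof.
have := sqr_sum_le [seq x - x0 | x <- v]; rewrite !big_map size_map.
have -> : \sum_(x <- v) (x - x0) = \sum_(x <- v) x - (size v)%:R * x0.
  elim: v => [|x v IH]; first by rewrite !big_nil mul0r subr0.
  by rewrite !big_cons IH /= -natr1; ring.
have -> : \sum_(x <- v) (x - x0) ^+ 2 =
    \sum_(x <- v) x ^+ 2 - 2 * x0 * \sum_(x <- v) x + (size v)%:R * x0 ^+ 2.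
  elim: v => [|x v IH]; first by rewrite !big_nil mul0r mulr0 subr0 addr0.
  by rewrite !big_cons IH /= -natr1; ring.
rewrite -natr1; set n : R := (size v)%:R; set S := \sum_(x <- v) x.
set Q := \sum_(x <- v) x ^+ 2; rewrite -subr_ge0 => H; rewrite -subr_ge0.
apply: le_trans H _; rewrite le_eqVlt; apply/orP; left; apply/eqP; ring.
Qed.

Lemma geometric_eseries_lty (q : R) : 0 <= q -> q < 1 ->
  (\sum_(0 <= n <oo) (q ^+ n)%:E < +oo)%E.
Proof.
move=> q0 q1.
have c : series (geometric 1 q) @ \oo --> 1 / (1 - q).
  by apply: cvg_geometric_series; rewrite ger0_norm.
have -> : (\sum_(0 <= n <oo) (q ^+ n)%:E = (1 / (1 - q))%:E)%E; last exact: ltry.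
apply: cvg_lim => //.
have -> : (fun n => \sum_(0 <= i < n) (q ^+ i)%:E)%E = EFin \o series (geometric 1 q).
  apply/funext => n; rewrite /= /series /= sumEFin; congr EFin.
  by apply: eq_bigr => i _; rewrite /geometric /= mul1r.
by apply: cvg_EFin => //; apply: nearW.
Qed.

End Averaging.

(** * Averaging operators and their contraction *)

Section AlmostInvariant.
Context (R : realType) (Gam Del : groupType) (d : measure_display)
  (T : measurableType d) (mu : {measure set T -> \bar R}).
Variables (a : Gam -> T -> T) (b : Del -> T -> T) (X : set T).
Hypothesis cDel : countable [set: Del].
Hypothesis ca : commuting_actions mu a b X.
Implicit Types f F H : T -> R.

Let mX : measurable X := measurable_fd (ca_fd ca).

(** For [b]-invariant functions this is integration over the orbit space of
    [b]. *)
Definition rint F : \bar R := (\int[mu]_(z in X) (F z)%:E)%E.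

Definition rmeas F : Prop := measurable_fun [set: T] F.

Lemma rmeasE F : rmeas F -> measurable_fun X (fun z => (F z)%:E).
Proof. by move=> mF; apply/measurable_EFinP; apply: measurable_funS mF. Qed.

Lemma rmeas_translate F s : rmeas F -> rmeas (fun z => F (a s z)).
Proof. by move=> mF; apply: (measurableT_comp mF); apply: (ca_left_mp ca s).1. Qed.

Lemma rint_ge0 F : (forall z, 0 <= F z) -> (0 <= rint F)%E.
Proof. by move=> F0; apply: integral_ge0 => z _; rewrite lee_fin. Qed.

Lemma rintD F H : rmeas F -> rmeas H -> (forall z, 0 <= F z) -> (forall z, 0 <= H z) ->
  rint (fun z => F z + H z) = (rint F + rint H)%E.
Proof.
move=> mF mH F0 H0; rewrite /rint -ge0_integralD //; do ?exact: rmeasE.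
- by move=> z _; rewrite lee_fin.
- by move=> z _; rewrite lee_fin.
Qed.

Lemma rintZ F k : rmeas F -> (forall z, 0 <= F z) -> 0 <= k ->
  rint (fun z => k * F z) = (k%:E * rint F)%E.
Proof.
move=> mF F0 k0; rewrite /rint -ge0_integralZl ?lee_fin //; first exact: rmeasE.
by move=> z _; rewrite lee_fin.
Qed.

Lemma rint_sum I (s : seq I) (F : I -> T -> R) :
  (forall i, rmeas (F i)) -> (forall i z, 0 <= F i z) ->
  rint (fun z => \sum_(i <- s) F i z) = (\sum_(i <- s) rint (F i))%E.
Proof.
move=> mF F0; rewrite /rint -ge0_integral_sum //.
- by apply: eq_integral => z _; rewrite sumEFin.
- by move=> i; apply: rmeasE.
- by move=> i z _; rewrite lee_fin.
Qed.

Lemma rint_le F H : rmeas F -> rmeas H -> (forall z, 0 <= F z) ->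
  (forall z, F z <= H z) -> (rint F <= rint H)%E.
Proof.
move=> mF mH F0 FH; apply: ge0_le_integral => //; do ?exact: rmeasE.
- by move=> z _; rewrite lee_fin.
- by move=> z _; rewrite lee_fin.
Qed.

Lemma rint_translate F s : rmeas F -> (forall z, 0 <= F z) -> orbit_inv b F ->
  rint (fun z => F (a s z)) = rint F.
Proof.
move=> mF F0 Fi.
apply: (integral_invariant cDel ca (F := fun z => (F z)%:E)).
- exact/measurable_EFinP.
- by move=> z; rewrite lee_fin.
- by move=> h z; rewrite Fi.
Qed.

(** Nonnegative vectors of L^2 of the orbit space of [b], without the condition
    of finite norm. *)
Record admissible f : Prop := {
  adm_meas : rmeas f ;
  adm_ge0 : forall z, 0 <= f z ;
  adm_inv : orbit_inv b f }.

Definition normsq f : \bar R := rint (fun z => f z ^+ 2).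

Lemma rmeas_sqr f : rmeas f -> rmeas (fun z => f z ^+ 2).
Proof. exact: measurable_funX. Qed.

Lemma normsq_ge0 f : (0 <= normsq f)%E.
Proof. by apply: rint_ge0 => z; apply: sqr_ge0. Qed.

Lemma normsq_translate f s : admissible f -> normsq (fun z => f (a s z)) = normsq f.
Proof.
move=> [mf f0 fi]; apply: (@rint_translate (fun z => f z ^+ 2)).
- exact: rmeas_sqr.
- by move=> z; apply: sqr_ge0.
- by move=> h z; rewrite fi.
Qed.

Definition symm (S : seq Gam) : seq Gam := S ++ [seq (s^-1)%g | s <- S].

(** The term [f z] makes the averaging operator lazy, so that [variance_le]
    compares each [f (a s z)] with [f z]. *)
Definition walk_sum S f z : R := f z + \sum_(s <- symm S) f (a s z).

Definition walk_size (S : seq Gam) : R := (size (symm S)).+1%:R.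

Definition walk S f z : R := walk_sum S f z / walk_size S.

Definition displacement (S : seq Gam) f z : R :=
  \sum_(s <- S) (f (a s z) - f z) ^+ 2.

Lemma walk_size_gt0 S : 0 < walk_size S. Proof. by rewrite ltr0n. Qed.

Lemma walk_sum_meas S f : rmeas f -> rmeas (walk_sum S f).
Proof.
move=> mf; apply: measurable_funD => //; apply: measurable_sum => s.
exact: rmeas_translate.
Qed.

Lemma admissible_walk S f : admissible f -> admissible (walk S f).
Proof.
move=> [mf f0 fi]; split.
- by apply: measurable_funM; [exact: walk_sum_meas | exact: measurable_cst].
- move=> z; rewrite divr_ge0 ?(ltW (walk_size_gt0 S)) // addr_ge0 //.
  by apply: sumr_ge0.
- move=> h z; rewrite /walk /walk_sum fi; congr ((_ + _) / _).
  by apply: eq_bigr => s _; rewrite (ca_comm ca) fi.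
Qed.

Lemma rmeas_displacement S f : rmeas f -> rmeas (displacement S f).
Proof.
move=> mf; apply: measurable_sum => s; apply: measurable_funX.
by apply: measurable_funB => //; apply: rmeas_translate.
Qed.

Lemma displacement_ge0 S f z : 0 <= displacement S f z.
Proof. by apply: sumr_ge0 => s _; apply: sqr_ge0. Qed.

Lemma walk_variance S f z :
  walk_sum S f z ^+ 2 + displacement S f z <=
  walk_size S * (f z ^+ 2 + \sum_(s <- symm S) f (a s z) ^+ 2).
Proof.
have := variance_le (f z) [seq f (a s z) | s <- symm S].
rewrite !big_map size_map; apply: le_trans; rewrite lerD2l /displacement /symm.
rewrite big_cat /= lerDl.
by apply: sumr_ge0 => s _; apply: sqr_ge0.
Qed.

Lemma rint_walk_variance S f : admissible f ->
  (normsq (walk_sum S f) + rint (displacement S f) <=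
   (walk_size S ^+ 2)%:E * normsq f)%E.
Proof.
move=> af; have [mf f0 fi] := af.
have mw := walk_sum_meas S mf.
rewrite /normsq -rintD; [|exact: rmeas_sqr|exact: rmeas_displacement
  |by move=> z; apply: sqr_ge0|by move=> z; apply: displacement_ge0].
have mt s : rmeas (fun z => f (a s z) ^+ 2) by apply: rmeas_sqr; apply: rmeas_translate.
have ms : rmeas (fun z => \sum_(s <- symm S) f (a s z) ^+ 2) by apply: measurable_sum.
have s0 z : 0 <= \sum_(s <- symm S) f (a s z) ^+ 2.
  by apply: sumr_ge0 => s _; apply: sqr_ge0.
have mfs := rmeas_sqr mf.
have -> : ((walk_size S ^+ 2)%:E * normsq f)%E =
    rint (fun z => walk_size S * (f z ^+ 2 + \sum_(s <- symm S) f (a s z) ^+ 2)).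
  rewrite rintZ ?(ltW (walk_size_gt0 S)) //; first last.
  - by move=> z; rewrite addr_ge0 ?sqr_ge0.
  - exact: measurable_funD.
  rewrite rintD //; last by move=> z; apply: sqr_ge0.
  rewrite rint_sum //; last by move=> s z; apply: sqr_ge0.
  have -> : (\sum_(s <- symm S) normsq (fun z => f (a s z)) =
      \sum_(s <- symm S) normsq f)%E.
    by apply: eq_bigr => s _; apply: normsq_translate.
  rewrite -/(normsq f) expr2 EFinM -muleA; congr (_ * _)%E.
  rewrite /walk_size; elim: (symm S) => [|s L IH].
    by rewrite big_nil adde0 mul1e.
  rewrite big_cons addeCA -IH /= -[X in (X%:E * _)%E]natr1 EFinD.
  by rewrite ge0_muleDl ?lee_fin // mul1e addeC.
apply: rint_le.
- by apply: measurable_funD; [exact: rmeas_sqr | exact: rmeas_displacement].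
- by apply: measurable_funM; [exact: measurable_cst | exact: measurable_funD].
- by move=> z; rewrite addr_ge0 ?sqr_ge0 // displacement_ge0.
- exact: walk_variance.
Qed.

(** The squared norm lost by averaging is at least a fixed multiple of the
    integral of the displacement, so a lower bound on the latter yields a
    contraction. *)
Lemma walk_contraction S (k : R) f : admissible f -> (normsq f < +oo)%E ->
  (k%:E * normsq f <= rint (displacement S f))%E ->
  (normsq (walk S f) <= (1 - k / walk_size S ^+ 2)%:E * normsq f)%E.
Proof.
move=> af fin kf; have [mf f0 fi] := af.
have H := rint_walk_variance S af.
have N0 := walk_size_gt0 S; set N := walk_size S in H N0 *.
have mw := rmeas_sqr (walk_sum_meas S mf).
have -> : normsq (walk S f) = ((N ^- 2)%:E * normsq (walk_sum S f))%E.
  rewrite /normsq -rintZ //; last 2 first.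
  - by move=> z; apply: sqr_ge0.
  - by rewrite invr_ge0 sqr_ge0.
  by congr rint; apply/funext => z; rewrite /walk exprMn exprVn mulrC.
have w0 : (0 <= normsq (walk_sum S f))%E.
  by apply: rint_ge0 => z; apply: sqr_ge0.
have := le_trans (leeD2l (normsq (walk_sum S f)) kf) H.
have nE : normsq f = (fine (normsq f))%:E by rewrite fineK // ge0_fin_numE ?normsq_ge0.
rewrite nE; move: (fine _) => n H1.
have wE : normsq (walk_sum S f) = (fine (normsq (walk_sum S f)))%:E.
  rewrite fineK // ge0_fin_numE //.
  have := le_lt_trans H1 (ltry (N ^+ 2 * n)).
  by move: w0; case: (normsq (walk_sum S f)) => [r _ _|//|//]; apply: ltry.
rewrite wE lee_fin in H1; rewrite -/(normsq _) wE; move: (fine _) H1 => w H1.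
rewrite lee_fin -subr_ge0.
have -> : (1 - k / N ^+ 2) * n - N ^- 2 * w = N ^- 2 * (N ^+ 2 * n - (w + k * n)).
  by field; rewrite gt_eqF.
by rewrite mulr_ge0 ?invr_ge0 ?sqr_ge0 // subr_ge0.
Qed.

(** On the disjoint pieces of a countable cover by sets of finite measure, take
    constants whose squares times the measures have a finite sum, and extend
    the function from X to T along the orbits. *)
Lemma positive_square_integrable : sigma_finite [set: T] mu ->
  exists f, [/\ admissible f, forall z, 0 < f z & (normsq f < +oo)%E].
Proof.
move=> [F FT HF].
pose E := seqDU F.
have mE n : measurable (E n).
  apply: measurableD; first exact: (HF n).1.
  by apply: bigsetU_measurable => i _; exact: (HF i).1.
have Eex z : exists n, E n z.
  have : (\bigcup_n E n) z by rewrite -seqDU_bigcup_eq -FT.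
  by case=> n _ Enz; exists n.
have [k0 Hk0] := choice Eex.
have k0E n z : E n z -> k0 z = n.
  move=> Enz; apply: (@trivIset_seqDU _ F) => //.
  by exists z; split => //; apply: Hk0.
pose k z := k0 (fd_rep b X z).
pose w n : R := 2 ^- n / (1 + fine (mu (F n))).
have den n : 1 <= 1 + fine (mu (F n)) by rewrite lerDl fine_ge0.
have w0 n : 0 < w n.
  by rewrite divr_gt0 ?invr_gt0 ?exprn_gt0 // (lt_le_trans ltr01).
have mk n : measurable [set z | k z = n].
  have -> : [set z | k z = n] = fd_rep b X @^-1` (E n).
    by apply/seteqP; split=> z /=; [move=> <-; apply: Hk0 | apply: k0E].
  rewrite -[_ @^-1` _]setTI.
  by apply: (measurable_fd_rep (ca_right ca) (fun h => (ca_right_mp ca h).1) cDel (ca_fd ca)).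
exists (fun z => w (k z)); split; [split| |].
- exact: (@measurable_countable_factor _ _ _ k _ _ w).
- by move=> z; apply: ltW.
- by move=> h z; rewrite /k (fd_rep_act (ca_right ca) (ca_fd ca)).
- by move=> z.
have wm n : ((w n ^+ 2)%:E * mu (F n) <= (4^-1 ^+ n)%:E)%E.
  have muF : mu (F n) = (fine (mu (F n)))%:E.
    by rewrite fineK // ge0_fin_numE // (HF n).2.
  rewrite muF lee_fin; have := den n.
  have : 0 <= fine (mu (F n)) by rewrite fine_ge0.
  set x := fine _ => x0 x1.
  have y0 : 0 < 1 + x by apply: lt_le_trans x1.
  have -> : w n ^+ 2 = 4^-1 ^+ n / (1 + x) ^+ 2.
    rewrite /w -/x expr_div_n -exprVn -exprM mulnC exprM.
    by have -> : 2^-1 ^+ 2 = 4^-1 :> R by field.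
  rewrite -mulrA; apply: ler_piMr; first by rewrite exprn_ge0 // invr_ge0.
  rewrite mulrC ler_pdivrMr ?exprn_gt0 // mul1r; nra.
have q1 : (4^-1 : R) < 1 by rewrite invf_lt1 ?ltr1n.
apply: le_lt_trans (geometric_eseries_lty (ltW _) q1); last by rewrite invr_gt0.
apply: (@le_trans _ _ (\sum_(0 <= n <oo) \int[mu]_(z in X) ((w n ^+ 2)%:E * (\1_(F n) z)%:E)))%E.
  rewrite -integral_nneseries //; last 2 first.
  - move=> n; apply: measurable_funeM; apply/measurable_EFinP.
    by apply: measurable_indic; exact: (HF n).1.
  - by move=> n z _; rewrite mule_ge0 ?lee_fin ?sqr_ge0.
  apply: ge0_le_integral => //.
  - by move=> z _; rewrite lee_fin sqr_ge0.
  - apply: rmeasE; apply: rmeas_sqr.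
    exact: (@measurable_countable_factor _ _ _ k _ _ w).
  - apply: ge0_emeasurable_sum => n; first by move=> z _ _; rewrite mule_ge0 ?lee_fin ?sqr_ge0.
    move=> _; apply: measurable_funeM; apply/measurable_EFinP.
    by apply: measurable_indic; exact: (HF n).1.
  move=> z Xz.
  have Fz : F (k z) z.
    rewrite /k (fd_rep_id (ca_right ca) (ca_fd ca)) //.
    by apply: (@subset_seqDU _ F); apply: Hk0.
  apply: le_trans (nneseries_lim_ge (k z).+1 _); last first.
    by move=> n _ _; rewrite mule_ge0 ?lee_fin ?sqr_ge0.
  rewrite big_nat_recr //= indicE mem_set // mule1 leeDr //.
  by apply: sume_ge0 => n _; rewrite mule_ge0 ?lee_fin ?sqr_ge0.
apply: lee_nneseries => [n _ _|n _].
  by apply: integral_ge0 => z _; rewrite mule_ge0 ?lee_fin ?sqr_ge0.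
have mi : measurable_fun X (fun z => (\1_(F n) z)%:E : \bar R).
  by apply/measurable_EFinP; apply: measurable_indic; exact: (HF n).1.
have wp : (0 <= (w n ^+ 2)%:E)%E by rewrite lee_fin sqr_ge0.
rewrite ge0_integralZl //.
apply: le_trans (wm n); apply: lee_wpmul2l; first by rewrite lee_fin sqr_ge0.
rewrite integral_indic //; last exact: (HF n).1.
by apply: le_measure; rewrite ?inE //; [apply: measurableI => //; exact: (HF n).1 | exact: (HF n).1].
Qed.

End AlmostInvariant.

(** * Almost invariant vectors from invariant means *)

Section Kesten.
Context (R : realType) (Gam Del : groupType) (d : measure_display)
  (T : measurableType d) (mu : {measure set T -> \bar R}).
Variables (a : Gam -> T -> T) (b : Del -> T -> T) (X : set T).
Hypothesis cDel : countable [set: Del].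
Hypothesis ca : commuting_actions mu a b X.
Variable m : (T -> R) -> R.
Hypothesis mm : invariant_mean mu a b X m.

Let mX : measurable X := measurable_fd (ca_fd ca).
Let aK s z : a (s^-1)%g (a s z) = z := actK (ca_left ca) s z.

Lemma mean0 : m (fun=> 0) = 0. Proof. exact: mean_cst mm 0. Qed.

Lemma ess_bounded_opp f : ess_bounded mu X f -> ess_bounded mu X (fun x => - f x).
Proof.
move=> [mf [M fM]]; split; first exact: measurable_funN.
by exists M; apply: filterS fM => x fx /fx; rewrite normrN.
Qed.

Lemma ess_bounded_add f g : ess_bounded mu X f -> ess_bounded mu X g ->
  ess_bounded mu X (fun x => f x + g x).
Proof.
move=> [mf [M fM]] [mg [N gN]]; split; first exact: measurable_funD.
exists (M + N); apply: filterS2 fM gN => x fx gx Xx.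
by apply: le_trans (ler_normD _ _) _; apply: lerD; [exact: fx | exact: gx].
Qed.

Lemma mean_opp f : ess_bounded mu X f -> m (fun x => - f x) = - m f.
Proof.
move=> bf; have := mean_add mm bf (ess_bounded_opp bf).
have -> : (fun x => f x - f x) = (fun=> 0) by apply/funext => x; rewrite subrr.
by rewrite mean0 => /esym/eqP; rewrite addrC addr_eq0 => /eqP.
Qed.

Lemma mean_sum (I : eqType) (s : seq I) (f : I -> T -> R) :
  (forall i, i \in s -> ess_bounded mu X (f i)) ->
  ess_bounded mu X (fun x => \sum_(i <- s) f i x) /\
  m (fun x => \sum_(i <- s) f i x) = \sum_(i <- s) m (f i).
Proof.
elim: s => [|i s IH] H.
  have -> : (fun x => \sum_(i <- [::]) f i x) = (fun=> 0).
    by apply/funext => x; rewrite big_nil.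
  by rewrite big_nil mean0; split => //; apply: ess_bounded_cst.
have [|b1 e1] := IH; first by move=> j js; apply: H; rewrite inE js orbT.
have -> : (fun x => \sum_(i <- i :: s) f i x) = (fun x => f i x + \sum_(i <- s) f i x).
  by apply/funext => x; rewrite big_cons.
have bi := H i (mem_head _ _).
split; first exact: ess_bounded_add.
by rewrite (mean_add mm bi b1) e1 big_cons.
Qed.

Lemma mem_symmV (S : seq Gam) s : s \in symm S -> (s^-1)%g \in symm S.
Proof.
rewrite !mem_cat => /orP[sS|/mapP[t tS ->]]; last by rewrite invgK tS.
by rewrite map_f ?orbT.
Qed.

(** The logarithmic derivatives of [F] along the elements of the symmetric set
    are bounded, because each translate of [F] is one of the terms of the
    contracted sum.  The mean of the derivative along [s^-1] is the opposite of
    that along [s], so they add up to mean zero; but concavity of the logarithm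
    and the contraction bound their sum by a negative constant. *)
Lemma no_contracted_function (S : seq Gam) (q : R) (F : T -> \bar R) :
  0 < q -> q < 1 -> measurable_fun [set: T] F -> orbit_inv b F ->
  (forall z, (0 < F z)%E) -> {ae mu, forall z, X z -> (F z < +oo)%E} ->
  (forall z, (F z + \sum_(s <- symm S) F (a s z) <=
     (walk_size R S * q)%:E * F z)%E) -> False.
Proof.
move=> q0 q1 mF Fi F0 Ffin FS.
pose phi z := fine (F z); pose N := walk_size R S.
have N0 : 0 < N := walk_size_gt0 R S.
pose k := N * q; have k0 : 0 < k by rewrite mulr_gt0.
pose B : set T := [set z | (F z < +oo)%E].
have BE z : B z -> F z = (phi z)%:E.
  by move=> Bz; rewrite /phi fineK // ge0_fin_numE // ltW.
have phi0 z : B z -> 0 < phi z by move=> Bz; rewrite -lte_fin -BE.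
have Fs z s : s \in symm S -> (F (a s z) <= k%:E * F z)%E.
  move=> sS; apply: le_trans (FS z).
  have [L1 [L2 ->]] : exists L1 L2, symm S = L1 ++ s :: L2.
    by case/splitPr : sS => L1 L2; exists L1, L2.
  rewrite big_cat big_cons /= [X in (_ <= _ + X)%E]addeCA [leRHS]addeCA.
  rewrite leeDl // !adde_ge0 ?(ltW (F0 _)) // sume_ge0 // => t _; exact: ltW.
have Bs z s : s \in symm S -> B z -> B (a s z).
  move=> sS Bz; apply: le_lt_trans (Fs z s sS) _.
  by rewrite BE // -EFinM ltry.
have phis z s : s \in symm S -> B z -> phi (a s z) <= k * phi z.
  move=> sS Bz; rewrite -lee_fin EFinM -!BE //; last exact: Bs.
  exact: Fs.
pose c s z := ln (phi (a s z)) - ln (phi z).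
have mphi : measurable_fun [set: T] phi.
  by apply: (measurableT_comp _ mF); apply: fine_measurable.
have mlphi : measurable_fun [set: T] (fun z => ln (phi z)).
  exact: (measurableT_comp (@measurable_ln R) mphi).
have mc s : measurable_fun [set: T] (c s).
  apply: measurable_funB => //.
  by apply: (measurableT_comp mlphi); apply: (ca_left_mp ca s).1.
have c_up z s : s \in symm S -> B z -> c s z <= ln k.
  move=> sS Bz; rewrite /c lerBlDr -lnM ?posrE ?phi0 //.
  by rewrite ler_ln ?posrE ?mulr_gt0 ?phi0 //; [exact: phis | exact: Bs].
have cV s z : c (s^-1)%g (a s z) = - c s z by rewrite /c aK opprB.
have bc s : s \in symm S -> ess_bounded mu X (c s).
  move=> sS; split; first exact: measurable_funS (mc s).
  exists (ln k); apply: filterS Ffin => z Bz /Bz {}Bz.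
  rewrite ler_norml c_up // andbT lerNl -cV.
  by apply: c_up; [exact: mem_symmV | exact: Bs].
have ci s : orbit_inv b (c s).
  by move=> h z; rewrite /c /phi (ca_comm ca) !Fi.
have mcV s : s \in symm S -> m (c (s^-1)%g) = - m (c s).
  move=> sS; rewrite -(mean_inv mm s (bc _ (mem_symmV sS)) (ci _)).
  rewrite -mean_opp //; last exact: bc.
  by congr m; apply/funext => z; apply: cV.
have [bsum msum] := mean_sum bc.
have sum0 : \sum_(s <- symm S) m (c s) = 0.
  rewrite big_cat big_map /=.
  rewrite -big_split big_seq big1 // => s sS /=.
  by rewrite mcV ?subrr // mem_cat sS.
(* By ln x <= x - 1; the term F z of the contracted sum accounts for 1 of the
   N = 1 + |symm S|. *)
have : m (fun z => \sum_(s <- symm S) c s z) <= m (fun=> N * q - N).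
  apply: (mean_le mm) => //; first exact: ess_bounded_cst.
  apply: filterS Ffin => z Bz /Bz {}Bz.
  have p0 := phi0 z Bz.
  apply: (@le_trans _ _ (\sum_(s <- symm S) (phi (a s z) / phi z - 1))).
    rewrite big_seq [leRHS]big_seq; apply: ler_sum => s sS.
    have ps := phi0 _ (Bs z s sS Bz).
    rewrite /c -ln_div ?posrE //.
    rewrite -[in leLHS](subrK 1 (phi (a s z) / phi z)) addrC.
    by apply: le_ln1Dx; rewrite ltrBrDl subrr divr_gt0.
  rewrite sumrB -mulr_suml big_const_seq count_predT iter_addr_0.
  have : phi z + \sum_(s <- symm S) phi (a s z) <= N * q * phi z.
    rewrite -lee_fin EFinD EFinM -sumEFin -BE //.
    apply: le_trans (FS z); rewrite leeD2l //.
    rewrite big_seq [leRHS]big_seq; apply: lee_sum => s sS.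
    by rewrite BE //; apply: Bs.
  set P := \sum_(s <- symm S) _ => H.
  rewrite lerBlDr; apply: (@le_trans _ _ (N * q - 1)).
    rewrite ler_pdivrMr // mulrBl mul1r lerBrDl //.
  by rewrite /N /walk_size -natr1; set x := (size _)%:R; lra.
rewrite msum sum0 (mean_cst mm) subr_ge0 => H.
have : N * q < N by rewrite gtr_pMr.
by rewrite ltNge H.
Qed.

(** If every [f] were displaced by [S], averaging would contract squared norms
    by a factor r < 1.  For r <= q^4 and a positive [f0] of finite norm, the
    series F of q^-n times the n-th average of [f0] converges almost
    everywhere, and averaging shifts its terms, whence the contraction that
    [no_contracted_function] excludes. *)
Lemma almost_invariant_vectors (S : seq Gam) (k : R) : sigma_finite [set: T] mu -> 0 < k ->
  exists f, [/\ admissible b f, (normsq mu X f < +oo)%E &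
    (rint mu X (displacement a S f) < k%:E * normsq mu X f)%E].
Proof.
move=> sf k0; apply: contrapT => none.
have H f : admissible b f -> (normsq mu X f < +oo)%E ->
    (k%:E * normsq mu X f <= rint mu X (displacement a S f))%E.
  by move=> af ff; rewrite leNgt; apply/negP => lt; apply: none; exists f.
have [f0 [af0 f0pos f0fin]] := positive_square_integrable cDel ca sf.
pose N := walk_size R S; have N0 : 0 < N := walk_size_gt0 R S.
pose r := Num.max 0 (1 - k / N ^+ 2).
have r0 : 0 <= r by rewrite le_max lexx.
have r1 : r < 1.
  by rewrite gt_max ltr01 /= ltrBlDr ltrDl divr_gt0 // exprn_gt0.
pose q := 1 - (1 - r) / 4.
have q0 : 0 < q by rewrite /q; lra.
have q1 : q < 1 by rewrite /q; lra.
(* The exponent 4 leaves q^n in r^n * q^(-3 n). *)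
have rq : r <= q ^+ 4.
  have : 0 <= 1 - r by lra.
  have : 1 - r <= 1 by lra.
  rewrite /q; set x := (1 - r) / 4 => h1 h2.
  have -> : r = 1 - 4 * x by rewrite /x; field.
  have x0 : 0 <= x by rewrite /x; lra.
  have x1 : x <= 1 by rewrite /x; lra.
  have -> : (1 - x) ^+ 4 = 1 - 4 * x + x ^+ 2 * (6 - 4 * x + x ^+ 2) by ring.
  by rewrite lerDl mulr_ge0 ?sqr_ge0 //; nra.
pose g n := iter n (walk a S) f0.
have ag n : admissible b (g n).
  by elim: n => [//|n IH]; apply: (admissible_walk ca).
have g0 n z : 0 <= g n z by case: (ag n).
have step f : admissible b f -> (normsq mu X f < +oo)%E ->
    (normsq mu X (walk a S f) <= r%:E * normsq mu X f)%E.
  move=> af ff; apply: le_trans (walk_contraction cDel ca af ff (H f af ff)) _.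
  apply: lee_wpmul2r; first exact: normsq_ge0.
  by rewrite lee_fin le_max lexx orbT.
have gn n : (normsq mu X (g n) <= (r ^+ n)%:E * normsq mu X f0)%E.
  elim: n => [|n IH]; first by rewrite expr0 mul1e.
  have fin : (normsq mu X (g n) < +oo)%E.
    apply: le_lt_trans IH _; rewrite -(fineK (x := normsq mu X f0)) ?ge0_fin_numE ?normsq_ge0 //.
    by rewrite -EFinM ltry.
  apply: le_trans (step _ (ag n) fin) _.
  rewrite exprS EFinM -muleA; apply: lee_wpmul2l => //.
pose p := q^-1; have p0 : 0 < p by rewrite invr_gt0.
pose u n z := p ^+ n * g n z.
have u0 n z : 0 <= u n z by rewrite mulr_ge0 // exprn_ge0 // ltW.
(* The series G of the squares, with the larger weights p^(3 n), has a finite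
   integral.  Together with a geometric series it dominates F, because
   u n <= q^n + p^n * (u n)^2. *)
pose F z : \bar R := (\sum_(0 <= n <oo) (u n z)%:E)%E.
pose G z : \bar R := (\sum_(0 <= n <oo) (p ^+ (3 * n) * g n z ^+ 2)%:E)%E.
have mu_ n : measurable_fun [set: T] (u n).
  by apply: measurable_funM; [exact: measurable_cst | exact: adm_meas (ag n)].
have mF : measurable_fun [set: T] F.
  apply: ge0_emeasurable_sum => n; first by move=> z _ _; rewrite lee_fin.
  by move=> _; apply/measurable_EFinP; apply: mu_.
have G0 n z : 0 <= p ^+ (3 * n) * g n z ^+ 2.
  by rewrite mulr_ge0 ?sqr_ge0 // exprn_ge0 // ltW.
have mGn n : measurable_fun X (fun z => (p ^+ (3 * n) * g n z ^+ 2)%:E).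
  apply/measurable_EFinP; apply: measurable_funM; first exact: measurable_cst.
  by apply: measurable_funX; apply: measurable_funS (adm_meas (ag n)).
have mG : measurable_fun X G.
  by apply: ge0_emeasurable_sum => n; first by move=> z _ _; rewrite lee_fin.
have GE z : (0 <= G z)%E by apply: nneseries_ge0 => n _ _; rewrite lee_fin.
have Gint : mu.-integrable X G.
  apply/integrableP; split => //.
  have -> : (\int[mu]_(x in X) `|G x| = \int[mu]_(x in X) G x)%E.
    by apply: eq_integral => z _; rewrite gee0_abs.
  rewrite integral_nneseries //; last by move=> n z _; rewrite lee_fin.
  apply: (@le_lt_trans _ _ (\sum_(0 <= n <oo) ((fine (normsq mu X f0))%:E * (q ^+ n)%:E)))%E.
    apply: lee_nneseries => [n _ _|n _].
      by apply: integral_ge0 => z _; rewrite lee_fin.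
    have -> : (\int[mu]_(z in X) (p ^+ (3 * n) * g n z ^+ 2)%:E =
        (p ^+ (3 * n))%:E * normsq mu X (g n))%E.
      apply: (rintZ ca (F := fun z => g n z ^+ 2)).
      - by apply: measurable_funX; apply: adm_meas.
      - by move=> z; apply: sqr_ge0.
      - by rewrite exprn_ge0 // ltW.
    rewrite fineK ?ge0_fin_numE ?normsq_ge0 //.
    apply: (@le_trans _ _ ((p ^+ (3 * n))%:E * ((r ^+ n)%:E * normsq mu X f0)))%E.
      by apply: lee_wpmul2l => //; rewrite lee_fin exprn_ge0 // ltW.
    rewrite muleA muleC; apply: lee_wpmul2l; first exact: normsq_ge0.
    rewrite -EFinM lee_fin exprM -exprMn lerXn2r ?nnegrE ?mulr_ge0 ?exprn_ge0 ?(ltW p0) ?(ltW q0) //.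
    rewrite /p exprVn mulrC ler_pdivrMr ?exprn_gt0 // -exprS //.
  rewrite nneseriesZl; last by move=> n _; rewrite lee_fin exprn_ge0 // ltW.
  have := geometric_eseries_lty (ltW q0) q1.
  have : (0 <= \sum_(0 <= n <oo) (q ^+ n)%:E)%E.
    by apply: nneseries_ge0 => n _ _; rewrite lee_fin exprn_ge0 // ltW.
  case: (\sum_(0 <= n <oo) (q ^+ n)%:E)%E => // x _ _.
  by rewrite -EFinM ltry.
apply: (@no_contracted_function S q F) => //.
- by move=> h z; apply: eq_eseriesr => n _; rewrite /u (adm_inv (ag n)).
- move=> z; apply: lt_le_trans (nneseries_lim_ge 1 _); last first.
    by move=> n _ _; rewrite lee_fin.
  by rewrite big_nat1 lte_fin /u expr0 mul1r.
- have := integrable_ae mX Gint; apply: filterS => z Gz /Gz {}Gz.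
  apply: (@le_lt_trans _ _ (\sum_(0 <= n <oo) ((q ^+ n)%:E +
    (p ^+ (3 * n) * g n z ^+ 2)%:E)))%E.
    apply: lee_nneseries => [n _ _|n _]; first by rewrite lee_fin.
    rewrite -EFinD lee_fin.
    have -> : p ^+ (3 * n) * g n z ^+ 2 = p ^+ n * u n z ^+ 2.
      have -> : p ^+ (3 * n) = p ^+ n * p ^+ n * p ^+ n.
        by rewrite -!exprD !mulSn mul0n addn0 addnA.
      by rewrite /u; ring.
    rewrite /p exprVn; set y := q ^+ n; set x := u n z.
    have y0 : 0 < y by rewrite exprn_gt0.
    have x0 : 0 <= x := u0 n z.
    rewrite -(ler_pM2l y0).
    have -> : y * (y + y^-1 * x ^+ 2) = y ^+ 2 + x ^+ 2 by field; rewrite gt_eqF.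
    have := sqr_ge0 (y - x); nra.
  rewrite nneseriesD; last 2 first.
  + by move=> n _ _; rewrite lee_fin exprn_ge0 // ltW.
  + by move=> n _ _; rewrite lee_fin.
  rewrite lte_add_pinfty //; first exact: geometric_eseries_lty (ltW q0) q1.
  by move: Gz; rewrite ge0_fin_numE.
move=> z.
have -> : (\sum_(s <- symm S) F (a s z) =
    \sum_(0 <= n <oo) \sum_(s <- symm S) (u n (a s z))%:E)%E.
  by rewrite nneseries_sum // => s n _; rewrite lee_fin.
rewrite /F -nneseriesD; last 2 first.
- by move=> n _ _; rewrite lee_fin.
- by move=> n _ _; apply: sume_ge0 => s _; rewrite lee_fin.
have Nq0 : 0 <= N * q by rewrite mulr_ge0 // ltW.
rewrite -nneseriesZl; last by move=> n _; rewrite lee_fin.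
have E n : ((u n z)%:E + \sum_(s <- symm S) (u n (a s z))%:E =
    (N * q)%:E * (u n.+1 z)%:E)%E.
  rewrite sumEFin -EFinD -EFinM; congr EFin.
  rewrite /u -mulr_sumr -mulrDr /= /walk -/(walk_sum _ _ _ _) -/N exprS.
  by rewrite /p; field; rewrite !gt_eqF.
rewrite (eq_eseriesr (fun n _ => E n)).
(* The left-hand side is N * q times the series F without its first term. *)
rewrite [leRHS]nneseries_recl //; last first.
  by move=> n _; rewrite mule_ge0 ?lee_fin.
rewrite -[X in (_ <= _ + X)%E](nneseries_addn (f := fun n => ((N * q)%:E * (u n z)%:E)%E) 1); last first.
  by move=> n; rewrite mule_ge0 ?lee_fin.
under [X in (_ <= _ + X)%E]eq_eseriesr => n _ do rewrite addn1.
by rewrite leeDr // mule_ge0 ?lee_fin ?mulr_ge0 // ltW.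
Qed.

End Kesten.

(** * Integrals of complex functions *)

Section ComplexIntegral.
Context (R : realType) (d : measure_display) (T : measurableType d)
  (mu : {measure set T -> \bar R}) (D : set T).
Hypothesis mD : measurable D.
Local Notation C := R[i].
Implicit Types (F G : T -> C) (H : T -> R).

Definition rintegrable H : Prop := mu.-integrable D (EFin \o H).

Definition cmeasurable F : Prop :=
  measurable_fun D (fun z => complex.Re (F z)) /\
  measurable_fun D (fun z => complex.Im (F z)).

Definition cintegrable F : Prop :=
  rintegrable (fun z => complex.Re (F z)) /\ rintegrable (fun z => complex.Im (F z)).

Definition cint F : C :=
  (\int[mu]_(z in D) complex.Re (F z)) +i* (\int[mu]_(z in D) complex.Im (F z)).

Lemma rintegrableD H1 H2 : rintegrable H1 -> rintegrable H2 ->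
  rintegrable (fun z => H1 z + H2 z).
Proof.
move=> i1 i2; have := integrableD mD i1 i2.
by apply: eq_integrable => // z _.
Qed.

Lemma rintegrableZ k H : rintegrable H -> rintegrable (fun z => k * H z).
Proof. by move=> i1; have := integrableZl mD k i1. Qed.

Lemma rintegrable_dom H1 H2 : measurable_fun D H1 -> rintegrable H2 ->
  (forall z, D z -> `|H1 z| <= H2 z) -> rintegrable H1.
Proof.
move=> m1 i2 le; apply: (le_integrable mD _ _ i2); first exact/measurable_EFinP.
by move=> z Dz /=; rewrite lee_fin; apply: le_trans (le z Dz) (ler_norm _).
Qed.

Lemma rintegrable_norm H : rintegrable H -> rintegrable (fun z => `|H z|).
Proof. by move=> iH; have := integrable_norm iH. Qed.

Lemma cmeasurable_linear a F G : cmeasurable F -> cmeasurable G ->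
  cmeasurable (fun z => a * F z + G z).
Proof.
move=> [fr fi] [gr gi]; case: a => x y; split.
  have -> : (fun z => complex.Re ((x +i* y) * F z + G z)) =
    (fun z => (x * complex.Re (F z) - y * complex.Im (F z)) + complex.Re (G z)).
    by apply/funext => z; case: (F z) (G z) => ? ? [].
  by apply: measurable_funD => //; apply: measurable_funB;
    apply: measurable_funM => //; exact: measurable_cst.
have -> : (fun z => complex.Im ((x +i* y) * F z + G z)) =
    (fun z => (x * complex.Im (F z) + y * complex.Re (F z)) + complex.Im (G z)).
  by apply/funext => z; case: (F z) (G z) => ? ? [].
by apply: measurable_funD => //; apply: measurable_funD;
  apply: measurable_funM => //; exact: measurable_cst.
Qed.

Lemma cint_linear a F G : cintegrable F -> cintegrable G ->
  cintegrable (fun z => a * F z + G z) /\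
  cint (fun z => a * F z + G z) = a * cint F + cint G.
Proof.
move=> [fr fi] [gr gi]; case: a => x y.
have E1 : (fun z => complex.Re ((x +i* y) * F z + G z)) =
    (fun z => (x * complex.Re (F z) + (- y) * complex.Im (F z)) + complex.Re (G z)).
  by apply/funext => z; rewrite mulNr; case: (F z) (G z) => ? ? [].
have E2 : (fun z => complex.Im ((x +i* y) * F z + G z)) =
    (fun z => (x * complex.Im (F z) + y * complex.Re (F z)) + complex.Im (G z)).
  by apply/funext => z; case: (F z) (G z) => ? ? [].
have i1 := rintegrableZ x fr; have i2 := rintegrableZ (- y) fi.
have i3 := rintegrableZ x fi; have i4 := rintegrableZ y fr.
have j1 := rintegrableD i1 i2; have j2 := rintegrableD i3 i4.
rewrite /cintegrable /cint E1 E2; split.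
  by split; apply: rintegrableD.
rewrite !RintegralD // !RintegralZl //.
by apply/eqP; rewrite eq_complex /= mulNr !eqxx.
Qed.

Lemma cintegrable0 : cintegrable (fun=> 0).
Proof. by split; apply: integrable0. Qed.

Lemma cint0 : cint (fun=> 0) = 0.
Proof. by rewrite /cint /= !Rintegral_cst // !mul0r. Qed.

Lemma cint_sum I (s : seq I) (k : I -> C) (F : I -> T -> C) :
  (forall i, cintegrable (F i)) ->
  cintegrable (fun z => \sum_(i <- s) k i * F i z) /\
  cint (fun z => \sum_(i <- s) k i * F i z) = \sum_(i <- s) k i * cint (F i).
Proof.
move=> iF; elim: s => [|i s [IH1 IH2]].
  have -> : (fun z => \sum_(i <- [::]) k i * F i z) = (fun=> 0).
    by apply/funext => z; rewrite big_nil.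
  by rewrite big_nil; split; [exact: cintegrable0 | exact: cint0].
have -> : (fun z => \sum_(i <- i :: s) k i * F i z) =
    (fun z => k i * F i z + \sum_(i <- s) k i * F i z).
  by apply/funext => z; rewrite big_cons.
by rewrite big_cons -IH2; apply: cint_linear.
Qed.

Lemma eq_cint F G : (forall z, D z -> F z = G z) -> cint F = cint G.
Proof.
move=> FG; rewrite /cint; congr (_ +i* _); apply: eq_Rintegral => z;
  by rewrite inE => /FG ->.
Qed.

Lemma cint_ge0 F : (forall z, D z -> 0 <= F z) -> 0 <= cint F.
Proof.
move=> F0; have -> : cint F = (\int[mu]_(z in D) complex.Re (F z))%:C.
  rewrite /cint; congr (_ +i* _).
  rewrite (@eq_Rintegral _ _ _ _ _ (fun=> 0)) ?Rintegral_cst ?mul0r //.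
  by move=> z; rewrite inE => /F0 /ger0_Im.
rewrite ler0c; apply: Rintegral_ge0 => z /F0.
by rewrite lecE => /andP[].
Qed.

Lemma cint_real H : cint (fun z => (H z)%:C) = (\int[mu]_(z in D) H z)%:C.
Proof. by rewrite /cint /= Rintegral_cst // mul0r. Qed.

Lemma cintegrable_real H : rintegrable H -> cintegrable (fun z => (H z)%:C).
Proof. by move=> iH; split => //; apply: integrable0. Qed.

Lemma norm_complex_le (x y : R) : `|x +i* y| <= (`|x| + `|y|)%:C.
Proof.
have -> : x +i* y = x%:C + 'i * y%:C by simpc.
apply: le_trans (ler_normD _ _) _; rewrite normrM normCi mul1r.
by rewrite !normc_def /= expr0n !addr0 !sqrtr_sqr rmorphD.
Qed.

Lemma ReIm_le_norm (z : C) (c : R) : `|z| <= c%:C ->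
  `|complex.Re z| + `|complex.Im z| <= 2 * c.
Proof.
move=> zc; have h1 : `|complex.Re z| <= c.
  by have := le_trans (normc_ge_Re z) zc; rewrite lecR.
have h2 : `|complex.Im z| <= c.
  have := normc_ge_Re ('i * z); rewrite normrM normCi mul1r => /le_trans /(_ zc).
  by rewrite lecR; case: (z) => p q; rewrite /= mul0r mul1r sub0r normrN.
by rewrite mulr2n mulrDl !mul1r lerD.
Qed.

Lemma cint_norm_le F : cintegrable F ->
  `|cint F| <= (\int[mu]_(z in D) (`|complex.Re (F z)| + `|complex.Im (F z)|))%:C.
Proof.
move=> [fr fi]; apply: le_trans (norm_complex_le _ _) _; rewrite lecR.
rewrite RintegralD //; do ?exact: rintegrable_norm.
by apply: lerD; apply: le_normr_Rintegral.
Qed.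

(** The factor 2 comes from bounding the real and the imaginary part
    separately. *)
Lemma cint_norm_bound F H : cintegrable F -> rintegrable H ->
  (forall z, D z -> `|F z| <= (H z)%:C) ->
  `|cint F| <= (2 * \int[mu]_(z in D) H z)%:C.
Proof.
move=> iF iH le; apply: le_trans (cint_norm_le iF) _; rewrite lecR -RintegralZl //.
case: iF => fr fi; apply: le_Rintegral => //.
- by apply: rintegrableD; apply: rintegrable_norm.
- exact: rintegrableZ.
- by move=> z /le; apply: ReIm_le_norm.
Qed.

Lemma cintegrable_dom F H : cmeasurable F -> rintegrable H ->
  (forall z, D z -> `|F z| <= (H z)%:C) -> cintegrable F.
Proof.
move=> [mr mi] iH le; have i2 := rintegrableZ 2 iH.
split; apply: (rintegrable_dom _ i2) => // z /le /ReIm_le_norm; apply: le_trans.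
  by rewrite lerDl.
by rewrite lerDr.
Qed.

Lemma cint_dominated (Fn : nat -> T -> C) F H :
  (forall n, cmeasurable (Fn n)) -> cintegrable F -> rintegrable H ->
  (forall n z, D z -> `|Fn n z - F z| <= (H z)%:C) ->
  (forall z, D z -> forall e : R, 0 < e -> exists N, forall n, (N <= n)%N ->
     `|Fn n z - F z| < e%:C) ->
  forall e : R, 0 < e -> exists N, forall n, (N <= n)%N -> `|cint (Fn n) - cint F| < e%:C.
Proof.
move=> mFn iF iH dom pw.
have mF : cmeasurable F.
  by case: iF => /integrableP[/measurable_EFinP mr _] /integrableP[/measurable_EFinP mi _].
pose G n z := Fn n z - F z.
have mG n : cmeasurable (G n).
  have := cmeasurable_linear (-1) mF (mFn n).
  by congr cmeasurable; apply/funext => z; rewrite mulN1r addrC.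
have iG n : cintegrable (G n) := cintegrable_dom (mG n) iH (dom n).
have cE n : cint (Fn n) - cint F = cint (G n).
  have [_ E] := cint_linear 1 (iG n) iF.
  rewrite mul1r in E; apply/eqP; rewrite subr_eq -E; apply/eqP; congr cint.
  by apply/funext => z; rewrite mul1r subrK.
pose h n z := `|complex.Re (G n z)| + `|complex.Im (G n z)|.
have h0 n z : 0 <= h n z by rewrite addr_ge0.
have mh n : measurable_fun D (h n).
  case: (mG n) => mr mi; apply: measurable_funD.
    exact: (measurableT_comp (@normr_measurable _ setT)).
  exact: (measurableT_comp (@normr_measurable _ setT)).
have [_ _ cvg] : [/\ mu.-integrable D (cst 0%E : T -> \bar R),
    ([sequence \int[mu]_(x in D) `|(h n x)%:E - cst 0%E x|]_n @ \oo --> 0)%E &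
    ([sequence \int[mu]_(x in D) (h n x)%:E]_n @ \oo --> \int[mu]_(x in D) cst 0 x)%E].
  apply: (@dominated_convergence _ _ _ mu D mD (fun n z => (h n z)%:E) _ (fun z => (2 * H z)%:E)).
  - by move=> n; apply/measurable_EFinP.
  - exact: measurable_cst.
  - apply: aeW => z Dz; apply: cvg_EFin; first exact: nearW.
    apply/cvgrPdist_lt => e e0.
    have [N HN] := pw z Dz (e / 3) (divr_gt0 e0 (ltr0Sn _ 2)); exists N => // n /= Nn.
    rewrite sub0r normrN ger0_norm //.
    apply: le_lt_trans (ReIm_le_norm (ltW (HN n Nn))) _; lra.
  - exact: rintegrableZ.
  - apply: aeW => z n Dz; rewrite lee_fin ger0_norm //.
    exact: ReIm_le_norm (dom n z Dz).
move=> e e0.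
move: cvg; rewrite integral0 => cvg.
have : \forall n \near \oo, (\int[mu]_(x in D) (h n x)%:E < e%:E)%E.
  have := cvg [set y | y < e%:E]%E; apply.
  by apply: open_nbhs_nbhs; split; [exact: open_ereal_lt_ereal | rewrite /= lte_fin].
move=> [N _ HN]; exists N => n Nn; rewrite cE.
apply: le_lt_trans (cint_norm_le (iG n)) _; rewrite ltcR.
have := HN n Nn; rewrite /Rintegral /= => lt.
rewrite -lte_fin fineK // ge0_fin_numE ?(lt_trans lt (ltry _)) //.
by apply: integral_ge0 => z _; rewrite lee_fin.
Qed.

End ComplexIntegral.

(** * Transfer of functions from one group to the other *)

Section Transfer.
Context (R : realType) (Gam Del : groupType) (d : measure_display)
  (T : measurableType d) (mu : {measure set T -> \bar R}).
Variables (a : Gam -> T -> T) (b : Del -> T -> T) (X : set T).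
Hypothesis cDel : countable [set: Del].
Hypothesis ca : commuting_actions mu a b X.
Local Notation C := R[i].
Local Notation cj := (@Num.conj C).

Let mX : measurable X := measurable_fd (ca_fd ca).
Let c := cocyc b X.

Lemma measurable_cocyc_act g h : measurable [set z | c (a g z) = h].
Proof.
have := (ca_left_mp ca g).1 measurableT.
have mc := measurable_cocyc (ca_right ca) (fun h => (ca_right_mp ca h).1) (ca_fd ca) h.
by move=> /(_ _ mc); rewrite setTI.
Qed.

Lemma measurable_cocyc_pair (h : Del -> Del -> R) g1 g2 :
  measurable_fun [set: T] (fun z => h (c (a g1 z)) (c (a g2 z))).
Proof.
apply: (@measurable_countable_factor _ _ _ (fun z => (c (a g1 z), c (a g2 z)))
  _ _ (fun p => h p.1 p.2)); first by rewrite -setXTT; apply: countableX.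
move=> [x y].
have -> : [set z | (c (a g1 z), c (a g2 z)) = (x, y)] =
    [set z | c (a g1 z) = x] `&` [set z | c (a g2 z) = y].
  by apply/seteqP; split=> z /= [-> ->].
by apply: measurableI; apply: measurable_cocyc_act.
Qed.

Lemma cocyc_translate g h z : c (a g (b h z)) = (c (a g z) * h^-1)%g.
Proof. by rewrite (ca_comm ca) /c (cocyc_act (ca_right ca) (ca_fd ca)). Qed.

(** A kernel on [Del] evaluated along the orbit of [z] by means of the cocycle,
    and weighted by [f]. *)
Definition integrand (w : Del -> Del -> C) (f : T -> R) g1 g2 (z : T) : C :=
  w (c (a g1 z)) (c (a g2 z)) * (f (a g1 z) * f (a g2 z))%:C.

Definition wint w f g1 g2 : C := cint mu X (integrand w f g1 g2).

Definition bounded2 (M : R) (w : Del -> Del -> C) : Prop :=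
  forall x y, `|w x y| <= M%:C.

Section FixedVector.
Variable f : T -> R.
Hypothesis af : admissible b f.
Hypothesis ffin : (normsq mu X f < +oo)%E.

Lemma meas_integrand w g1 g2 :
  measurable_fun [set: T] (fun z => complex.Re (integrand w f g1 g2 z)) /\
  measurable_fun [set: T] (fun z => complex.Im (integrand w f g1 g2 z)).
Proof.
have mf g := rmeas_translate ca g (adm_meas af).
split.
  have -> : (fun z => complex.Re (integrand w f g1 g2 z)) =
      (fun z => complex.Re (w (c (a g1 z)) (c (a g2 z))) * (f (a g1 z) * f (a g2 z))).
    by apply/funext => z; rewrite /integrand; case: (w _ _) => x y /=;
      rewrite mulr0 subr0.
  apply: measurable_funM; last by apply: measurable_funM; apply: mf.
  exact: (measurable_cocyc_pair (fun x y => complex.Re (w x y))).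
have -> : (fun z => complex.Im (integrand w f g1 g2 z)) =
    (fun z => complex.Im (w (c (a g1 z)) (c (a g2 z))) * (f (a g1 z) * f (a g2 z))).
  by apply/funext => z; rewrite /integrand; case: (w _ _) => x y /=;
    rewrite mulr0 add0r.
apply: measurable_funM; last by apply: measurable_funM; apply: mf.
exact: (measurable_cocyc_pair (fun x y => complex.Im (w x y))).
Qed.

Lemma cmeas_integrand w g1 g2 : cmeasurable X (integrand w f g1 g2).
Proof.
by have [mr mi] := meas_integrand w g1 g2; split;
  [exact: measurable_funS mr | exact: measurable_funS mi].
Qed.

Lemma rintegrable_sqr g : rintegrable mu X (fun z => f (a g z) ^+ 2).
Proof.
apply/integrableP; split.
  by apply: rmeasE; apply: rmeas_sqr; apply: (rmeas_translate ca g (adm_meas af)).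
have -> : (\int[mu]_(x in X) `|(EFin \o (fun z => (f (a g z) ^+ 2)%R)) x| =
    normsq mu X (fun z => f (a g z)))%E.
  by apply: eq_integral => z _; rewrite gee0_abs //= lee_fin sqr_ge0.
by rewrite (normsq_translate cDel ca).
Qed.

Lemma rintegrable_weight g1 g2 :
  rintegrable mu X (fun z => f (a g1 z) * f (a g2 z)).
Proof.
have i1 := rintegrableD mX (rintegrable_sqr g1) (rintegrable_sqr g2).
apply: (rintegrable_dom mX _ i1).
  have mf g : measurable_fun X (fun z => f (a g z)).
    exact: measurable_funS (rmeas_translate ca g (adm_meas af)).
  exact: measurable_funM.
move=> z _; rewrite ger0_norm ?mulr_ge0 ?(adm_ge0 af) //.
have := sqr_ge0 (f (a g1 z) - f (a g2 z)).
have := sqr_ge0 (f (a g1 z)); have := sqr_ge0 (f (a g2 z)); nra.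
Qed.

Lemma norm_integrand M w g1 g2 z : bounded2 M w ->
  `|integrand w f g1 g2 z| <= (M * (f (a g1 z) * f (a g2 z)))%:C.
Proof.
move=> wM; have fp : 0 <= (f (a g1 z) * f (a g2 z))%:C.
  by rewrite ler0c mulr_ge0 ?(adm_ge0 af).
by rewrite /integrand normrM (ger0_norm fp) [leRHS]rmorphM; apply: ler_wpM2r.
Qed.

Lemma cintegrable_integrand M w g1 g2 : bounded2 M w ->
  cintegrable mu X (integrand w f g1 g2).
Proof.
move=> wM; apply: (cintegrable_dom mX (cmeas_integrand w g1 g2)
  (rintegrableZ mX M (rintegrable_weight g1 g2))) => z _.
exact: norm_integrand.
Qed.

(** For each [z] the integrand is the kernel [K] pulled back along a map from
    [Gam] to [Del] and multiplied by real weights, hence positive, and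
    integration preserves positivity.  The label in [I] is carried along: it
    is the block index of a Herz-Schur kernel. *)
Lemma psd_wint (I : Type) (K : Del * I -> Del * I -> C) (M : R) :
  psd K -> (forall s t, `|K s t| <= M%:C) ->
  psd (fun s t : Gam * I =>
    wint (fun x y => K (x^-1, s.2)%g (y^-1, t.2)%g) f (s.1^-1)%g (t.1^-1)%g).
Proof.
move=> Kp KM L.
pose w (s t : Gam * I) x y := K (x^-1, s.2)%g (y^-1, t.2)%g.
pose F (s t : Gam * I) := integrand (w s t) f (s.1^-1)%g (t.1^-1)%g.
have iF s t : cintegrable mu X (F s t).
  by apply: (@cintegrable_integrand M) => x y; apply: KM.
have inner p := cint_sum mX L (fun q => p.1 * cj q.1) (fun q => iF p.2 q.2).
have outer := cint_sum mX L (fun _ => 1) (fun p => (inner p).1).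
have -> : \sum_(p <- L) \sum_(q <- L) p.1 * cj q.1 * cint mu X (F p.2 q.2) =
    cint mu X (fun z => \sum_(p <- L) 1 * \sum_(q <- L) p.1 * cj q.1 * F p.2 q.2 z).
  by rewrite outer.2; apply: eq_bigr => p _; rewrite mul1r (inner p).2.
apply: cint_ge0 => // z _.
have := psd_comp (fun s : Gam * I => ((c (a (s.1^-1)%g z))^-1, s.2)%g)
  (fun s => (f (a (s.1^-1)%g z))%:C) Kp L.
congr (0 <= _); apply: eq_bigr => p _; rewrite mul1r; apply: eq_bigr => q _.
have cr (x : R) : cj x%:C = x%:C by rewrite cjE /= oppr0.
by rewrite /F /integrand /w cr rmorphM /=; ring.
Qed.

(** For a right invariant kernel the integrand is [b]-invariant, so that
    translating by [g] does not change its integral over X. *)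
Lemma wint_translate w g g1 g2 : (forall x y h, w (x * h)%g (y * h)%g = w x y) ->
  wint w f (g1 * g)%g (g2 * g)%g = wint w f g1 g2.
Proof.
move=> wi; have [mr mi] := meas_integrand w g1 g2.
have Finv : orbit_inv b (integrand w f g1 g2).
  by move=> h z; rewrite /integrand !cocyc_translate wi !(ca_comm ca) !(adm_inv af).
have E z : integrand w f (g1 * g)%g (g2 * g)%g z = integrand w f g1 g2 (a g z).
  by rewrite /integrand !(actM (ca_left ca)).
rewrite /wint /cint /Rintegral; congr (fine _ +i* fine _).
  under eq_integral => z _ do rewrite E.
  apply: (integral_invariant_real cDel ca (F := fun z => complex.Re (integrand w f g1 g2 z))) => //.
  by move=> h z; rewrite Finv.
under eq_integral => z _ do rewrite E.
apply: (integral_invariant_real cDel ca (F := fun z => complex.Im (integrand w f g1 g2 z))) => //.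
by move=> h z; rewrite Finv.
Qed.

(** The inverses turn the kernel [u (y^-1 * x)] into a right invariant one,
    matching the behaviour of the cocycle along [b]-orbits. *)
Definition transfer_kernel (u : Del -> C) (x y : Del) : C := u (y * x^-1)%g.

Definition transfer (u : Del -> C) (g : Gam) : C :=
  wint (transfer_kernel u) f (g^-1)%g 1%g.

Lemma wint_transfer u g h :
  wint (transfer_kernel u) f (g^-1)%g (h^-1)%g = transfer u (h^-1 * g)%g.
Proof.
rewrite /transfer invgM invgK -(@wint_translate _ (h^-1)%g _ 1%g).
  by rewrite mul1g -mulgA mulgV mulg1.
by move=> x y k; rewrite /transfer_kernel invgM mulgA mulgK.
Qed.

Hypothesis f1 : (normsq mu X f <= 1)%E.

Lemma Rintegral_sqr_le1 g : \int[mu]_(z in X) (f (a g z) * f (a g z)) <= 1.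
Proof.
rewrite /Rintegral.
have -> : (\int[mu]_(z in X) (f (a g z) * f (a g z))%:E = normsq mu X f)%E.
  by rewrite -(normsq_translate cDel ca g af).
by rewrite -lee_fin fineK // ge0_fin_numE ?normsq_ge0.
Qed.

Lemma wint_diag_le (w : Del -> Del -> C) (M : R) g :
  bounded2 M w -> 0 <= M -> (forall x, w x x <= M%:C) -> wint w f g g <= M%:C.
Proof.
move=> wM M0 wx.
have i1 := cintegrable_integrand g g wM.
have i2 := cintegrable_real (rintegrableZ mX M (rintegrable_weight g g)).
have [_ E] := cint_linear mX (-1) i1 i2.
have : 0 <= cint mu X (fun z => -1 * integrand w f g g z +
    (M * (f (a g z) * f (a g z)))%:C).
  apply: cint_ge0 => // z _; rewrite mulN1r addrC subr_ge0 rmorphM.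
  by apply: ler_wpM2r; rewrite ?ler0c ?mulr_ge0 ?(adm_ge0 af).
rewrite E mulN1r addrC subr_ge0 => /le_trans; apply.
rewrite cint_real // lecR RintegralZl //; last exact: rintegrable_weight.
by apply: ler_piMr => //; apply: Rintegral_sqr_le1.
Qed.

(** Both blocks of the kernel are transported in the same way; the diagonal
    bounds survive because [f] has norm at most 1. *)
Lemma herz_schur_transfer M u : herz_schur_le M M u -> herz_schur_le M M (transfer u).
Proof.
move=> [K [Kp Ku Ka Kb]].
have Kd s : K s s <= M%:C by case: s => g [].
have KM s t : `|K s t| <= M%:C by apply: psd_bound.
have M0 : 0 <= M.
  by rewrite -ler0c; apply: le_trans (Ka 1%g); apply: psd_diag_ge0.
exists (fun s t => wint (fun x y => K (x^-1, s.2)%g (y^-1, t.2)%g) f (s.1^-1)%g (t.1^-1)%g).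
split.
- exact: (psd_wint Kp KM).
- move=> g h /=; rewrite -(wint_transfer u g h).
  have -> // : (fun x y => K (x^-1, false)%g (y^-1, true)%g) = transfer_kernel u.
  by apply/funext => x; apply/funext => y; rewrite Ku invgK.
- by move=> g; apply: wint_diag_le => // x y; exact: KM.
- by move=> g; apply: wint_diag_le => // x y; exact: KM.
Qed.

Lemma positive_definite_transfer u : positive_definite u ->
  positive_definite (transfer u).
Proof.
rewrite !positive_definite_psd => up.
have u1 : u 1%g = (complex.Re (u 1%g))%:C.
  have := psd_diag_ge0 up 1%g; rewrite mulVg => /ger0_Im.
  by case: (u 1%g) => x y /= ->.
have bnd s t : `|u (t^-1 * s)%g| <= (complex.Re (u 1%g))%:C.
  by apply: (psd_bound up); rewrite mulVg -u1.
pose K (s t : Del * unit) := u (t.1^-1 * s.1)%g.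
have Kp : psd K.
  move=> L; have := up [seq (p.1, p.2.1) | p <- L].
  by rewrite big_map; under eq_bigr => p _ do rewrite big_map /=.
have := psd_wint Kp (fun s t => bnd s.1 t.1).
move=> Hp L; have := Hp [seq (p.1, (p.2, tt)) | p <- L].
rewrite big_map; under eq_bigr => p _ do rewrite big_map /=.
congr (0 <= _); apply: eq_bigr => p _; apply: eq_bigr => q _.
congr (_ * _).
have -> : (fun x y => K (x^-1, (p.2, tt).2)%g (y^-1, (q.2, tt).2)%g) = transfer_kernel u.
  by apply/funext => x; apply/funext => y; rewrite /K /= invgK.
exact: (wint_transfer u p.2 q.2).
Qed.

End FixedVector.
End Transfer.

(** * Limits and bounds of transferred functions *)

Section Limits.
Context (R : realType) (Gam Del : groupType) (d : measure_display)
  (T : measurableType d) (mu : {measure set T -> \bar R}).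
Variables (a : Gam -> T -> T) (b : Del -> T -> T) (X : set T).
Hypothesis cDel : countable [set: Del].
Hypothesis ca : commuting_actions mu a b X.
Local Notation C := R[i].

Let mX : measurable X := measurable_fd (ca_fd ca).
Local Notation c := (cocyc b X).
Local Notation integrand := (integrand a b X).
Local Notation wint := (wint mu a b X).
Local Notation transfer := (transfer mu a b X).

Variable f : T -> R.
Hypothesis af : admissible b f.
Hypothesis f1 : normsq mu X f = 1%E.

Let ffin : (normsq mu X f < +oo)%E. Proof. by rewrite f1 ltry. Qed.
Let iw g1 g2 := rintegrable_weight cDel ca af ffin g1 g2.

Lemma wint_cvg (wn : nat -> Del -> Del -> C) (w : Del -> Del -> C) (M : R) g1 g2 :
  (forall n, bounded2 M (wn n)) -> bounded2 M w ->
  (forall x y (e : R), 0 < e -> exists N, forall n, (N <= n)%N ->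
    `|wn n x y - w x y| < e%:C) ->
  forall e : R, 0 < e -> exists N, forall n, (N <= n)%N ->
    `|wint (wn n) f g1 g2 - wint w f g1 g2| < e%:C.
Proof.
move=> wnM wM pw; have M0 : 0 <= M.
  by rewrite -ler0c; apply: le_trans (wM 1%g 1%g).
have w0 z : 0 <= f (a g1 z) * f (a g2 z) by rewrite mulr_ge0 ?(adm_ge0 af).
have E n z : `|integrand (wn n) f g1 g2 z - integrand w f g1 g2 z| =
    `|wn n (c (a g1 z)) (c (a g2 z)) - w (c (a g1 z)) (c (a g2 z))| *
    (f (a g1 z) * f (a g2 z))%:C.
  rewrite -mulrBl normrM; congr (_ * _); apply: ger0_norm.
  by rewrite ler0c.
apply: (cint_dominated mX (fun n => cmeas_integrand cDel ca af (wn n) g1 g2)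
  (cintegrable_integrand cDel ca af ffin g1 g2 wM) (rintegrableZ mX (2 * M) (iw g1 g2))).
  move=> n z _; rewrite E [leRHS]rmorphM /=; apply: ler_wpM2r; first by rewrite ler0c.
  apply: le_trans (ler_normB _ _) _.
  have -> : (2 * M)%:C = M%:C + M%:C by rewrite -rmorphD /= mulr2n mulrDl mul1r.
  by apply: lerD; [exact: wnM | exact: wM].
move=> z _ e e0; set t := f (a g1 z) * f (a g2 z) in E *.
have t1 : 0 < t + 1 by rewrite ltr_wpDl // /t.
have [N HN] := pw (c (a g1 z)) (c (a g2 z)) (e / (t + 1)) (divr_gt0 e0 t1).
exists N => n Nn; rewrite E -/t.
apply: (@le_lt_trans _ _ ((e / (t + 1))%:C * t%:C)).
  by apply: ler_wpM2r; [rewrite ler0c /t | exact: ltW (HN n Nn)].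
rewrite -rmorphM ltcR mulrAC ltr_pdivrMr // ltr_pM2l //.
by rewrite ltrDl.
Qed.

Lemma Rintegral_sqr1 g : \int[mu]_(z in X) (f (a g z) ^+ 2) = 1.
Proof.
have -> : \int[mu]_(z in X) (f (a g z) ^+ 2) = fine (normsq mu X (fun z => f (a g z))).
  by [].
by rewrite (normsq_translate cDel ca) // f1.
Qed.

(** The polarization identity for two unit vectors. *)
Lemma Rintegral_weight g1 g2 :
  \int[mu]_(z in X) (f (a g1 z) * f (a g2 z)) =
  1 - (\int[mu]_(z in X) ((f (a g1 z) - f (a g2 z)) ^+ 2)) / 2.
Proof.
have i1 := rintegrable_sqr cDel ca af ffin g1; have i2 := rintegrable_sqr cDel ca af ffin g2.
have -> : \int[mu]_(z in X) ((f (a g1 z) - f (a g2 z)) ^+ 2) =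
    \int[mu]_(z in X) ((f (a g1 z) ^+ 2 + f (a g2 z) ^+ 2) +
      (- 2) * (f (a g1 z) * f (a g2 z))).
  by apply: eq_Rintegral => z _; ring.
rewrite RintegralD //; last 2 first.
- exact: rintegrableD.
- exact: rintegrableZ.
rewrite RintegralD // RintegralZl //; last exact: iw.
rewrite (Rintegral_sqr1 g1) (Rintegral_sqr1 g2); by field.
Qed.

Lemma Rintegral_weight_le1 g1 g2 :
  \int[mu]_(z in X) (f (a g1 z) * f (a g2 z)) <= 1.
Proof.
rewrite Rintegral_weight gerBl divr_ge0 //.
by apply: Rintegral_ge0 => z _; apply: sqr_ge0.
Qed.

Lemma wint_bound w (M : R) g1 g2 : bounded2 M w -> 0 <= M ->
  `|wint w f g1 g2| <= (2 * M)%:C.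
Proof.
move=> wM M0.
have B z : X z -> `|integrand w f g1 g2 z| <= (M * (f (a g1 z) * f (a g2 z)))%:C.
  by move=> _; apply: norm_integrand.
have := cint_norm_bound mX (cintegrable_integrand cDel ca af ffin g1 g2 wM)
  (rintegrableZ mX M (iw g1 g2)) B.
move=> /le_trans; apply; rewrite lecR ler_wpM2l // RintegralZl //; last exact: iw.
by apply: ler_piMr => //; apply: Rintegral_weight_le1.
Qed.

Lemma integrandE (w : Del -> Del -> C) (h : T -> R) g1 g2 z :
  integrand w h g1 g2 z = w (c (a g1 z)) (c (a g2 z)) * (h (a g1 z) * h (a g2 z))%:C.
Proof. by []. Qed.

Lemma wint_cst1 g1 g2 : wint (fun _ _ => 1) f g1 g2 =
  (\int[mu]_(z in X) (f (a g1 z) * f (a g2 z)))%:C.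
Proof.
rewrite -cint_real //; apply: eq_cint => z _.
by rewrite integrandE mul1r.
Qed.

Lemma transfer1 u : u 1%g = 1 -> transfer f u 1%g = 1.
Proof.
move=> u1; have -> : transfer f u 1%g = cint mu X (fun z => (f (a 1%g z) ^+ 2)%:C).
  apply: eq_cint => z _.
  by rewrite integrandE /transfer_kernel invg1 mulgV u1 mul1r expr2.
by rewrite cint_real // Rintegral_sqr1.
Qed.

(** The constant kernel 1 has the integral on the right, and the convergence is
    dominated because the kernels are uniformly bounded. *)
Lemma transfer_cvg (un : nat -> Del -> C) (M : R) g :
  (forall n x, `|un n x| <= M%:C) ->
  (forall x (e : R), 0 < e -> exists N, forall n, (N <= n)%N -> `|un n x - 1| < e%:C) ->
  forall e : R, 0 < e -> exists N, forall n, (N <= n)%N ->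
    `|transfer f (un n) g - (\int[mu]_(z in X) (f (a (g^-1)%g z) * f (a 1%g z)))%:C| < e%:C.
Proof.
move=> uM pw; rewrite -wint_cst1.
apply: (@wint_cvg (fun n => transfer_kernel (un n)) _ (Num.max M 1)).
- move=> n x y; apply: le_trans (uM n _) _.
  by rewrite lecR le_max lexx.
- by move=> x y; rewrite normr1 lecR le_max lexx orbT.
- by move=> x y; apply: pw.
Qed.

Lemma transferB u v g M : (forall x, `|u x| <= M%:C) -> (forall x, `|v x| <= M%:C) ->
  transfer f (fun x => u x - v x) g = transfer f u g - transfer f v g.
Proof.
move=> uM vM.
have bu : bounded2 M (transfer_kernel u) by move=> x y; apply: uM.
have bv : bounded2 M (transfer_kernel v) by move=> x y; apply: vM.
have := (cint_linear mX (-1) (cintegrable_integrand cDel ca af ffin (g^-1)%g 1%g bv)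
  (cintegrable_integrand cDel ca af ffin (g^-1)%g 1%g bu)).2.
rewrite mulN1r addrC => <-; apply: eq_cint => z _.
by rewrite integrandE /transfer_kernel mulrBl mulN1r addrC.
Qed.

End Limits.

(** * Cut-off vectors and finite support *)

Section Cutoff.
Context (R : realType) (Gam Del : groupType) (d : measure_display)
  (T : measurableType d) (mu : {measure set T -> \bar R}).
Variables (a : Gam -> T -> T) (b : Del -> T -> T) (X Y : set T).
Hypothesis cGam : countable [set: Gam].
Hypothesis cDel : countable [set: Del].
Hypothesis ca : commuting_actions mu a b X.
Hypothesis fdY : fundamental_domain a Y.
Local Notation C := R[i].
Local Notation integrand := (integrand a b X).
Local Notation wint := (wint mu a b X).
Local Notation transfer := (transfer mu a b X).

Let mX : measurable X := measurable_fd (ca_fd ca).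

Variable f : T -> R.
Hypothesis af : admissible b f.
Hypothesis f1 : normsq mu X f = 1%E.

Let ffin : (normsq mu X f < +oo)%E. Proof. by rewrite f1 ltry. Qed.

Lemma normsq_le h : admissible b h -> (forall z, h z <= f z) ->
  (normsq mu X h <= 1)%E.
Proof.
move=> ah hf; rewrite -f1; apply: (rint_le ca).
- exact: rmeas_sqr (adm_meas ah).
- exact: rmeas_sqr (adm_meas af).
- by move=> z; apply: sqr_ge0.
- by move=> z; rewrite ler_sqr ?nnegrE ?(adm_ge0 ah) ?(adm_ge0 af).
Qed.

(** The products of translates satisfy 0 <= f f' - h h', and this difference is
    at most a combination of the squares of f - h and of f with weights 1 / (2 n)
    and n / 2, by the inequality between arithmetic and geometric means; the
    parameter [n] bounds the norm of [f - h]. *)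
Lemma wint_approx h w (M n : R) g1 g2 : admissible b h -> (forall z, h z <= f z) ->
  bounded2 M w -> 0 <= M -> 0 < n ->
  \int[mu]_(z in X) ((f z - h z) ^+ 2) <= n ^+ 2 ->
  `|wint w f g1 g2 - wint w h g1 g2| <= (2 * (M * (2 * n)))%:C.
Proof.
move=> ah hf wM M0 n0 D.
pose k z := f z - h z.
have ak : admissible b k.
  split; first by apply: measurable_funB; [exact: adm_meas af | exact: adm_meas ah].
    by move=> z; rewrite subr_ge0.
  by move=> y z; rewrite /k (adm_inv af) (adm_inv ah).
have kfin : (normsq mu X k < +oo)%E.
  apply: (@le_lt_trans _ _ 1%E); last exact: ltry.
  rewrite -f1; apply: (rint_le ca).
  - exact: rmeas_sqr (adm_meas ak).
  - exact: rmeas_sqr (adm_meas af).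
  - by move=> z; apply: sqr_ge0.
  - move=> z; rewrite ler_sqr ?nnegrE ?(adm_ge0 ak) ?(adm_ge0 af) //.
    by rewrite /k gerBl (adm_ge0 ah).
have hfin : (normsq mu X h < +oo)%E by apply: le_lt_trans (normsq_le ah hf) (ltry _).
have ik g := rintegrable_sqr cDel ca ak kfin g.
have i_f g := rintegrable_sqr cDel ca af ffin g.
have Dg g : \int[mu]_(z in X) (k (a g z) ^+ 2) <= n ^+ 2.
  apply: le_trans D; rewrite le_eqVlt; apply/orP; left; apply/eqP.
  have -> : \int[mu]_(z in X) (k (a g z) ^+ 2) = fine (normsq mu X (fun z => k (a g z))).
    by [].
  by rewrite (normsq_translate cDel ca).
pose q z := (2 * n)^-1 * (k (a g1 z) ^+ 2 + k (a g2 z) ^+ 2) +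
  n / 2 * (f (a g1 z) ^+ 2 + f (a g2 z) ^+ 2).
have j1 := rintegrableZ mX (2 * n)^-1 (rintegrableD mX (ik g1) (ik g2)).
have j2 := rintegrableZ mX (n / 2) (rintegrableD mX (i_f g1) (i_f g2)).
have iq : rintegrable mu X q := rintegrableD mX j1 j2.
have q_le z : f (a g1 z) * f (a g2 z) - h (a g1 z) * h (a g2 z) <= q z.
  rewrite /q; have := adm_ge0 ak (a g1 z); have := adm_ge0 ak (a g2 z).
  have := adm_ge0 ah (a g1 z); have := adm_ge0 ah (a g2 z); rewrite /k.
  set x := f (a g1 z); set y := f (a g2 z).
  set x' := h (a g1 z); set y' := h (a g2 z) => h1 h2 h3 h4.
  have n2 : 0 < 2 * n by rewrite mulr_gt0.
  rewrite -(ler_pM2l n2).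
  have -> : 2 * n * ((2 * n)^-1 * ((x - x') ^+ 2 + (y - y') ^+ 2) +
      n / 2 * (x ^+ 2 + y ^+ 2)) =
    (x - x') ^+ 2 + (y - y') ^+ 2 + ((n * x) ^+ 2 + (n * y) ^+ 2).
    by field; rewrite gt_eqF.
  have e1 := sqr_ge0 ((x - x') - n * y).
  have e2 := sqr_ge0 ((y - y') - n * x).
  have e3 : 0 <= n * ((x - x') * (y - y')) by rewrite !mulr_ge0 // ltW.
  rewrite -subr_ge0.
  have -> : (x - x') ^+ 2 + (y - y') ^+ 2 + ((n * x) ^+ 2 + (n * y) ^+ 2) -
      2 * n * (x * y - x' * y') =
    (x - x' - n * y) ^+ 2 + (y - y' - n * x) ^+ 2 + 2 * (n * ((x - x') * (y - y'))) by ring.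
  by rewrite !addr_ge0 // mulr_ge0.
have pos z : 0 <= f (a g1 z) * f (a g2 z) - h (a g1 z) * h (a g2 z).
  by rewrite subr_ge0 ler_pM ?(adm_ge0 ah).
have i1 := cintegrable_integrand cDel ca af ffin g1 g2 wM.
have i2 := cintegrable_integrand cDel ca ah hfin g1 g2 wM.
have [i3 E] := cint_linear mX (-1) i2 i1.
have -> : wint w f g1 g2 - wint w h g1 g2 =
    cint mu X (fun z => -1 * integrand w h g1 g2 z + integrand w f g1 g2 z).
  by rewrite E mulN1r addrC.
have B z : X z -> `|-1 * integrand w h g1 g2 z + integrand w f g1 g2 z| <= (M * q z)%:C.
  have p1 : 0 <= (f (a g1 z) * f (a g2 z) - h (a g1 z) * h (a g2 z))%:C.
    by rewrite ler0c.
  move=> _; rewrite mulN1r addrC !integrandE -mulrBr -rmorphB normrM (ger0_norm p1).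
  rewrite [leRHS]rmorphM /=.
  by apply: ler_pM; [exact: normr_ge0 | rewrite ler0c | exact: wM | rewrite lecR].
apply: le_trans (cint_norm_bound mX i3 (rintegrableZ mX M iq) B) _.
have qE : \int[mu]_(z in X) q z =
    (2 * n)^-1 * (\int[mu]_(z in X) (k (a g1 z) ^+ 2) + \int[mu]_(z in X) (k (a g2 z) ^+ 2))
    + n / 2 * (1 + 1).
  rewrite /q (RintegralD mX j1 j2) (RintegralZl _ mX (rintegrableD mX (ik g1) (ik g2))).
  rewrite (RintegralZl _ mX (rintegrableD mX (i_f g1) (i_f g2))).
  rewrite (RintegralD mX (ik g1) (ik g2)) (RintegralD mX (i_f g1) (i_f g2)).
  by rewrite (Rintegral_sqr1 cDel ca af f1 g1) (Rintegral_sqr1 cDel ca af f1 g2).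
rewrite lecR; apply: ler_wpM2l => //; rewrite (RintegralZl _ mX iq).
apply: ler_wpM2l => //; rewrite qE.
have := Dg g1; have := Dg g2.
set u := \int[mu]_(z in X) _; set v := \int[mu]_(z in X) _ => hu hv.
have : (2 * n)^-1 * (u + v) <= n.
  rewrite mulrC ler_pdivrMr ?mulr_gt0 //.
  apply: le_trans (lerD hu hv) _; rewrite le_eqVlt; apply/orP; left; apply/eqP; ring.
by lra.
Qed.

Section Sequence.
Variable idx : Gam -> nat.
Hypothesis idxI : injective idx.
Variable K : seq Del.

(** The indicator of the points whose translates by all elements of [K] are
    moved into Y by elements of [Gam] with index below [n]. *)
Definition cutoff n (x : T) : R :=
  \prod_(h <- K) (idx (cocyc a Y (b h x)) < n)%N%:R.

Lemma cutoff_bound n x : 0 <= cutoff n x <= 1.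
Proof.
rewrite /cutoff; elim: K => [|h L /andP[IH1 IH2]]; first by rewrite big_nil ler01 lexx.
rewrite big_cons; case: (_ < n)%N; first by rewrite mul1r IH1 IH2.
by rewrite mul0r lexx ler01.
Qed.

Lemma cutoff_neq0 n x h : cutoff n x != 0 -> h \in K ->
  (idx (cocyc a Y (b h x)) < n)%N.
Proof.
rewrite /cutoff => + hK; rewrite (big_rem h hK) /=; apply: contraNT => /negbTE ->.
by rewrite mul0r.
Qed.

Lemma cutoff_eventually x : exists N, forall n, (N <= n)%N -> cutoff n x = 1.
Proof.
rewrite /cutoff; elim: K => [|h L [N HN]]; first by exists 0%N => n _; rewrite big_nil.
exists (maxn N (idx (cocyc a Y (b h x))).+1) => n.
rewrite geq_max big_cons => /andP[Nn ->].
by rewrite HN // mulr1.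
Qed.

Lemma measurable_cutoff n : measurable_fun [set: T] (cutoff n).
Proof.
apply: measurable_prod => h _.
apply: (measurableT_comp (f := fun z => (idx (cocyc a Y z) < n)%N%:R : R)
  (g := b h)); last exact: (ca_right_mp ca h).1.
apply: (@measurable_countable_factor _ _ _ (cocyc a Y) _ _ (fun g => (idx g < n)%N%:R : R)) => //.
by move=> g; apply: (measurable_cocyc (ca_left ca) (fun h => (ca_left_mp ca h).1) fdY).
Qed.

(** The cut-off is evaluated at the representative in X to keep the product
    [b]-invariant. *)
Definition localized n (z : T) : R := f z * cutoff n (fd_rep b X z).

Lemma admissible_cut n : admissible b (localized n).
Proof.
split.
- apply: measurable_funM; first exact: adm_meas af.
  apply: (measurableT_comp (measurable_cutoff n)).
  by apply: (measurable_fd_rep (ca_right ca) (fun h => (ca_right_mp ca h).1) cDel (ca_fd ca)).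
- by move=> z; have /andP[h _] := cutoff_bound n (fd_rep b X z); rewrite mulr_ge0 ?(adm_ge0 af).
- by move=> h z; rewrite /localized (adm_inv af) (fd_rep_act (ca_right ca) (ca_fd ca)).
Qed.

Lemma cut_le n z : localized n z <= f z.
Proof.
have /andP[_ h] := cutoff_bound n (fd_rep b X z).
by rewrite /localized ler_piMr ?(adm_ge0 af).
Qed.

(** The cut-off functions tend to 1 pointwise, and the square of [f] dominates
    the squared distance. *)
Lemma cut_dist_cvg (e : R) : 0 < e -> exists n,
  \int[mu]_(z in X) ((f z - localized n z) ^+ 2) < e.
Proof.
move=> e0.
have m0 n : measurable_fun X (fun z => (f z - localized n z) ^+ 2).
  apply: measurable_funS (rmeas_sqr _) => //.
  by apply: measurable_funB; [exact: adm_meas af | exact: adm_meas (admissible_cut n)].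
have iH : rintegrable mu X (fun z => f z ^+ 2).
  have := rintegrable_sqr cDel ca af ffin 1%g.
  by congr rintegrable; apply/funext => z; rewrite (act1 (ca_left ca)).
have [||||N HN] := @cint_dominated R d T mu X mX
  (fun n z => ((f z - localized n z) ^+ 2)%:C) (fun=> 0) (fun z => f z ^+ 2) _ _ iH _ _ e e0.
- by move=> n; split; [exact: m0 | exact: (measurable_cst (0 : R))].
- exact: cintegrable0.
- move=> n z _; rewrite subr0 ger0_norm ?ler0c ?sqr_ge0 // lecR.
  have := cut_le n z; have := adm_ge0 (admissible_cut n) z; have := adm_ge0 af z.
  move=> h1 h2 h3; rewrite ler_sqr ?nnegrE ?subr_ge0 //; lra.
- move=> z _ e' e'0; have [N HN] := cutoff_eventually (fd_rep b X z).
  exists N => n Nn; rewrite /localized HN // mulr1 subrr expr0n /= subr0 normr0.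
  by rewrite ltcR.
exists N; have := HN N (leqnn _); rewrite cint0 // subr0 cint_real //.
rewrite ger0_norm ?ltcR // ler0c; apply: Rintegral_ge0 => z _; exact: sqr_ge0.
Qed.

Lemma wint_cut_approx (M e : R) : 0 <= M -> 0 < e ->
  exists n, forall w g1 g2, bounded2 M w ->
    `|wint w f g1 g2 - wint w (localized n) g1 g2| <= e%:C.
Proof.
move=> M0 e0; pose r := e / (4 * (M + 1)).
have M1 : 0 < M + 1 by rewrite ltr_wpDl.
have r0 : 0 < r by rewrite divr_gt0 // mulr_gt0.
have [n Hn] := cut_dist_cvg (exprn_gt0 2 r0).
exists n => w g1 g2 wM.
apply: le_trans (wint_approx g1 g2 (admissible_cut n) (cut_le n) wM M0 r0 (ltW Hn)) _.
have -> : 2 * (M * (2 * r)) = e * (M / (M + 1)).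
  by rewrite /r; field; rewrite gt_eqF.
by rewrite lecR ler_piMr ?(ltW e0) // ler_pdivrMr // mul1r lerDl.
Qed.

(** Suppose the integrand is not zero at [z] in X, and let y = g^-1 z.  As [u]
    does not vanish at k = (c y)^-1, which moves the representative of [y] in X
    back to [y], the cut-off at that representative restricts the element of
    [Gam] that moves [y] into Y to a finite set; the cut-off at [z], for
    the identity in [K], does the same for [z].  These two elements determine
    [g]. *)
Lemma transfer_cut_finite_support u n : 1%g \in K ->
  (forall h, u h != 0 -> h \in K) ->
  finite_set [set g | transfer (localized n) u g != 0].
Proof.
move=> K1 uK.
pose A : set Gam := [set g | (idx g < n)%N].
have fA : finite_set A.
  apply: (@finite_preimage _ _ `I_n idx) => //.
  by move=> x y _ _; apply: idxI.
apply: (@sub_finite_set _ _ [set (x^-1 * y)%g | x in A & y in A]); last exact: finite_image2.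
move=> g /= tg; apply: contrapT => ng; move/eqP: tg; apply.
have -> : transfer (localized n) u g = cint mu X (fun=> 0); last exact: cint0.
apply: eq_cint => z Xz.
rewrite integrandE /transfer_kernel (act1 (ca_left ca)).
rewrite (cocyc_fd (ca_right ca) (ca_fd ca) Xz) mul1g.
set y := a (g^-1)%g z.
apply/eqP; apply: contrapT => /negP; rewrite mulf_eq0 negb_or => /andP[/uK yK].
rewrite eq_complex /= eqxx andbT mulf_eq0 negb_or /localized => /andP[].
rewrite !mulf_eq0 !negb_or => /andP[_ cy] /andP[_ cz].
have := cutoff_neq0 cy yK.
rewrite /fd_rep (actK (ca_right ca)) => Ay.
move: cz; rewrite (fd_rep_id (ca_right ca) (ca_fd ca) Xz) => cz.
have := cutoff_neq0 cz K1; rewrite (act1 (ca_right ca)) => Az.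
apply: ng; exists (cocyc a Y z) => //; exists (cocyc a Y y) => //.
by rewrite /y (cocyc_act (ca_left ca) fdY) invgK mulKg.
Qed.

End Sequence.
End Cutoff.

(** * Approximation properties pass to the other group *)

Section OneSided.
Context (R : realType) (Gam Del : groupType) (d : measure_display)
  (T : measurableType d) (mu : {measure set T -> \bar R}).
Variables (a : Gam -> T -> T) (b : Del -> T -> T) (X Y : set T).
Hypothesis cGam : countable [set: Gam].
Hypothesis cDel : countable [set: Del].
Hypothesis ca : commuting_actions mu a b X.
Hypothesis fdY : fundamental_domain a Y.
Hypothesis sf : sigma_finite [set: T] mu.
Hypothesis am : amenable_pair mu X (quotient_action b X a).
Local Notation C := R[i].
Local Notation transfer := (transfer mu a b X).

Let mX : measurable X := measurable_fd (ca_fd ca).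

(** A bound on the total displacement bounds each of its terms, and both sides
    scale alike under normalization. *)
Lemma unit_almost_invariant (S : seq Gam) (k : R) : 0 < k ->
  exists f, [/\ admissible b f, normsq mu X f = 1%E &
    forall s, s \in S -> \int[mu]_(z in X) ((f (a s z) - f z) ^+ 2) <= k].
Proof.
move=> k0; have [m mm] := amenable_pair_mean ca am.
have [f [af ffin fk]] := almost_invariant_vectors cDel ca mm S sf k0.
have nE : normsq mu X f = (fine (normsq mu X f))%:E.
  by rewrite fineK // ge0_fin_numE ?normsq_ge0.
set n := fine _ in nE.
have n0 : 0 < n.
  rewrite lt_def -lee_fin -nE normsq_ge0 andbT; apply/eqP => n0.
  move: fk; rewrite nE n0 mule0 ltNge => /negP; apply.
  by apply: rint_ge0 => z; apply: displacement_ge0.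
pose r := (Num.sqrt n)^-1.
have r0 : 0 < r by rewrite invr_gt0 sqrtr_gt0.
have r2 : r ^+ 2 = n^-1 by rewrite exprVn sqr_sqrtr // ltW.
have [mf f0 fi] := af.
exists (fun z => r * f z); split.
- split.
  + by apply: measurable_funM => //; exact: measurable_cst.
  + by move=> z; rewrite mulr_ge0 // ltW.
  + by move=> h z; rewrite fi.
- have -> : normsq mu X (fun z => r * f z) = ((r ^+ 2)%:E * normsq mu X f)%E.
    rewrite -(rintZ ca (rmeas_sqr mf)) ?sqr_ge0 //; last by move=> z; apply: sqr_ge0.
    by congr (rint mu X _); apply/funext => z; rewrite exprMn.
  by rewrite nE -EFinM r2 mulVf // gt_eqF.
move=> s sS.
have mt : rmeas (fun z => (f (a s z) - f z) ^+ 2).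
  by apply: measurable_funX; apply: measurable_funB => //; apply: (rmeas_translate ca).
have le : (rint mu X (fun z => ((f (a s z) - f z) ^+ 2)%R) <= (k * n)%:E)%E.
  apply: le_trans (ltW _); last by rewrite EFinM -nE; exact: fk.
  apply: (rint_le ca) => //; first exact: (rmeas_displacement ca).
    by move=> z; apply: sqr_ge0.
  move=> z; rewrite /displacement (big_rem s) //= lerDl.
  by apply: sumr_ge0 => t _; apply: sqr_ge0.
have E : (rint mu X (fun z => ((r * f (a s z) - r * f z) ^+ 2)%R) <= k%:E)%E.
  have -> : (fun z => (r * f (a s z) - r * f z) ^+ 2) =
      (fun z => r ^+ 2 * (f (a s z) - f z) ^+ 2).
    by apply/funext => z; rewrite -mulrBr exprMn.
  rewrite (rintZ ca mt) ?sqr_ge0 //; last by move=> z; apply: sqr_ge0.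
  apply: le_trans (lee_wpmul2l _ le) _; first by rewrite lee_fin sqr_ge0.
  by rewrite -EFinM lee_fin r2 mulrCA mulVf ?mulr1 // gt_eqF.
rewrite /Rintegral -lee_fin fineK //.
rewrite ge0_fin_numE; first exact: le_lt_trans E (ltry _).
by apply: rint_ge0 => z; apply: sqr_ge0.
Qed.

(** First choose an almost invariant [f]; the index of [un] may depend on it. *)
Lemma transfer_approx (un : nat -> Del -> C) (M : R) (F : seq Gam) (e : R) :
  (forall n x, `|un n x| <= M%:C) ->
  (forall x (e : R), 0 < e -> exists N, forall n, (N <= n)%N -> `|un n x - 1| < e%:C) ->
  0 < e ->
  exists f, [/\ admissible b f, normsq mu X f = 1%E &
    exists n, forall g, g \in F -> `|transfer f (un n) g - 1| < e%:C].
Proof.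
move=> uM pw e0.
have [f [af f1 fF]] := unit_almost_invariant [seq (g^-1)%g | g <- F] e0.
exists f; split => //.
have e2 : 0 < e / 2 by rewrite divr_gt0.
have near1 g : g \in F ->
    `|(\int[mu]_(z in X) (f (a (g^-1)%g z) * f (a 1%g z)))%:C - 1| <= (e / 2)%:C.
  move=> gF; rewrite (Rintegral_weight cDel ca af f1).
  have := fF _ (map_f _ gF).
  have -> : \int[mu]_(z in X) ((f (a (g^-1)%g z) - f (a 1%g z)) ^+ 2) =
      \int[mu]_(z in X) ((f (a (g^-1)%g z) - f z) ^+ 2).
    by apply: eq_Rintegral => z _; rewrite (act1 (ca_left ca)).
  have : 0 <= \int[mu]_(z in X) ((f (a (g^-1)%g z) - f z) ^+ 2).
    by apply: Rintegral_ge0 => z _; apply: sqr_ge0.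
  set x := Rintegral _ _ _ => x0 xe.
  rewrite rmorphB rmorph1 addrC addKr normrN ger0_norm; last by rewrite ler0c divr_ge0.
  by rewrite lecR ler_wpM2r // invr_ge0.
have [N HN] : exists N, forall g, g \in F ->
    `|transfer f (un N) g - (\int[mu]_(z in X) (f (a (g^-1)%g z) * f (a 1%g z)))%:C|
      < (e / 2)%:C.
  have : exists N, forall n, (N <= n)%N -> forall g, g \in F ->
    `|transfer f (un n) g - (\int[mu]_(z in X) (f (a (g^-1)%g z) * f (a 1%g z)))%:C|
      < (e / 2)%:C.
    elim: (F) => [|g L [N HN]]; first by exists 0%N.
    have [N' HN'] := transfer_cvg cDel ca af f1 g uM pw e2.
    exists (maxn N N') => n; rewrite geq_max => /andP[Nn N'n] h.
    by rewrite inE => /predU1P[-> | hL]; [exact: HN' | exact: HN].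
  by move=> [N HN]; exists N; apply: HN.
exists N => g gF.
pose w : C := (\int[mu]_(z in X) (f (a (g^-1)%g z) * f (a 1%g z)))%:C.
have -> : transfer f (un N) g - 1 = (transfer f (un N) g - w) + (w - 1) by ring.
apply: le_lt_trans (ler_normD _ _) _.
rewrite [e]splitr rmorphD; apply: ltr_leD; [exact: HN | exact: near1].
Qed.

(** Split [u] into a finitely supported and a uniformly small function.  The
    transfer of the second one is uniformly small, and that of the first one
    is uniformly close to a finitely supported function. *)
Lemma transfer_C0 f u (M : R) : admissible b f -> normsq mu X f = 1%E ->
  (forall x, `|u x| <= M%:C) -> C0 u -> C0 (transfer f u).
Proof.
move=> af f1 uM u0 e e0.
have ffin : (normsq mu X f < +oo)%E by rewrite f1 ltry.
have M0 : 0 <= M by rewrite -ler0c; apply: le_trans (uM 1%g).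
have e8 : 0 < e / 8 by rewrite divr_gt0.
pose K := fset_set [set h | (e / 8)%:C <= `|u h|].
have KE h : (h \in K) = ((e / 8)%:C <= `|u h|).
  have fK : finite_set [set h | (e / 8)%:C <= `|u h|] := u0 _ e8.
  by rewrite in_fset_set //; apply/idP/idP; rewrite inE.
pose u1 h := if h \in K then u h else 0.
pose u2 h := if h \in K then 0 else u h.
have u1M h : `|u1 h| <= M%:C by rewrite /u1; case: ifP => // _; rewrite normr0 ler0c.
have u2M h : `|u2 h| <= M%:C by rewrite /u2; case: ifP => // _; rewrite normr0 ler0c.
have u2e h : `|u2 h| <= (e / 8)%:C.
  rewrite /u2; case: ifP => [_|]; first by rewrite normr0 ler0c ltW.
  rewrite KE => /negbT; rewrite -real_ltNge ?normr_real //; first exact: ltW.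
  by apply: ger0_real; rewrite ler0c ltW.
have [idx idxI] := countable_inj cGam.
pose Ks : seq Del := 1%g :: K.
have [j Hj] := wint_cut_approx cGam cDel ca fdY af f1 idx Ks M0 (divr_gt0 e0 (ltr0Sn _ 3)).
have fin : finite_set [set g | transfer (localized a b X Y f idx Ks j) u1 g != 0].
  apply: (transfer_cut_finite_support ca fdY f idxI); first exact: mem_head.
  move=> h; rewrite /u1; case: ifP => [hK _|_]; last by rewrite eqxx.
  by rewrite inE hK orbT.
apply: sub_finite_set fin => g /= eg; apply/eqP => tz.
have uE : transfer f u g = transfer f u1 g + transfer f u2 g.
  have -> : u1 = (fun h => u h - u2 h).
    by apply/funext => h; rewrite /u1 /u2; case: ifP => _; rewrite ?subr0 ?subrr.
  by rewrite (transferB cDel ca af f1 g uM u2M) subrK.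
have b2 : `|transfer f u2 g| <= (2 * (e / 8))%:C.
  apply: (wint_bound cDel ca af f1); last exact: ltW.
  by move=> x y; apply: u2e.
have b1 : `|transfer f u1 g| <= (e / 4)%:C.
  have := Hj (transfer_kernel u1) (g^-1)%g 1%g (fun x y => u1M _).
  have -> : wint mu a b X (transfer_kernel u1) (localized a b X Y f idx Ks j) (g^-1)%g 1%g = 0.
    exact: tz.
  by rewrite subr0.
move: eg; rewrite uE => eg.
have := le_trans eg (le_trans (ler_normD _ _) (lerD b1 b2)).
rewrite -rmorphD lecR; apply/negP; rewrite -ltNge.
lra.
Qed.

(** Enumerating the countable group turns approximation on each finite set into
    a sequence. *)
Lemma sequence_of_approximants (P : (Gam -> C) -> Prop) :
  (forall (F : seq Gam) (e : R), 0 < e ->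
     exists2 v, P v & forall g, g \in F -> `|v g - 1| < e%:C) ->
  exists v : nat -> Gam -> C, (forall n, P (v n)) /\ cvg_to_one v.
Proof.
move=> H; have [idx idxI] := countable_inj cGam.
have fin n : finite_set [set g | (idx g < n)%N].
  by apply: (@finite_preimage _ _ `I_n idx) => // x y _ _; apply: idxI.
have He n : 0 < n.+1%:R^-1 :> R by rewrite invr_gt0.
have [v Hv] := choice (fun n => let: ex_intro2 v p q :=
  H (fset_set [set g | (idx g < n)%N]) _ (He n) in ex_intro (fun v => P v /\ _) v (conj p q)).
exists v; split=> [n|K fK e e0]; first exact: (Hv n).1.
pose N1 := (\max_(g <- fset_set K) (idx g).+1)%N.
pose N2 := (Num.truncn e^-1).+1.
exists (maxn N1 N2) => // n /=; rewrite geq_max => /andP[n1 n2] g Kg.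
apply: (@lt_le_trans _ _ (n.+1%:R^-1)%:C).
  apply: (Hv n).2; rewrite in_fset_set // inE /=.
  apply: leq_trans n1; rewrite /N1 (big_fsetD1 g) /=; first exact: leq_maxl.
  by rewrite in_fset_set // inE.
rewrite lecR invf_ple ?posrE ?ltr0n //.
apply: le_trans (_ : N2%:R <= _); last by rewrite ler_nat leqW.
by apply: ltW; apply: Num.Theory.truncnS_gt.
Qed.

Lemma cvg_to_one_pointwise (G : groupType) (u : nat -> G -> C) : cvg_to_one u ->
  forall x (e : R), 0 < e -> exists N, forall n, (N <= n)%N -> `|u n x - 1| < e%:C.
Proof.
move=> cu x e e0; have [N _ HN] := cu [set x] (finite_set1 x) e e0.
by exists N => n Nn; apply: HN.
Qed.

(** A normalized positive definite function is bounded by 1, and the transfer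
    along a unit vector is normalized. *)
Lemma haagerup_transfer : haagerup R Del -> haagerup R Gam.
Proof.
move=> [u [u1 up u0 uc]].
have uM n x : `|u n x| <= 1%:C.
  have K := (positive_definite_psd (u n)).1 (up n).
  have := psd_bound K (c := 1) (s := x) (t := 1%g).
  by rewrite ?invg1 ?mul1g ?mulVg !u1; apply; rewrite rmorph1.
have [|v [vP vc]] := @sequence_of_approximants (fun v =>
    [/\ v 1%g = 1, positive_definite v & C0 v]).
  move=> F e e0.
  have [f [af f1 [n fn]]] := transfer_approx F uM (cvg_to_one_pointwise uc) e0.
  have ffin : (normsq mu X f < +oo)%E by rewrite f1 ltry.
  exists (transfer f (u n)) => //; split.
  - by apply: (transfer1 cDel ca af f1).
  - exact: (positive_definite_transfer cDel ca af ffin).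
  - by apply: (transfer_C0 af f1 (uM n)).
by exists v; split => // n; case: (vP n).
Qed.

Lemma B2_norm_le_approx (G : groupType) (u : G -> C) (c : R) : countable [set: G] ->
  (forall e : R, 0 < e -> herz_schur_le (c + e) (c + e) u) -> (B2_norm u <= c%:E)%E.
Proof.
move=> cG H; apply/lee_addgt0Pr => e e0; rewrite -EFinD.
exact: herz_schur_B2_norm (H e e0).
Qed.

Lemma herz_schur_of_B2_norm_le (G : groupType) (u : G -> C) (c e : R) :
  (B2_norm u <= c%:E)%E -> 0 < e -> herz_schur_le (c + e) (c + e) u.
Proof.
move=> uc e0; apply: B2_norm_herz_schur; apply: le_lt_trans uc _.
by rewrite lte_fin ltrDl.
Qed.

(** The norm of a multiplier is an infimum, so bounds by kernels hold with an
    arbitrarily small loss [e']; it is removed after the transfer. *)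
Lemma Lambda_WH_transfer : (Lambda_WH R Gam <= Lambda_WH R Del)%E.
Proof.
apply: ereal_inf_le_tmp => _ [c [c1 [u [ub uc u1]]] <-]; exists c => //; split => //.
have hs n e : 0 < e -> herz_schur_le (c + e) (c + e) (u n).
  by move=> e0; apply: herz_schur_of_B2_norm_le.
have uM n x : `|u n x| <= (c + 1)%:C by apply: herz_schur_bound; apply: hs.
have [|v [vP vc]] := @sequence_of_approximants (fun v =>
    (B2 v /\ C0 v) /\ (B2_norm v <= c%:E)%E).
  move=> F e e0.
  have [f [af f1 [n fn]]] := transfer_approx F uM (cvg_to_one_pointwise u1) e0.
  have ffin : (normsq mu X f < +oo)%E by rewrite f1 ltry.
  have fle : (normsq mu X f <= 1)%E by rewrite f1.
  have ht e' : 0 < e' -> herz_schur_le (c + e') (c + e') (transfer f (u n)).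
    by move=> e'0; apply: (herz_schur_transfer cDel ca af ffin fle); apply: hs.
  exists (transfer f (u n)) => //; split; [split|].
  - exact: herz_schur_B2 (ht 1 ltr01).
  - by apply: (transfer_C0 af f1 (uM n)); case: (ub n).
  - exact: B2_norm_le_approx.
exists v; split => // n; first by case: (vP n).
by case: (vP n).
Qed.

(** The functions [u n] are first replaced by finitely supported ones at a cost
    of [e] in the norm; their transfers along cut-off vectors are finitely
    supported, hence in the Fourier algebra. *)
Lemma Lambda_WA_transfer : (Lambda_WA R Gam <= Lambda_WA R Del)%E.
Proof.
apply: le_ereal_inf_tmp => _ [c [c1 [u [uA uc u1]]] <-].
apply/lee_addgt0Pr => e e0; rewrite -EFinD.
apply: ereal_inf_lbound; exists (c + e) => //; split.
  by apply: le_trans c1 _; rewrite lerDl ltW.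
pose d_ n : R := Num.min (e / 2) n.+1%:R^-1.
have d0 n : 0 < d_ n by rewrite lt_min !divr_gt0 //= invr_gt0.
have [v Hv] := choice (fun n => fourier_finite_approx cDel (uA n) (d0 n)).
have e2 : 0 < e / 2 by rewrite divr_gt0.
have hs n : herz_schur_le (c + e) (c + e) (v n).
  have h1 := herz_schur_of_B2_norm_le (uc n) e2.
  have h2 := herz_schur_leN (Hv n).2.
  have := herz_schur_leD h1 h2.
  have -> : (fun g => u n g + - (u n g - v n g)) = v n.
    by apply/funext => g; rewrite opprB addrC subrK.
  have de : d_ n <= e / 2 by rewrite ge_min lexx.
  by apply: herz_schur_leW; rewrite -addrA lerD2l [leRHS]splitr lerD2l.
have vM n x : `|v n x| <= (c + e)%:C by apply: herz_schur_bound; apply: hs.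
have v1 x (k : R) : 0 < k -> exists N, forall n, (N <= n)%N -> `|v n x - 1| < k%:C.
  move=> k0; have k2 : 0 < k / 2 by rewrite divr_gt0.
  have [N HN] := cvg_to_one_pointwise u1 x k2.
  exists (maxn N (Num.truncn (k / 2)^-1).+1) => n; rewrite geq_max => /andP[Nn n2].
  have -> : v n x - 1 = - (u n x - v n x) + (u n x - 1) by ring.
  apply: le_lt_trans (ler_normD _ _) _; rewrite normrN [k]splitr rmorphD.
  apply: ler_ltD; last exact: HN.
  apply: le_trans (herz_schur_bound x (Hv n).2) _; rewrite lecR.
  apply: (@le_trans _ _ n.+1%:R^-1); first by rewrite ge_min lexx orbT.
  rewrite invf_ple ?posrE ?ltr0n //.
  apply: le_trans (_ : (Num.truncn (k / 2)^-1).+1%:R <= _); last by rewrite ler_nat leqW.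
  by apply: ltW; apply: Num.Theory.truncnS_gt.
have [|w [wP wc]] := @sequence_of_approximants (fun w =>
    fourier_algebra w /\ (B2_norm w <= (c + e)%:E)%E).
  move=> F k k0; have k2 : 0 < k / 2 by rewrite divr_gt0.
  have [f [af f1 [n fn]]] := transfer_approx F vM v1 k2.
  have [idx idxI] := countable_inj cGam.
  pose K := fset_set [set h | v n h != 0].
  have fK : finite_set [set h | v n h != 0] := (Hv n).1.
  have KE h : v n h != 0 -> h \in (1%g :: K : seq Del).
    by move=> vh; rewrite inE in_fset_set // mem_set ?orbT.
  pose M := c + e; have M0 : 0 <= M.
    by rewrite -ler0c; apply: le_trans (vM 0%N 1%g).
  have [j Hj] := wint_cut_approx cGam cDel ca fdY af f1 idx (1%g :: K) M0
    (divr_gt0 k0 (ltr0Sn _ 3)).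
  have ac := admissible_cut cGam cDel ca fdY af idx (1%g :: K) j.
  have cle := cut_le a X Y af idx (1%g :: K) j.
  pose h := localized a b X Y f idx (1%g :: K) j.
  have hle : (normsq mu X h <= 1)%E := normsq_le ca af f1 ac cle.
  have hfin : (normsq mu X h < +oo)%E by apply: le_lt_trans hle (ltry _).
  exists (transfer h (v n)).
    split.
      apply: fourier_of_finite_support.
      by apply: (transfer_cut_finite_support ca fdY f idxI); first exact: mem_head.
    by apply: herz_schur_B2_norm => //; apply: (herz_schur_transfer cDel ca ac hfin hle).
  move=> g gF.
  have b1 : `|transfer f (v n) g - transfer h (v n) g| <= (k / 4)%:C.
    exact: (Hj (transfer_kernel (v n)) (g^-1)%g 1%g (fun x y => vM n _)).
  have -> : transfer h (v n) g - 1 =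
    - (transfer f (v n) g - transfer h (v n) g) + (transfer f (v n) g - 1) by ring.
  apply: le_lt_trans (ler_normD _ _) _; rewrite normrN [k]splitr rmorphD.
  apply: ler_ltD; last exact: fn.
  apply: le_trans b1 _; rewrite lecR.
  lra.
by exists w; split => // n; case: (wP n).
Qed.

End OneSided.

(** * The two orders of the actions of a coupling *)

Section Coupling.
Context (R : realType) (Gam Del : groupType) (d : measure_display)
  (T : measurableType d) (sigma : {measure set T -> \bar R}).
Variables (l : Gam -> T -> T) (r : T -> Del -> T) (X Y : set T).
Hypothesis cpl : amenable_coupling sigma l r X Y.

Lemma left_of_right_action : left_action_on [set: T] (left_of_right r).
Proof.
have [r1 rM] := coupling_right cpl; rewrite /left_of_right; split=> //.
  by move=> z _; rewrite invg1.
by move=> g h z _; rewrite invgM rM.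
Qed.

Lemma commuting_actions_lr : commuting_actions sigma l (left_of_right r) X.
Proof.
split.
- exact: coupling_left cpl.
- exact: left_of_right_action.
- by move=> g h z; apply: (coupling_commute cpl).
- exact: coupling_left_mp cpl.
- by move=> h; apply: (coupling_right_mp cpl).
- exact: coupling_right_domain cpl.
Qed.

Lemma commuting_actions_rl : commuting_actions sigma (left_of_right r) l Y.
Proof.
split.
- exact: left_of_right_action.
- exact: coupling_left cpl.
- by move=> h g z; rewrite [RHS](coupling_commute cpl).
- by move=> h; apply: (coupling_right_mp cpl).
- exact: coupling_left_mp cpl.
- exact: coupling_left_domain cpl.
Qed.

End Coupling.

Theorem theorem1p10 (R : realType) (Gam Del : groupType)
    (countable_Gam : countable [set: Gam]%classic)
    (countable_Del : countable [set: Del]%classic)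
    (ame : amenably_measure_equivalent R Gam Del) :
  (haagerup R Gam <-> haagerup R Del) /\
  (Lambda_WA R Gam = Lambda_WA R Del /\ Lambda_WH R Gam = Lambda_WH R Del).
Proof.
have [d [T [sigma [l [r [X [Y cpl]]]]]]] := ame.
have clr := commuting_actions_lr cpl; have crl := commuting_actions_rl cpl.
have sf := coupling_sigma_finite cpl.
have [dX dY] := (coupling_right_domain cpl, coupling_left_domain cpl).
have [aX aY] := (coupling_left_amenable cpl, coupling_right_amenable cpl).
split; [split | split].
- exact: (haagerup_transfer countable_Del countable_Gam crl dX sf aY).
- exact: (haagerup_transfer countable_Gam countable_Del clr dY sf aX).
- apply/eqP; rewrite eq_le (Lambda_WA_transfer countable_Gam countable_Del clr dY sf aX).
  exact: (Lambda_WA_transfer countable_Del countable_Gam crl dX sf aY).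
- apply/eqP; rewrite eq_le (Lambda_WH_transfer countable_Gam countable_Del clr dY sf aX).
  exact: (Lambda_WH_transfer countable_Del countable_Gam crl dX sf aY).
Qed.
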